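(* Let \[ F(\lambda)=r_1(\lambda)\int_{-1}^1\frac{d\sigma(t)}{t-\lambda}+r_2(\lambda)=-\sum_{j=0}^\infty\frac{s_j}{\lambda^{j+1}},\qquad |\lambda|>R, \] where $\sigma$ is a finite nonnegative measure on $[-1,1]$, $r_1=q_1/w_1$ is a rational function ($q_1,w_1$ polynomials, $\deg q_1\le\deg w_1$) which is nonnegative for real $\lambda$, and $r_2=q_2/w_2$ is a real rational function with $\deg q_2<\deg w_2$. Let $n_j$, $b_j$, $P_j$ and $\mathcal N_F$ be the normal indices, numbers, polynomials and index set associated with $\mathbf s=\{s_j\}_{j=0}^\infty$. If \[ \sup_{n_j\in\mathcal N_F}\left|b_{j-1}\frac{P_j(0)}{P_{j-1}(0)}\right|<\infty, \] then there exists a constant $\varepsilon>0$ such that the sequence of Padé approximants $\{F^{[n_j/n_j-1]}\}_{n_j\in\mathcal N_F}$ converges to $F$ locally uniformly in $\mathbb C\setminus([-1-\varepsilon,1+\varepsilon]\cup\mathcal P(F))$, where $\mathcal P(F)$ is the set of poles of $F$.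
   Context: Padé approximants. For $F(\lambda)\sim-\sum_{j\ge0}s_j\lambda^{-j-1}$ with $s_j\in\mathbb R$, the $[L/M]$ Padé approximant is a ratio $F^{[L/M]}(\lambda)=A(1/\lambda)/B(1/\lambda)$ of polynomials with $\deg A\le L$, $\deg B\le M$, $B(0)\ne0$ and \[ \sum_{j=0}^{L+M-1}\frac{s_j}{\lambda^{j+1}}+F^{[L/M]}(\lambda)=O\!\left(\lambda^{-(L+M+1)}\right),\quad\lambda\to\infty . \] Normal indices. $\mathcal N(\mathbf s)=\{n_1<n_2<\dots\}$ is the set of all $n\in\mathbb N$ with $\det(s_{i+k})_{i,k=0}^{n-1}\neq0$; put $n_0=0$. It is assumed throughout that $\det(s_{i+k})_{i,k=0}^{n-1}\ne0$ for all sufficiently large $n$. Associated polynomials. Put $F_0=F/|s_{n_1-1}|$ (as a formal series in $1/\lambda$). Inductively there are unique $\varepsilon_j\in\{1,-1\}$, $b_j>0$, real monic polynomials $p_j$ of degree $k_j=n_{j+1}-n_j$, and series $F_{j+1}$ in $1/\lambda$ without constant term whose first nonzero coefficient has modulus $1$, such that $-1/F_j=\varepsilon_jp_j+b_j^2F_{j+1}$, $j\ge0$. Put $\tilde b_j=\varepsilon_j\varepsilon_{j+1}b_j$ and $\tilde b_{-1}=\varepsilon_0$. The polynomials $P_j$ are defined by $P_{-1}=0$, $P_0=1$, $\tilde b_{j-1}P_{j-1}(\lambda)-p_j(\lambda)P_j(\lambda)+b_jP_{j+1}(\lambda)=0$, $j\ge0$; then $\deg P_j=n_j$. Index set. $\mathcal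 N_F=\{n_j\in\mathcal N(\mathbf s):P_{j-1}(0)\neq0\}$ (an infinite set). It is a known fact that $F^{[n_j/n_j-1]}$ exists if and only if $n_j\in\mathcal N_F$. *)

(* Defs.v *)
From HB Require Import structures.
From mathcomp Require Import all_boot all_order all_algebra.
From mathcomp Require Import complex.
From mathcomp Require Import all_classical all_reals all_analysis.

Set Implicit Arguments.
Unset Strict Implicit.
Unset Printing Implicit Defensive.

Import Order.TTheory GRing.Theory Num.Theory.
Import numFieldNormedType.Exports.

Local Open Scope classical_set_scope.
Local Open Scope ring_scope.
Local Open Scope complex_scope.

(* R[i] with the topology of its modulus. *)
HB.instance Definition _ (R : rcfType) := NormedModule.copy R[i] R[i]^o.

Section MomentSequence.
Variable R : realType.
Implicit Types (s : nat -> R) (n : nat -> nat) (eps b : nat -> R)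
  (p : nat -> {poly R}) (f : nat -> nat -> R).

Definition hankel s (m : nat) : 'M[R]_m := \matrix_(i < m, k < m) s (i + k)%N.

(* [n 0 = 0] is a convention: 0 does not count as a normal index. *)
Definition normal_indices s n : Prop :=
  [/\ n 0%N = 0%N,
      {homo n : i j / (i < j)%N} &
      forall m, (0 < m)%N ->
        (\det (hankel s m) != 0 <-> exists2 j, (0 < j)%N & n j = m)].

(* A formal series in 1/lambda is given by its coefficients: [g m] is the
   coefficient of lambda^-m. *)
Definition series_mul (g h : nat -> R) (m : nat) : R :=
  \sum_(i < m.+1) g i * h (m - i)%N.

Definition unit_leading (g : nat -> R) : Prop :=
  exists2 m, `|g m| = 1 & forall i, (i < m)%N -> g i = 0.

(* lambda^-k * (e * q + c ^+ 2 * g), for q of degree k and g without constant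
   term, as a formal series in 1/lambda. *)
Definition shifted_rhs (k : nat) (e c : R) (q : {poly R}) (g : nat -> R)
    (m : nat) : R :=
  if (m <= k)%N then e * q`_(k - m) else c ^+ 2 * g (m - k)%N.

Definition gap n (j : nat) : nat := (n j.+1 - n j)%N.

(* The last clause is -1 / F_j = eps_j p_j + b_j^2 F_(j+1), multiplied by
   - lambda^-k_j F_j, where k_j = gap n j. *)
Definition P_fraction s n eps b p f : Prop :=
  [/\ f 0%N 0%N = 0 /\
      (forall m, f 0%N m.+1 = - s m / `|s (n 1%N).-1|),
      (forall j, (eps j = 1 \/ eps j = -1) /\ 0 < b j),
      (forall j, p j \is monic /\ size (p j) = (gap n j).+1),
      (forall j, f j.+1 0%N = 0 /\ unit_leading (f j.+1)) &
      forall j m,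
        series_mul (f j)
          (shifted_rhs (gap n j) (eps j) (b j) (p j) (f j.+1)) m
        = - (m == gap n j)%:R].

(* [btilde_pred eps b j] is btilde_(j-1). *)
Definition btilde_pred eps b (j : nat) : R :=
  if j is i.+1 then eps i * eps i.+1 * b i else eps 0%N.

(* [P_pair eps b p j] is (P_(j-1), P_j). *)
Fixpoint P_pair eps b p (j : nat) : {poly R} * {poly R} :=
  if j is i.+1 then
    let: (P', P) := P_pair eps b p i in
    (P, (b i)^-1 *: (p i * P - btilde_pred eps b i *: P'))
  else (0, 1).

Definition P_poly eps b p (j : nat) : {poly R} := (P_pair eps b p j).2.

(* The j such that n_j belongs to N_F. *)
Definition NF_index eps b p : set nat :=
  [set j | (0 < j)%N /\ (P_poly eps b p j.-1).[0] != 0].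

End MomentSequence.

Section Functions.
Variable R : realType.
Local Notation C := R[i].

Definition rat_eval (q w : {poly R}) (z : C) : C :=
  (map_poly (real_complex R) q).[z] / (map_poly (real_complex R) w).[z].

Definition Cintegral (mu : {measure set (measurableTypeR R) -> \bar R})
    (D : set (measurableTypeR R)) (g : R -> C) : C :=
  (\int[mu]_(t in D) complex.Re (g t)) +i* (\int[mu]_(t in D) complex.Im (g t)).

Definition cauchy_transform
    (sigma : {measure set (measurableTypeR R) -> \bar R}) (z : C) : C :=
  Cintegral sigma `[-1, 1] (fun t => (t%:C - z)^-1).

(* Meromorphic function given by a formula [g] that may be meaningless at
   isolated points: its value is the limit, so that removable singularities
   (e.g. common poles of r_1 and r_2 that cancel) are filled in. *)
Definition mero_val (g : C -> C) (z : C) : C := lim (g x @[x --> z^']).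

Definition real_segment (a b : R) : set C := real_complex R @` `[a, b].

Definition poles (g : C -> C) : set C :=
  [set z | ~ real_segment (-1) 1 z /\
           forall M : R, \forall x \near z^', M%:C < `|g x|].

Definition is_pade (s : nat -> R) (L M : nat) (AB : {poly C} * {poly C}) :
    Prop :=
  [/\ (size AB.1 <= L.+1)%N, (size AB.2 <= M.+1)%N, AB.2.[0] != 0 &
      exists K rho : R, forall z : C, rho%:C < `|z| ->
        `| \sum_(j < L + M) (s j)%:C / z ^+ j.+1 + AB.1.[z^-1] / AB.2.[z^-1] |
          <= K%:C / `|z| ^+ (L + M + 1)].

(* (A, B) for the [L/M] approximant; (0, 0) if it does not exist. *)
Definition pade_pair (s : nat -> R) (L M : nat) : {poly C} * {poly C} :=
  xget (0, 0) [set AB | is_pade s L M AB].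

Definition pade_den (s : nat -> R) (L M : nat) (z : C) : C :=
  (pade_pair s L M).2.[z^-1].

Definition pade (s : nat -> R) (L M : nat) (z : C) : C :=
  (pade_pair s L M).1.[z^-1] / pade_den s L M z.

End Functions.

(* Main.v *)
Require Import Defs.
From HB Require Import structures.
From mathcomp Require Import all_boot all_order all_algebra.
From mathcomp Require Import complex.
From mathcomp Require Import all_classical all_reals all_analysis.
From mathcomp Require Import measurable_realfun.
From mathcomp Require polyrcf.
From mathcomp Require Import ring lra zify.

Set Implicit Arguments.
Unset Strict Implicit.
Unset Printing Implicit Defensive.

Import Order.TTheory GRing.Theory Num.Theory.
Import numFieldNormedType.Exports.

Local Open Scope classical_set_scope.
Local Open Scope ring_scope.
Local Open Scope complex_scope.

(** The tail of the P-fraction of F is a bounded self-adjoint Jacobi operator,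
    and the approximants are Moebius images of the resolvents of its
    truncations, with a perturbed last diagonal entry.

    Put W = (w1 w2)^2 and q = q1 w1 w2^2, so that q >= 0.  Then W F is a
    polynomial plus the Cauchy transform of q dsigma, and the functional S with
    moments s satisfies S(W g) = int g q dsigma ([moment_identity]).  The P_j
    are orthogonal for S, and up to a positive factor S(P_j^2) = eps_j as soon
    as the gap n_(j+1) - n_j is 1.  Since S is nonnegative on the squares of the
    ideal generated by W, which has finite codimension, only finitely many
    eps_j are -1 ([eventually_eps1]).  So from some index N on the P-fraction is
    the J-fraction of a positive functional.  The moments of that functional
    grow at most geometrically because the expansion of F at infinity
    converges, hence its coefficients are bounded ([tail_bounded]).

    Let Q_j solve the recurrence of the P_j with Q_(-1) = -1, Q_0 = 0, and let
    kappa_j = b_j P_(j+1)(0) / P_j(0).  For j > N the approximant of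
    index j+1 is - sg E_j / D_j, where sg = |s_(n_1 - 1)|, D_j = b_j P_(j+1) -
    kappa_j P_j and E_j is the same combination of the Q_j ([pade_formula]):
    kappa_j is chosen so that D_j(0) = 0, which lowers by one the degree of the denominator
    in 1/lambda.  The hypothesis of the theorem says that the kappa_j are
    bounded.  Moreover E_j / D_j equals
    (Q_(N+1) + b_N Q_N h) / (P_(N+1) + b_N P_N h), where h is the upper left
    entry of the resolvent of a truncation of the tail, kappa_j being added to
    its last diagonal entry ([bdry_p], [bdry_q]).

    All these truncations are symmetric and bounded by a common r.  Hence their
    resolvents are controlled outside every disc |z - iY|^2 <= r^2 + Y^2, and
    the complements of these discs cover the complement of [-r, r]
    ([resolvent_le], [far_exists]).  Since the matrices are tridiagonal, the
    upper right entry of the resolvent decays exponentially with the size of the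
    truncation ([resolvent_last_le]); two truncations differ only at their far
    end, so h converges to some G locally uniformly ([res0_cauchy],
    [res_joint]).

    The limit is F for the following reason.  For large i the remainder
    W (P_i F + sg Q_i) is the Cauchy transform of P_i q dsigma
    ([remainder_transform]), which is bounded in i because int P_i^2 q dsigma =
    S(W P_i^2) is ([weighted_moment_bounded], [Itr_bound]).  The combination
    D_j F + sg E_j, divided by the exponentially large casoratian, tends to 0,
    and this gives (P_(N+1) + b_N P_N G) F = - sg (Q_(N+1) + b_N Q_N G)
    ([phi_den_num]).  Numerator and denominator of the corresponding quotient
    never vanish together, so away from the poles of F the denominator is
    nonzero ([den_neq0]), and the approximants converge there ([pade_local]). *)

(** * Reversed polynomials *)

Section Reversal.
Variable R : realType.
Implicit Types (p q : {poly R}).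

(** For [p] of degree at most [d] this is lambda^-d p(lambda) as a polynomial
    in 1/lambda. *)
Definition rev_poly (d : nat) p : {poly R} := \poly_(i < d.+1) p`_(d - i).

Lemma coef_rev d p i :
  (rev_poly d p)`_i = if (i <= d)%N then p`_(d - i) else 0.
Proof. by rewrite coef_poly ltnS. Qed.

Lemma size_rev_poly d p : (size (rev_poly d p) <= d.+1)%N.
Proof. exact: size_poly. Qed.

Lemma rev_is_linear d : linear (rev_poly d).
Proof.
move=> c p q; apply/polyP => i; rewrite coefD coefZ !coef_rev coefD coefZ.
by case: ifP => // _; rewrite mulr0 addr0.
Qed.
HB.instance Definition _ d :=
  GRing.isLinear.Build R {poly R} {poly R} _ (rev_poly d) (rev_is_linear d).

Lemma revXn d i : (i <= d)%N -> rev_poly d 'X^i = 'X^(d - i).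
Proof.
move=> id; apply/polyP => l; rewrite coef_rev !coefXn.
case: leqP => ld; first by congr ((_ : bool)%:R); lia.
by rewrite (_ : (l == _) = false) //; lia.
Qed.

Lemma rev1 d : rev_poly d 1 = 'X^d.
Proof. by rewrite -(expr0 'X) revXn ?subn0. Qed.

Lemma poly_sumX d p : (size p <= d)%N -> p = \sum_(i < d) p`_i *: 'X^i.
Proof.
move=> sp; apply/polyP => l; rewrite coef_sum.
under eq_bigr do rewrite coefZ coefXn.
case: (ltnP l d) => ld; last first.
  rewrite nth_default ?(leq_trans sp) // big1 // => i _.
  by rewrite gtn_eqF ?mulr0 // (leq_trans (ltn_ord i)).
rewrite (bigD1 (Ordinal ld)) //= eqxx mulr1 big1 ?addr0 // => i /negbTE ni.
by rewrite -val_eqE /= eq_sym in ni; rewrite ni mulr0.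
Qed.

Lemma rev_sum d p : (size p <= d.+1)%N ->
  rev_poly d p = \sum_(i < d.+1) p`_i *: 'X^(d - i).
Proof.
move=> /poly_sumX {1}->; rewrite linear_sum /=; apply: eq_bigr => i _.
by rewrite linearZ /= revXn // -ltnS.
Qed.

Lemma revM k d p q : (size p <= k.+1)%N -> (size q <= d.+1)%N ->
  rev_poly (k + d) (p * q) = rev_poly k p * rev_poly d q.
Proof.
move=> sp sq; rewrite (rev_sum sp) (rev_sum sq).
rewrite {1}(poly_sumX sp) {1}(poly_sumX sq) big_distrlr /= linear_sum /=.
rewrite big_distrlr /=; apply: eq_bigr => i _; rewrite linear_sum /=.
apply: eq_bigr => j _.
have := ltn_ord i; have := ltn_ord j; rewrite !ltnS => jd ik.
rewrite -!scalerAl -!scalerAr -!exprD !linearZ /= revXn ?leq_add //.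
by rewrite scalerA mulrC -scalerA; congr (_ *: (_ *: 'X^_)); lia.
Qed.

Lemma horner_rev d p x : x != 0 -> (size p <= d.+1)%N ->
  (rev_poly d p).[x] = x ^+ d * p.[x^-1].
Proof.
move=> x0 sp; rewrite (rev_sum sp) horner_sum {2}(poly_sumX sp) horner_sum.
rewrite mulr_sumr; apply: eq_bigr => i _; rewrite !hornerZ !hornerXn.
rewrite mulrCA; congr (_ * _).
by rewrite exprVn exprB ?unitfE // -ltnS.
Qed.
End Reversal.

(** * The polynomials of a P-fraction *)

Section Formal.
Variable R : realType.
Implicit Types (k : nat -> nat) (eps b : nat -> R) (p : nat -> {poly R})
  (f : nat -> nat -> R).

(** Unlike [P_fraction] this makes no reference to the moments, so that the data
    obtained by dropping the first levels satisfy it again. *)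
Definition fraction_data k eps b p f : Prop :=
  [/\ forall j, f j 0%N = 0,
      forall j, (eps j = 1 \/ eps j = -1) /\ 0 < b j,
      forall j, p j \is monic /\ size (p j) = (k j).+1,
      forall j, (0 < k j)%N &
      forall j m, series_mul (f j)
          (shifted_rhs (k j) (eps j) (b j) (p j) (f j.+1)) m
        = - (m == k j)%:R].

Lemma fraction_data_shift N k eps b p f : fraction_data k eps b p f ->
  fraction_data (fun j => k (N + j)%N) (fun j => eps (N + j)%N)
    (fun j => b (N + j)%N) (fun j => p (N + j)%N) (fun j => f (N + j)%N).
Proof.
by case=> h1 h2 h3 h4 h5; split=> // j m; rewrite addnS; apply: h5.
Qed.

(** The recurrence of the P_j from an arbitrary pair of initial values, since
    the second solution below is needed as well. *)
Fixpoint rec_pair eps b p (y : {poly R} * {poly R}) (j : nat) :=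
  if j is i.+1 then
    let: (y', y0) := rec_pair eps b p y i in
    (y0, (b i)^-1 *: (p i * y0 - btilde_pred eps b i *: y'))
  else y.

Lemma P_pairE eps b p j : P_pair eps b p j = rec_pair eps b p (0, 1) j.
Proof. by elim: j => //= j ->. Qed.

(** With these initial values P_j F_0 + Q_j is small at infinity: - Q_j / P_j is
    the j-th convergent of the P-fraction. *)
Definition Q_pair eps b p := rec_pair eps b p (-1, 0).
Definition Q_poly eps b p j := (Q_pair eps b p j).2.

Section Data.
Variables (k : nat -> nat) (eps b : nat -> R) (p : nat -> {poly R})
  (f : nat -> nat -> R).
Hypothesis H : fraction_data k eps b p f.

Let f00 j : f j 0%N = 0. Proof. by case: H. Qed.
Let epsP j : eps j = 1 \/ eps j = -1. Proof. by case: H => _ /(_ j) []. Qed.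
Let b_gt0 j : 0 < b j. Proof. by case: H => _ /(_ j) []. Qed.
Let p_monic j : p j \is monic. Proof. by case: H => _ _ /(_ j) []. Qed.
Let p_size j : size (p j) = (k j).+1. Proof. by case: H => _ _ /(_ j) []. Qed.
Let k_gt0 j : (0 < k j)%N. Proof. by case: H. Qed.
Let fmul j m : series_mul (f j)
  (shifted_rhs (k j) (eps j) (b j) (p j) (f j.+1)) m = - (m == k j)%:R.
Proof. by case: H. Qed.
Let eps2 j : eps j * eps j = 1. Proof. by case: (epsP j) => ->; ring. Qed.

Lemma shifted_rhs0 j : shifted_rhs (k j) (eps j) (b j) (p j) (f j.+1) 0 = eps j.
Proof.
rewrite /shifted_rhs /= subn0; have := monicP (p_monic j).
by rewrite lead_coefE p_size /= => ->; rewrite mulr1.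
Qed.

(** F_j = - eps_j lambda^-k_j + ..., by comparing coefficients in the defining
    identity, whose right factor has constant term eps_j. *)
Lemma f_low j m : (m <= k j)%N -> f j m = - (m == k j)%:R * eps j.
Proof.
elim/ltn_ind: m => m IH mk; have := fmul j m.
rewrite /series_mul big_ord_recr /= subnn shifted_rhs0 big1 ?add0r => [<-|i _].
  by rewrite -mulrA eps2 mulr1.
rewrite IH ?(ltnW (leq_trans (ltn_ord i) _)) // ltn_eqF ?oppr0 ?mul0r //.
exact: leq_trans (ltn_ord i) mk.
Qed.

Definition deg j := (\sum_(i < j) k i)%N.
Lemma degS j : deg j.+1 = (deg j + k j)%N.
Proof. by rewrite /deg big_ord_recr. Qed.

(* Indices j - 1, read as 0 for j = 0: [kp j] is k_(j-1) and [dp j] is the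
   degree bound for P_(j-1). *)
Let kp j := if j is i.+1 then k i else 0%N.
Let dp j := if j is i.+1 then deg i else 0%N.
Let kpdp j : (kp j + dp j = deg j)%N.
Proof. by case: j => [|j] /=; rewrite ?degS 1?addnC // /deg big_ord0. Qed.

Let sol y j := rec_pair eps b p y j.
Let sol1S y j : (sol y j.+1).1 = (sol y j).2.
Proof. by rewrite /sol /=; case: rec_pair. Qed.
Let sol2S y j : (sol y j.+1).2 =
  (b j)^-1 *: (p j * (sol y j).2 - btilde_pred eps b j *: (sol y j).1).
Proof. by rewrite /sol /=; case: rec_pair. Qed.

Lemma size_sol (y : {poly R} * {poly R}) j : (size y.1 <= 1)%N -> (size y.2 <= 1)%N ->
  (size (sol y j).1 <= (dp j).+1)%N /\ (size (sol y j).2 <= (deg j).+1)%N.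
Proof.
move=> s1 s2; elim: j => [|j [IH1 IH2]]; first by rewrite /= /deg big_ord0.
rewrite sol1S sol2S; split => //.
apply: leq_trans (size_scale_leq _ _) _.
apply: leq_trans (size_polyD _ _) _; rewrite geq_max; apply/andP; split.
  apply: leq_trans (size_polyMleq _ _) _.
  by rewrite p_size degS; lia.
rewrite size_polyN; apply: leq_trans (size_scale_leq _ _) _.
by apply: (leq_trans IH1); have := kpdp j; rewrite degS; lia.
Qed.

Section Truncation.
Variable M : nat.
Let a j : {poly R} := \poly_(i < M) f j i.
Let A j : {poly R} := \prod_(i < j) a i.

(** The identity -1 / F_j = eps_j p_j + b_j^2 F_(j+1) for polynomials in
    1/lambda, modulo lambda^-M. *)
Lemma trunc_eq j : exists c, a j * (eps j *: rev_poly (k j) (p j)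
    + b j ^+ 2 *: ('X^(k j) * a j.+1)) + 'X^(k j) = 'X^M * c.
Proof.
set g := (X in exists c, X = _).
exists (drop_poly M g); rewrite -[LHS](poly_take_drop M).
rewrite [X in X + _](_ : _ = 0) ?add0r 1?mulrC //.
apply/polyP => m; rewrite coef_take_poly coef0; case: ltnP => // mM.
rewrite /g coefD coefXn coefM; apply/eqP; rewrite addr_eq0 -fmul; apply/eqP.
apply: eq_bigr => i _.
have iM : (i < M)%N by have := ltn_ord i; lia.
have miM : (m - i < M)%N by lia.
rewrite coef_poly iM; congr (_ * _).
have mikM : (m - i - k j < M)%N by lia.
rewrite coefD !coefZ coefXnM coef_rev coef_poly mikM /shifted_rhs.
case: ltngtP => h /=; first by rewrite mulr0 addr0.
  by rewrite mulr0 add0r.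
by rewrite h subnn f00 !mulr0 addr0.
Qed.

(* [ccp] is why these are the constants of the remainders: the recurrence with
   coefficient btilde_(j-1) reproduces them. *)
Let c j : R := \prod_(i < j) (- eps i * b i).
Let cp j : R := if j is i.+1 then c i else -1.
Let ccp j : btilde_pred eps b j * cp j = - eps j * c j.
Proof.
case: j => [|j]; first by rewrite /= /c big_ord0 mulrN mulNr.
by rewrite /= /c big_ord_recr /=; ring.
Qed.

(* The remainders P_(j-1) F_0 + Q_(j-1) and P_j F_0 + Q_j, multiplied by
   lambda^-deg to become polynomials in 1/lambda. *)
Let y_rev (j : nat) : {poly R} * {poly R} :=
  (rev_poly (dp j) (sol (0, 1) j).1 * a 0%N + rev_poly (dp j) (sol (-1, 0) j).1,
   rev_poly (deg j) (sol (0, 1) j).2 * a 0%N + rev_poly (deg j) (sol (-1, 0) j).2).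

Lemma rev_sol (y : {poly R} * {poly R}) j : (size y.1 <= 1)%N -> (size y.2 <= 1)%N ->
  b j *: rev_poly (deg j.+1) (sol y j.+1).2 =
  rev_poly (k j) (p j) * rev_poly (deg j) (sol y j).2 - 
  btilde_pred eps b j *: ('X^(k j + kp j) * rev_poly (dp j) (sol y j).1).
Proof.
move=> s1 s2; have [h1 h2] := size_sol j s1 s2.
rewrite sol2S linearZ /= scalerA divff ?scale1r ?gt_eqF //.
rewrite linearB linearZ /= degS addnC revM ?p_size //; congr (_ - _ *: _).
rewrite -[X in rev_poly _ X]mul1r -kpdp addnA revM ?size_poly1 //; congr (_ * _).
by rewrite rev1.
Qed.

(** P_j F_0 + Q_j is a constant times F_0 F_1 ... F_j: the quotient of two
    consecutive remainders satisfies the recursion that defines the F_j. *)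
Lemma y_rev_trunc j :
  (exists e, (y_rev j).1 = cp j *: ('X^(dp j) * A j) + 'X^M * e) /\
  (exists e, (y_rev j).2 = c j *: ('X^(deg j) * A j.+1) + 'X^M * e).
Proof.
elim: j => [|j [[e1 h1] [e2 h2]]].
  split; exists 0; rewrite mulr0 addr0 /y_rev /= /deg ?big_ord0 /c /A.
    by rewrite linear0 linearN /= rev1 expr0 mul0r add0r big_ord0 mulr1 scaleN1r.
  by rewrite linear0 /= rev1 big_ord0 big_ord1 scale1r !expr0 addr0.
split; first by exists e2; move: h2; rewrite /y_rev !sol1S.
have [e3 h3] := trunc_eq j.
exists ((b j)^-1 *: (rev_poly (k j) (p j) * e2 
  - btilde_pred eps b j *: ('X^(k j + kp j) * e1)
  + (eps j * c j) *: ('X^(deg j) * A j * e3))).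
apply: (@scalerI _ _ (b j)); first by rewrite gt_eqF.
have -> : b j *: (y_rev j.+1).2 = rev_poly (k j) (p j) * (y_rev j).2 -
    btilde_pred eps b j *: ('X^(k j + kp j) * (y_rev j).1).
  rewrite /y_rev [(_, _).2]/= scalerDr scalerAl !rev_sol ?size_poly0 ?size_poly1 ?size_polyN ?size_poly1 //=.
  rewrite -!mul_polyC; ring.
rewrite h1 h2 scalerDr !scalerA.
rewrite -!scalerAr scalerA divff ?gt_eqF // scale1r.
rewrite !mulrDr scalerDr -!scalerAr !scalerA ccp.
rewrite /c big_ord_recr /= -/(c j) /A 2!big_ord_recr /= -/(A j).
have -> : 'X^(k j + kp j) * ('X^(dp j) * A j) = 'X^(deg j) * A j * 'X^(k j) :> {poly R}.
  by rewrite -kpdp !exprD; ring.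
have hX : 'X^(k j) = 'X^M * e3 - a j * (eps j *: rev_poly (k j) (p j)
    + b j ^+ 2 *: ('X^(k j) * a j.+1)) by rewrite -h3; ring.
have e2C : (eps j)%:P * (eps j)%:P = 1 :> {poly R} by rewrite -polyCM eps2.
have hXX : (eps j)%:P * 'X^(k j) + a j * rev_poly (k j) (p j) =
  (eps j)%:P * 'X^M * e3 - (eps j)%:P * a j * (b j ^+ 2)%:P * ('X^(k j) * a j.+1).
  rewrite {1}hX -!mul_polyC -[a j * rev_poly _ _]mul1r -e2C; ring.
rewrite degS exprD -!mul_polyC !polyCM !polyCN.
transitivity ('X^(deg j) * (c j)%:P * A j * ((eps j)%:P * 'X^(k j) + a j * rev_poly (k j) (p j))
  + 'X^M * (rev_poly (k j) (p j) * e2) - (btilde_pred eps b j)%:P * 'X^(k j + kp j) * 'X^M * e1).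
  by rewrite exprD; ring.
rewrite hXX rmorphXn /= big_ord_recr /= -/(A j) !exprD; ring.
Qed.

Lemma A_low j : (deg j < M)%N -> exists2 B, A j = 'X^(deg j) * B &
  B`_0 = \prod_(i < j) (- eps i).
Proof.
elim: j => [|j IH] dM.
  by exists 1; rewrite /A /deg !big_ord0 ?mulr1 ?coef1.
rewrite degS in dM; have [|B hB hB0] := IH; first by lia.
exists (B * drop_poly (k j) (a j)); last first.
  rewrite coef0M coef_drop_poly hB0 add0n coef_poly ifT; last by lia.
  by rewrite f_low // eqxx big_ord_recr /= mulN1r.
rewrite /A big_ord_recr /= -/(A j) hB.
rewrite -[a j in LHS](poly_take_drop (k j)) degS exprD.
rewrite [take_poly _ _](_ : _ = 0) ?add0r; first by ring.
apply/polyP => m; rewrite coef_take_poly coef0; case: ltnP => // mk.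
rewrite coef_poly; case: ifP => // _; rewrite f_low; last exact: ltnW.
by rewrite ltn_eqF // oppr0 mul0r.
Qed.

Lemma y_rev_dvd j : (deg j + deg j.+1 < M)%N ->
  exists2 e, (y_rev j).2 = 'X^(deg j + deg j.+1) * e &
    e`_0 = - eps j * \prod_(i < j) b i.
Proof.
move=> dM; have [_ [e ->]] := y_rev_trunc j.
have [|B -> hB] := A_low (j := j.+1); first by lia.
exists (c j *: B + 'X^(M - (deg j + deg j.+1)) * e).
  rewrite mulrDr -scalerAr; congr (_ *: _ + _); first by rewrite exprD mulrA.
  by rewrite mulrA -exprD subnKC // ltnW.
rewrite coefD coefZ hB coefXnM ifT ?addr0; last by lia.
rewrite big_ord_recr /= mulrA mulrC; congr (_ * _).
rewrite /c -big_split /=; apply: eq_bigr => i _.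
by rewrite mulrC mulrA mulrNN eps2 mul1r.
Qed.

End Truncation.

(** Each F_i contributes a factor of order lambda^-k_i, so the remainder
    P_j F_0 + Q_j has order exactly n_(j+1) at infinity. *)
Lemma rev_remainder j M : (deg j + deg j.+1 < M)%N ->
  exists2 e, rev_poly (deg j) (P_poly eps b p j) * (\poly_(i < M) f 0%N i)
      + rev_poly (deg j) (Q_poly eps b p j) = 'X^(deg j + deg j.+1) * e &
    e`_0 = - eps j * \prod_(i < j) b i.
Proof. by move=> dM; rewrite /P_poly P_pairE; have := y_rev_dvd dM. Qed.

Lemma size_P j : (size (P_poly eps b p j) <= (deg j).+1)%N.
Proof.
by rewrite /P_poly P_pairE; apply: (size_sol _ _ _).2; rewrite /= ?size_poly0 ?size_poly1.
Qed.

Lemma size_Q j : (size (Q_poly eps b p j) <= (deg j).+1)%N.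
Proof.
by apply: (size_sol _ _ _).2; rewrite ?size_poly0 ?size_polyN ?size_poly1.
Qed.

Lemma P_rec0 : P_poly eps b p 1 = (b 0%N)^-1 *: p 0%N.
Proof. by rewrite /P_poly /= mulr1 scaler0 subr0. Qed.

Lemma Q_rec0 : Q_poly eps b p 1 = (eps 0%N / b 0%N)%:P.
Proof.
by rewrite /Q_poly /= mulr0 sub0r !scalerN opprK scalerA -mul_polyC mulr1 mulrC.
Qed.

Lemma P_recS j : b j.+1 *: P_poly eps b p j.+2 =
  p j.+1 * P_poly eps b p j.+1 - btilde_pred eps b j.+1 *: P_poly eps b p j.
Proof.
rewrite /P_poly !P_pairE -/(sol _ _) sol2S scalerA divff ?gt_eqF // scale1r.
by rewrite sol1S.
Qed.

Lemma Q_recS j : b j.+1 *: Q_poly eps b p j.+2 =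
  p j.+1 * Q_poly eps b p j.+1 - btilde_pred eps b j.+1 *: Q_poly eps b p j.
Proof.
rewrite /Q_poly /Q_pair -/(sol _ _) sol2S scalerA divff ?gt_eqF // scale1r.
by rewrite sol1S.
Qed.

Lemma btilde_neq0 j : btilde_pred eps b j != 0.
Proof.
have e0 i : eps i != 0 by case: (epsP i) => ->; rewrite ?oppr_eq0 oner_eq0.
by case: j => [|j] //=; rewrite !mulf_neq0 // gt_eqF.
Qed.

Lemma P_lead j : (P_poly eps b p j)`_(deg j) = (\prod_(i < j) b i)^-1.
Proof.
have -> : (P_poly eps b p j)`_(deg j) = (rev_poly (deg j) (P_poly eps b p j))`_0.
  by rewrite coef_rev subn0.
rewrite /P_poly P_pairE -/(sol _ _).
elim: j => [|j IH]; first by rewrite /deg !big_ord0 coef_rev coef1 invr1.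
apply: (mulfI (_ : b j != 0)); first by rewrite gt_eqF.
rewrite -coefZ rev_sol ?size_poly0 ?size_poly1 // coefB coefZ coefXnM.
rewrite ifT ?mulr0 ?subr0; last by have := k_gt0 j; lia.
rewrite coef0M IH coef_rev /= subn0.
have := monicP (p_monic j); rewrite lead_coefE p_size /= => ->.
by rewrite mul1r big_ord_recr /= invfM mulrCA divff ?mulr1 ?gt_eqF.
Qed.

(** Two solutions of the same recurrence have a Wronskian that is multiplied by
    btilde / b at each step. *)
Lemma wronskian j : exists2 c : R, c != 0 &
  P_poly eps b p j.+1 * Q_poly eps b p j - P_poly eps b p j * Q_poly eps b p j.+1
  = c%:P.
Proof.
elim: j => [|j [c c0 hc]].
  exists (- (eps 0%N / b 0%N)).
    rewrite oppr_eq0 mulf_neq0 //; first exact: (btilde_neq0 0).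
    by rewrite invr_eq0 gt_eqF.
  by rewrite Q_rec0 /P_poly /Q_poly /= mulr0 mul1r sub0r polyCN.
exists (btilde_pred eps b j.+1 / b j.+1 * c).
  apply: mulf_neq0 => //; apply: mulf_neq0; first exact: btilde_neq0.
  by rewrite invr_eq0 gt_eqF.
apply: (@scalerI _ _ (b j.+1)); first by rewrite gt_eqF.
have b0 : b j.+1 != 0 by rewrite gt_eqF.
rewrite -[in RHS]mul_polyC -polyCM.
have -> : b j.+1 * (btilde_pred eps b j.+1 / b j.+1 * c) = btilde_pred eps b j.+1 * c.
  by field.
rewrite polyCM -hc scalerBr scalerAl scalerAr P_recS Q_recS -!mul_polyC; ring.
Qed.

End Data.

(** * Moments and orthogonality *)

(** The linear functional X^i |-> u i. *)
Definition mom (u : nat -> R) (g : {poly R}) : R := \sum_(i < size g) g`_i * u i.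

Lemma mom_wide u d (g : {poly R}) : (size g <= d)%N ->
  mom u g = \sum_(i < d) g`_i * u i.
Proof.
move=> sg; rewrite /mom (big_ord_widen d (fun i => g`_i * u i)) // big_mkcond.
apply: eq_bigr => i _; case: ltnP => // h; by rewrite nth_default ?mul0r.
Qed.

Lemma mom_is_linear u : scalar (mom u).
Proof.
move=> c g h; pose d := maxn (size g) (size h).
have sgh : (size (c *: g + h)%R <= d)%N.
  apply: leq_trans (size_polyD _ _) _.
  by rewrite geq_max (leq_trans (size_scale_leq _ _)) ?leq_maxl ?leq_maxr.
rewrite (mom_wide u sgh) (mom_wide u (leq_maxl _ _ : (size g <= d)%N)).
rewrite (mom_wide u (leq_maxr _ _ : (size h <= d)%N)).
rewrite mulr_sumr -big_split; apply: eq_bigr => i _ /=.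
by rewrite coefD coefZ mulrDl mulrA.
Qed.
HB.instance Definition _ u :=
  GRing.isLinear.Build R {poly R} R *%R (mom u) (mom_is_linear u).

Lemma momXn u i : mom u 'X^i = u i.
Proof.
rewrite /mom size_polyXn big_ord_recr /= coefXn eqxx mul1r big1 ?add0r // => j _.
by rewrite coefXn ltn_eqF ?mul0r.
Qed.

Lemma mom_mulXn u d (g : {poly R}) m : (size g <= d)%N ->
  mom u (g * 'X^m) = \sum_(i < d) g`_i * u (i + m)%N.
Proof.
move=> /poly_sumX {1}->; rewrite mulr_suml linear_sum /=; apply: eq_bigr => i _.
by rewrite -scalerAl -exprD linearZ /= momXn.
Qed.

(** The series f_0 is - sum_i s_i / lambda^(i+1), up to scaling. *)
Definition momf f (i : nat) : R := - f 0%N i.+1.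

Section Orthogonality.
Variables (k : nat -> nat) (eps b : nat -> R) (p : nat -> {poly R})
  (f : nat -> nat -> R).
Hypothesis H : fraction_data k eps b p f.
Local Notation P := (P_poly eps b p).
Local Notation S := (mom (momf f)).
Local Notation deg := (deg k).

(** S(P_j X^m) is a coefficient of P_j F_0, up to sign; those up to the order
    of the remainder vanish by [rev_remainder]. *)
Lemma mom_PXn j m : (m < deg j.+1)%N -> S (P j * 'X^m) =
  (m.+1 == deg j.+1)%:R * (eps j * \prod_(i < j) b i).
Proof.
move=> hm.
pose M := (deg j + deg j.+1 + m).+2.
have [|e he e0] := @rev_remainder _ _ _ _ _ H j M; first by rewrite /M; lia.
have : (rev_poly (deg j) (P j) * (\poly_(i < M) f 0%N i))`_(deg j + m.+1) =
    (m.+1 == deg j.+1)%:R * (- eps j * \prod_(i < j) b i).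
  move/(congr1 (fun g : {poly R} => g`_(deg j + m.+1))): he.
  rewrite coefD coef_rev ifF ?addr0; last by lia.
  move=> ->; rewrite coefXnM ltn_add2l.
  move: hm; rewrite leq_eqVlt => /orP[/eqP <-|hm].
    by rewrite ltnn eqxx subnn e0 mul1r.
  by rewrite hm ltn_eqF // mul0r.
rewrite mulNr mulrN => /eqP; rewrite -eqr_oppLR => /eqP <-.
rewrite (mom_mulXn (momf f) m (size_P H j)) (rev_sum (size_P H j)) mulr_suml coef_sum.
rewrite -sumrN; apply: eq_bigr => i _; rewrite -scalerAl coefZ coefXnM.
have hi := ltn_ord i.
rewrite ifF; last by lia.
rewrite coef_poly ifT; last by rewrite /M; lia.
by rewrite -mulrN; congr (_ * - f 0%N _); lia.
Qed.

Lemma mom_P_low j (g : {poly R}) : (size g < deg j.+1)%N -> S (P j * g) = 0.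
Proof.
move=> sg; rewrite (poly_sumX (leqnn (size g))) mulr_sumr linear_sum /=.
apply: big1 => i _; have hi := ltn_ord i.
rewrite -scalerAr linearZ /= mom_PXn; last exact: ltn_trans hi sg.
rewrite ltn_eqF ?mul0r ?mulr0 //; exact: leq_ltn_trans hi sg.
Qed.

Lemma deg_lt i j : (i < j)%N -> (deg i < deg j)%N.
Proof.
elim: j => // j IH; rewrite ltnS leq_eqVlt degS.
have k0 : (0 < k j)%N by case: H.
by case/orP => [/eqP ->|/IH]; lia.
Qed.

Lemma mom_PP_lt i j : (i < j)%N -> S (P j * P i) = 0.
Proof.
move=> ij; apply: mom_P_low; apply: leq_ltn_trans (size_P H i) _.
by apply: leq_ltn_trans (deg_lt ij) (deg_lt (ltnSn j)).
Qed.

(** Only the leading term of the second factor contributes, and the leading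
    coefficient of P_j cancels the product in [mom_PXn]. *)
Lemma mom_PP j : k j = 1%N -> S (P j * P j) = eps j.
Proof.
move=> kj; have dS : deg j.+1 = (deg j).+1 by rewrite degS kj addn1.
have b0 : \prod_(i < j) b i != 0.
  by apply/prodf_neq0 => i _; rewrite gt_eqF //; case: H => _ /(_ i) [].
rewrite {2}(poly_sumX (size_P H j)) mulr_sumr linear_sum /= big_ord_recr /=.
rewrite big1 ?add0r => [|i _].
  rewrite -scalerAr linearZ /= mom_PXn ?dS // eqxx mul1r (P_lead H).
  by rewrite mulrCA mulVf ?mulr1.
rewrite -scalerAr linearZ /= mom_PXn ?dS //; last by rewrite ltnW ?ltnS.
by rewrite eqSS ltn_eqF ?mul0r ?mulr0.
Qed.

End Orthogonality.
End Formal.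

(** * Geometric growth and bounded Jacobi coefficients *)

Section Positivity.
Variable R : realType.

Section Geometric.
Implicit Types (u g : nat -> R).

Definition geom_bounded u : Prop :=
  exists C r : R, [/\ 1 <= C, 1 <= r & forall m, `|u m| <= C * r ^+ m].

Lemma geometric_scale c u : geom_bounded u -> geom_bounded (fun m => c * u m).
Proof.
move=> [C [r [C1 r1 h]]]; exists ((1 + `|c|) * C), r; split=> // [|m].
  by rewrite mulr_ege1 // lerDl.
by rewrite normrM -mulrA ler_pM // lerDr.
Qed.

Lemma geometric_shift N u : geom_bounded u -> geom_bounded (fun m => u (m + N)%N).
Proof.
move=> [C [r [C1 r1 h]]]; exists (C * r ^+ N), r; split=> // [|m].
  by rewrite mulr_ege1 // exprn_ege1.
by rewrite -mulrA -exprD addnC.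
Qed.

Lemma geometric_geq N u v : (forall m, (N <= m)%N -> `|v m| <= `|u m|) ->
  geom_bounded u -> geom_bounded v.
Proof.
move=> uv [C [r [C1 r1 h]]].
pose B := \sum_(i < N) `|v i|.
have B0 : 0 <= B by apply: sumr_ge0.
exists (C + B), r; split=> // [|m]; first by rewrite ler_wpDr.
have rm : 1 <= r ^+ m by rewrite exprn_ege1.
have rm0 : 0 <= r ^+ m by rewrite (le_trans ler01).
case: (leqP N m) => hm.
  apply: (le_trans (uv _ hm)); apply: (le_trans (h m)).
  by rewrite ler_wpM2r // lerDl.
apply: (@le_trans _ _ B).
  by rewrite /B (bigD1 (Ordinal hm)) //= lerDl sumr_ge0.
apply: le_trans (_ : B * r ^+ m <= _); first by rewrite ler_peMr.
by rewrite ler_wpM2r // lerDr (le_trans ler01).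
Qed.

(** The majorant inequality that closes the induction in [geometric_inverse]. *)
Lemma geometric_conv (C r K : R) m : 1 <= C -> 0 <= r -> 2 * C * r <= K ->
  \sum_(i < m) C * r ^+ i.+1 * K ^+ (m - i.+1) <= K ^+ m.
Proof.
move=> C1 r0 rK; have C0 : 0 <= C by apply: le_trans C1.
have K0 : 0 <= K by apply: le_trans rK; rewrite !mulr_ge0.
elim: m => [|m IH]; first by rewrite big_ord0 expr0.
rewrite big_ord_recl /= expr1 subSS subn0.
apply: le_trans (_ : C * r * K ^+ m + C * r * K ^+ m <= _); last first.
  by rewrite -mulr2n -mulr_natl mulrA exprS ler_wpM2r ?exprn_ge0 // mulrA.
rewrite lerD2l; apply: le_trans (_ : r * K ^+ m <= _); last first.
  by rewrite ler_wpM2r ?exprn_ge0 // ler_peMl.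
apply: le_trans (ler_wpM2l r0 IH); rewrite mulr_sumr le_eqVlt; apply/orP; left.
apply/eqP; apply: eq_bigr => i _; rewrite /bump /= add1n subSS.
by rewrite [r ^+ i.+2]exprS; ring.
Qed.

(** The reciprocal of a convergent power series converges: its coefficients are
    determined recursively, and the convolution is dominated by a geometric
    sequence of large enough ratio. *)
Lemma geometric_inverse k u g :
  (forall m, (m < k)%N -> u m = 0) -> `|u k| = 1 ->
  (forall m, series_mul u g m = - (m == k)%:R) ->
  geom_bounded u -> geom_bounded g.
Proof.
move=> u0 uk ug [C [r [C1 r1 hu]]].
pose C' := C * r ^+ k.
have C'1 : 1 <= C' by rewrite mulr_ege1 // exprn_ege1.
have r0 : 0 <= r by apply: le_trans r1.
exists 1, (2 * C' * r); split=> // [|m].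
  by apply: mulr_ege1 => //; apply: mulr_ege1 => //; rewrite ler1n.
have K0 : 0 <= 2 * C' * r by apply: mulr_ge0 => //; apply: mulr_ge0 => //; apply: le_trans C'1.
rewrite mul1r; elim/ltn_ind: m => m IH.
have := ug (k + m)%N; rewrite /series_mul.
rewrite -addnS big_split_ord /= big1 ?add0r => [|i _]; last by rewrite u0 ?mul0r.
rewrite big_ord_recl /= addn0 (_ : (k + m - k = m)%N); last by lia.
move/(canRL (addrK _)) => h.
have -> : `|g m| = `|u k * g m| by rewrite normrM uk mul1r.
rewrite h; case: m IH h => [|m] IH h.
  by rewrite big_ord0 subr0 addn0 eqxx normrN normr1 expr0.
rewrite (_ : (_ == k) = false) ?oppr0 ?sub0r ?normrN; last by lia.
apply: le_trans (ler_norm_sum _ _ _) _.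
apply: le_trans (geometric_conv m.+1 C'1 r0 (lexx _)).
apply: ler_sum => i _; rewrite normrM /bump /= add1n.
rewrite (_ : (k + m.+1 - (k + i.+1) = m.+1 - i.+1)%N); last by lia.
apply: ler_pM => //; first by rewrite /C' -mulrA -exprD.
by apply: IH; lia.
Qed.

(** F_(N+1) is obtained from F_N by a reciprocal and the removal of a
    polynomial part. *)
Lemma geometric_f k eps b p f N : fraction_data k eps b p f ->
  geom_bounded (f 0%N) -> geom_bounded (f N).
Proof.
move=> H h0; elim: N => // N IH.
case: (H) => f00 hb hp hk fmul.
have [epsN bN] := hb N.
have low m : (m < k N)%N -> f N m = 0.
  by move=> hm; rewrite (f_low H) 1?ltnW // ltn_eqF // oppr0 mul0r.
have fk : `|f N (k N)| = 1.
  by rewrite (f_low H) // eqxx mulN1r normrN; case: epsN => ->; rewrite ?normrN normr1.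
have := geometric_inverse low fk (fmul N) IH.
move=> /(geometric_shift (k N)) /(geometric_scale (b N ^- 2)).
apply: (@geometric_geq 1) => m m0; rewrite /shifted_rhs ifF; last by lia.
by rewrite addnK mulrA mulVf ?mul1r // expf_neq0 // gt_eqF.
Qed.

End Geometric.

Lemma bernoulli_ge (x : R) n : 0 <= x -> 1 + n%:R * x <= (1 + x) ^+ n.
Proof.
move=> x0; elim: n => [|n IH]; first by rewrite mul0r addr0 expr0.
rewrite exprS; have h1 : 0 <= 1 + x by rewrite addr_ge0.
apply: le_trans (ler_wpM2l h1 IH).
have : 0 <= n%:R * x * x by rewrite !mulr_ge0.
by rewrite -natr1; nra.
Qed.

Lemma expr_unbounded (q C : R) : 1 < q -> exists n, C < q ^+ n.
Proof.
move=> q1; have x0 : 0 < q - 1 by rewrite subr_gt0.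
exists (Num.truncn (C / (q - 1))).+1.
have := bernoulli_ge (Num.truncn (C / (q - 1))).+1 (ltW x0); rewrite subrKC.
apply: lt_le_trans; apply: le_lt_trans (_ : C / (q - 1) * (q - 1) < _).
  by rewrite divfK // gt_eqF.
by rewrite ltr_wpDl // ltr_pM2r // truncnS_gt.
Qed.

(** Log-convexity makes the ratios v (m+1) / v m nondecreasing, so v m is at
    least (v 1)^m. *)
Lemma log_convex_bound (v : nat -> R) (C r : R) : 0 < r -> v 0%N = 1 ->
  (forall m, 0 < v m -> v m.+1 ^+ 2 <= v m * v m.+2) ->
  (forall m, v m <= C * r ^+ m) -> v 1%N <= r.
Proof.
move=> r0 v0 cvx vC; rewrite leNgt; apply/negP => rv.
have v1 : 0 < v 1%N by apply: lt_trans rv.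
have grow m : 0 < v m /\ v 1%N * v m <= v m.+1.
  elim: m => [|m [vm vS]]; first by rewrite v0 mulr1.
  have vS0 : 0 < v m.+1 by apply: lt_le_trans vS; rewrite mulr_gt0.
  split=> //; rewrite -(ler_pM2l vm); apply: le_trans (cvx _ vm).
  by rewrite mulrCA mulrA expr2 ler_pM2r.
have pow m : v 1%N ^+ m <= v m.
  elim: m => [|m IH]; first by rewrite v0.
  by rewrite exprS; apply: le_trans (grow m).2; rewrite ler_pM2l.
have [|n hn] := @expr_unbounded (v 1%N / r) C; first by rewrite ltr_pdivlMr ?mul1r.
move: hn; rewrite expr_div_n ltr_pdivlMr ?exprn_gt0 // ltNge.
by rewrite (le_trans (pow n)).
Qed.

Section JacobiBound.
Variables (k : nat -> nat) (eps b : nat -> R) (p : nat -> {poly R})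
  (f : nat -> nat -> R).
Hypothesis H : fraction_data k eps b p f.
Hypothesis k1 : forall j, k j = 1%N.
Hypothesis eps1 : forall j, eps j = 1.
Hypothesis geof : geom_bounded (f 0%N).
Local Notation P := (P_poly eps b p).
Local Notation M := (mom (momf f)).

Let deg_id j : deg k j = j.
Proof. by elim: j => [|j]; rewrite ?degS ?k1 ?addn1; [rewrite /deg big_ord0|move=> ->]. Qed.

(** Subtracting from [g] its component along P_n lowers the degree, and P_n is
    orthogonal to what remains. *)
Lemma mom_sq_ge0 g : 0 <= M (g * g).
Proof.
have [n] := ubnP (size g); elim: n g => // n IH g sg.
case: n IH sg => [_|n IH sg].
  by rewrite ltnS leqn0 size_poly_eq0 => /eqP ->; rewrite mul0r linear0.
have l0 : (P n)`_n != 0.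
  rewrite -{2}(deg_id n) (P_lead H) invr_eq0; apply/prodf_neq0 => i _.
  by rewrite gt_eqF //; case: H => _ /(_ i) [].
pose c := g`_n / (P n)`_n; pose h := g - c *: P n.
have sh : (size h < n.+1)%N.
  rewrite ltnS; apply/leq_sizeP => i; rewrite leq_eqVlt => /orP[/eqP <-|ni].
    by rewrite coefB coefZ /c divfK ?subrr.
  rewrite coefB coefZ !nth_default ?mulr0 ?subr0 //.
    by apply: leq_trans (size_P H n) _; rewrite deg_id.
  by apply: leq_trans ni.
have -> : g * g = h * h + (2 * c) *: (P n * h) + (c ^+ 2) *: (P n * P n).
  rewrite -[g](subrK (c *: P n)) -/h -!mul_polyC polyCM polyC_exp polyC_natr.
  by clearbody h; clearbody c; ring.
rewrite !linearD /= !linearZ /= (mom_PP H) ?k1 // eps1 (mom_P_low H) ?deg_id //.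
by rewrite mulr0 addr0 mulr1 addr_ge0 ?IH ?sqr_ge0.
Qed.

Lemma mom_cauchy_schwarz g h : 0 < M (g * g) ->
  M (g * h) ^+ 2 <= M (g * g) * M (h * h).
Proof.
move=> g0; set A := M (g * g); set B := M (g * h).
have := mom_sq_ge0 (A *: h - B *: g).
have -> : (A *: h - B *: g) * (A *: h - B *: g) =
   (A ^+ 2) *: (h * h) - (2 * A * B) *: (g * h) + (B ^+ 2) *: (g * g).
  by rewrite -!mul_polyC !polyC_exp !polyCM polyC_natr; ring.
rewrite linearD linearB /= !linearZ /= -/A -/B => h0.
rewrite -subr_ge0 -(pmulr_rge0 _ g0) -/A.
have -> // : A * (A * M (h * h) - B ^+ 2) =
  A ^+ 2 * M (h * h) + (2 * A * B) * - B + B ^+ 2 * A by ring.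
Qed.

(** For fixed j the sequence M(P_j^2 X^(2m)) is log-convex in m by the
    Cauchy-Schwarz inequality, starts at 1, and is O(r^(2m)); therefore
    M((X P_j)^2) <= r^2.  Since X P_j has components b_j and a_j along the
    orthonormal P_(j+1) and P_j, this bounds a_j^2 + b_j^2. *)
Lemma jacobi_bounded : exists2 K : R, 1 <= K &
  forall j, `|(p j)`_0| <= K /\ b j <= K.
Proof.
have [C [r [C1 r1 hf]]] := geof.
have r0 : 0 < r by apply: lt_le_trans r1.
exists r => // j; have b0 : 0 < b j by case: H => _ /(_ j) [].
pose v m := M ((P j * 'X^m) * (P j * 'X^m)).
have v1 : v 1%N <= r ^+ 2.
  pose D := \sum_(i < size (P j * P j)) `|(P j * P j)`_i| * (C * r ^+ (i.+1)).
  apply: (@log_convex_bound v D).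
  - by rewrite exprn_gt0.
  - by rewrite /v expr0 mulr1 (mom_PP H) ?eps1.
  - move=> m vm; rewrite /v.
    have -> : P j * 'X^(m.+1) * (P j * 'X^(m.+1)) = P j * 'X^m * (P j * 'X^(m.+2)).
      by rewrite !exprS; ring.
    exact: mom_cauchy_schwarz.
  move=> m; rewrite /v -exprM.
  have -> : P j * 'X^m * (P j * 'X^m) = P j * P j * 'X^(2 * m).
    by rewrite mul2n -addnn exprD; ring.
  rewrite (mom_mulXn _ _ (leqnn _)) /D mulr_suml; apply: ler_sum => i _.
  apply: le_trans (ler_norm _) _; rewrite normrM -mulrA ler_wpM2l // /momf normrN.
  by apply: le_trans (hf _) _; rewrite -mulrA -exprD.
pose a := - (p j)`_0.
have pX : p j = 'X - a%:P.
  have [hm hs] : p j \is monic /\ size (p j) = 2%N.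
    by case: H => _ _ /(_ j); rewrite k1.
  apply/polyP => -[|[|i]]; rewrite coefB coefX coefC /= ?subr0.
  - by rewrite sub0r /a opprK.
  - by move/monicP: hm; rewrite lead_coefE hs.
  - by rewrite nth_default ?hs.
have orth i l : (i < l)%N -> M (P l * P i) = 0 by exact: (mom_PP_lt H).
have [Q MQ hQ] : exists2 Q : {poly R}, M (P j * Q) = 0 /\ M (P j.+1 * Q) = 0 &
   P j * 'X = b j *: P j.+1 + a *: P j + Q.
  case: j @a {v v1 b0} pX => [|i] a pX.
    exists 0; first by rewrite !mulr0 !linear0.
    rewrite P_rec0 scalerA divff ?scale1r; last first.
      by rewrite gt_eqF //; case: H => _ /(_ 0%N) [].
    by rewrite pX /P_poly /= -mul_polyC; ring.
  exists (btilde_pred eps b i.+1 *: P i); last first.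
    rewrite (P_recS H) pX -!mul_polyC; ring.
  by rewrite -!scalerAr !linearZ /= !orth ?mulr0.
have va : M (P j * 'X * (P j * 'X)) = v 1%N by rewrite /v expr1.
have hsum : a ^+ 2 + b j ^+ 2 <= r ^+ 2.
  apply: le_trans v1; rewrite -va hQ.
  set N := P j.+1; set O := P j.
  have -> : (b j *: N + a *: O + Q) * (b j *: N + a *: O + Q) =
    (b j ^+ 2) *: (N * N) + (a ^+ 2) *: (O * O) + (2 * a * b j) *: (N * O)
    + (2 * b j) *: (N * Q) + (2 * a) *: (O * Q) + Q * Q.
    by rewrite -!mul_polyC !polyC_exp !polyCM !polyC_natr; ring.
  rewrite !linearD /= !linearZ /= !(mom_PP H) // !eps1 orth // MQ.1 MQ.2.
  by have := mom_sq_ge0 Q; lra.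
have r_ge0 : 0 <= r by exact: ltW.
have le_r x : 0 <= x -> x ^+ 2 <= r ^+ 2 -> x <= r.
  by move=> x0; rewrite ler_pXn2r ?nnegrE.
split; last by apply: le_r; [exact: ltW | have := sqr_ge0 a; lra].
rewrite -normrN -/a; apply: le_r => //; rewrite real_normK ?num_real //.
by have := sqr_ge0 (b j); lra.
Qed.
End JacobiBound.

End Positivity.

(** * Squared moduli *)

Section SquaredModulus.
Variable R : rcfType.
Local Notation C := R[i].
Implicit Types (z w : C).

(** Squared moduli keep all estimates polynomial in real and imaginary parts.
    The definition is locked so that it stays folded under simplification. *)
Fact sqn_key : unit. Proof. exact: tt. Qed.
Definition sqn z : R :=
  locked_with sqn_key (complex.Re z ^+ 2 + complex.Im z ^+ 2).

Lemma sqnE z : sqn z = complex.Re z ^+ 2 + complex.Im z ^+ 2.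
Proof. by rewrite /sqn unlock. Qed.

Lemma sqn_ge0 z : 0 <= sqn z.
Proof. by rewrite sqnE addr_ge0 ?sqr_ge0. Qed.

Lemma sqnM z w : sqn (z * w) = sqn z * sqn w.
Proof. by case: z => a b; case: w => c d; rewrite !sqnE /=; ring. Qed.

Lemma sqn0 : sqn 0 = 0.
Proof. by rewrite !sqnE /= !expr0n addr0. Qed.

Lemma sqn1 : sqn 1 = 1.
Proof. by rewrite !sqnE /= expr1n expr0n addr0. Qed.

Lemma sqnX z n : sqn (z ^+ n) = sqn z ^+ n.
Proof. by elim: n => [|n IH]; rewrite ?expr0 ?sqn1 // !exprS sqnM IH. Qed.

Lemma sqn_eq0 z : (sqn z == 0) = (z == 0).
Proof.
case: z => a b; rewrite sqnE paddr_eq0 ?sqr_ge0 // !sqrf_eq0 /=.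
by rewrite eq_complex.
Qed.

Lemma sqn_gt0 z : (0 < sqn z) = (z != 0).
Proof. by rewrite lt_def sqn_ge0 andbT sqn_eq0. Qed.

Lemma sqnV z : sqn z^-1 = (sqn z)^-1.
Proof.
have [->|z0] := eqVneq z 0; first by rewrite invr0 sqn0 invr0.
apply: (mulfI (_ : sqn z != 0)); first by rewrite sqn_eq0.
by rewrite -sqnM !divff ?sqn1 // sqn_eq0.
Qed.

Lemma sqnR (x : R) : sqn x%:C = x ^+ 2.
Proof. by rewrite !sqnE /= expr0n addr0. Qed.

Lemma sqnN z : sqn (- z) = sqn z.
Proof. by case: z => a b; rewrite !sqnE /= !sqrrN. Qed.

(** The weights 1 + t and 1 + 1/t let one summand keep a coefficient close to
    1. *)
Lemma sqnD_young (t : R) z w : 0 < t ->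
  sqn (z + w) <= (1 + t) * sqn z + (1 + t^-1) * sqn w.
Proof.
move=> t0; case: z => a b; case: w => c d; rewrite !sqnE /=.
have key x y : (x + y) ^+ 2 <= (1 + t) * x ^+ 2 + (1 + t^-1) * y ^+ 2 :> R.
  have : 0 <= t^-1 * (t * x - y) ^+ 2 by rewrite mulr_ge0 ?sqr_ge0 ?invr_ge0 ?ltW.
  have -> : t^-1 * (t * x - y) ^+ 2 = t * x ^+ 2 - 2 * x * y + t^-1 * y ^+ 2.
    by field; rewrite gt_eqF.
  by lra.
by have := key a c; have := key b d; lra.
Qed.

Lemma sqnD_le z w : sqn (z + w) <= 2 * sqn z + 2 * sqn w.
Proof. by have := sqnD_young z w ltr01; rewrite invr1. Qed.

Lemma sqnD3_le (x y z : C) :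
  sqn (x + y + z) <= 3 * (sqn x + sqn y + sqn z).
Proof.
case: x => a a'; case: y => c c'; case: z => d d'; rewrite !sqnE /=.
have key p q r : (p + q + r) ^+ 2 <= 3 * (p ^+ 2 + q ^+ 2 + r ^+ 2) :> R.
  by have := sqr_ge0 (p - q); have := sqr_ge0 (q - r); have := sqr_ge0 (p - r); lra.
by have := key a c d; have := key a' c' d'; lra.
Qed.
End SquaredModulus.

(** * Truncated Jacobi operators *)

Section JacobiOperator.
Variable R : rcfType.
Local Notation C := R[i].
Variables (a b : nat -> R).

(** The tridiagonal matrix with indices 0, ..., m, with [kap] added to its last
    diagonal entry. *)
Definition jacobi (m : nat) (kap : R) (y : nat -> C) (i : nat) : C :=
  (if i is i'.+1 then (b i')%:C * y i' else 0)
  + (a i + (i == m)%:R * kap)%:C * y i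
  + (if (i < m)%N then (b i)%:C * y i.+1 else 0).

Definition nrm2 (m : nat) (y : nat -> C) : R := \sum_(i < m.+1) sqn (y i).

Lemma nrm2_ge0 m y : 0 <= nrm2 m y.
Proof. by apply: sumr_ge0 => i _; exact: sqn_ge0. Qed.

Lemma sqn_le_nrm2 m y i : (i <= m)%N -> sqn (y i) <= nrm2 m y.
Proof.
rewrite -ltnS => hi; rewrite /nrm2 (bigD1 (Ordinal hi)) //= lerDl.
by apply: sumr_ge0 => j _; exact: sqn_ge0.
Qed.

Lemma jacobi_comb m kap (c d : C) y x i :
  jacobi m kap (fun i => c * y i + d * x i) i =
  c * jacobi m kap y i + d * jacobi m kap x i.
Proof. by rewrite /jacobi; case: i => [|i]; case: ifP => _; ring. Qed.

(** The sum is the imaginary part of the sum of conj(T y) y, which vanishes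
    because T is real symmetric. *)
Lemma jacobi_sym m kap y :
  \sum_(i < m.+1) (complex.Re (jacobi m kap y i) * complex.Im (y i)
     - complex.Im (jacobi m kap y i) * complex.Re (y i)) = 0.
Proof.
have ReE (c : R) (x : C) : complex.Re (c%:C * x) = c * complex.Re x.
  by case: x => u v /=; rewrite mul0r subr0.
have ImE (c : R) (x : C) : complex.Im (c%:C * x) = c * complex.Im x.
  by case: x => u v /=; rewrite mul0r addr0.
have ReD (x x' : C) : complex.Re (x + x') = complex.Re x + complex.Re x'.
  by case: x => u v; case: x'.
have ImD (x x' : C) : complex.Im (x + x') = complex.Im x + complex.Im x'.
  by case: x => u v; case: x'.
pose u i := complex.Re (y i); pose v i := complex.Im (y i).
pose lo i : R := if i is i'.+1 then b i' * (u i' * v i - v i' * u i) else 0.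
pose hi i : R := if (i < m)%N then b i * (u i.+1 * v i - v i.+1 * u i) else 0.
rewrite (eq_bigr (fun i : 'I_m.+1 => lo i + hi i)) => [|i _]; last first.
  rewrite /jacobi !ReD !ImD !ReE !ImE /lo /hi /u /v.
  by case: (i : nat) => [|i']; case: ifP => _; rewrite ?ReE ?ImE /=; ring.
rewrite big_split /= [X in X + _]big_ord_recl [X in _ + X]big_ord_recr /=.
rewrite /hi ltnn addr0 add0r -big_split big1 // => i _ /=.
by rewrite ltn_ord /lo /= ?add1n; ring.
Qed.

Section Bounds.
Variables (L : R) (m : nat) (kap : R).
Hypothesis L0 : 0 < L.
Hypothesis bL : forall i, b i ^+ 2 <= L.
Hypothesis aL : forall i, (a i + (i == m)%:R * kap) ^+ 2 <= L.
Local Notation T := (jacobi m kap).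

Lemma jacobi_le y : nrm2 m (T y) <= 9 * L * nrm2 m y.
Proof.
pose lo i : R := if i is i'.+1 then sqn (y i') else 0.
pose hi i : R := if (i < m)%N then sqn (y i.+1) else 0.
have step (i : 'I_m.+1) : sqn (T y i) <= 3 * L * (lo i + sqn (y i) + hi i).
  apply: le_trans (sqnD3_le _ _ _) _.
  have distr x1 x2 x3 : L * (x1 + x2 + x3) = L * x1 + L * x2 + L * x3 by ring.
  rewrite -mulrA ler_wpM2l // distr; apply: lerD; first apply: lerD.
  - rewrite /lo; case: (i : nat) => [|i']; first by rewrite sqn0 mulr0.
    by rewrite sqnM sqnR ler_wpM2r ?sqn_ge0.
  - by rewrite sqnM sqnR ler_wpM2r ?sqn_ge0.
  rewrite /hi; case: ifP => _; last by rewrite sqn0 mulr0.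
  by rewrite sqnM sqnR ler_wpM2r ?sqn_ge0.
rewrite /nrm2; apply: le_trans (ler_sum _ (fun i _ => step i)) _.
rewrite -mulr_sumr !big_split /=.
have -> : 9 * L = 3 * L * 3 by ring.
rewrite -[leRHS]mulrA ler_wpM2l ?mulr_ge0 ?(ltW L0) //.
set S := \sum_(i < m.+1) sqn (y i).
have lo_le : \sum_(i < m.+1) lo i <= S.
  rewrite big_ord_recl /= add0r /S big_ord_recr /= lerDl; exact: sqn_ge0.
have hi_le : \sum_(i < m.+1) hi i <= S.
  rewrite big_ord_recr /= /hi ltnn addr0 /S big_ord_recl /=.
  rewrite (eq_bigr (fun i : 'I_m => sqn (y i.+1))) => [|i _]; last by rewrite ltn_ord.
  by rewrite lerDr sqn_ge0.
by lra.
Qed.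

Variables (Y t : R) (z : C).
Hypothesis t0 : 0 < t.
Let r2 : R := 9 * L + Y ^+ 2.
Let w : C := z - Y *i.
Hypothesis zout : (1 + t) ^+ 2 * r2 <= sqn w.

Let r2_gt0 : 0 < r2.
Proof. by rewrite ltr_wpDr ?sqr_ge0 ?mulr_gt0. Qed.

(* u = T - iY.  The cross term of |T y - iY y|^2 vanishes by symmetry, so the
   squared norm of u is at most r2. *)
Let u y i : C := T y i - Y *i * y i.

Let u_le y : nrm2 m (u y) <= r2 * nrm2 m y.
Proof.
have -> : nrm2 m (u y) = nrm2 m (T y) + Y ^+ 2 * nrm2 m y
   + 2 * Y * \sum_(i < m.+1) (complex.Re (jacobi m kap y i) * complex.Im (y i)
     - complex.Im (jacobi m kap y i) * complex.Re (y i)).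
  rewrite /nrm2 !mulr_sumr -!big_split /=; apply: eq_bigr => i _.
  by rewrite /u !sqnE; case: (T y i) => p q; case: (y i) => c d /=; ring.
by rewrite jacobi_sym mulr0 addr0 /r2 mulrDl lerD2r jacobi_le.
Qed.

(** Here w y = u y - g, and |w| is at least 1 + t times the norm of u. *)
Lemma resolvent_le y g : (forall i, (i <= m)%N -> T y i - z * y i = g i) ->
  t ^+ 2 * r2 * nrm2 m y <= nrm2 m g.
Proof.
move=> hg.
have h1 : sqn w * nrm2 m y <= (1 + t) * nrm2 m (u y) + (1 + t^-1) * nrm2 m g.
  rewrite /nrm2 !mulr_sumr -big_split /=; apply: ler_sum => i _.
  rewrite -sqnM -[sqn (g i)]sqnN.
  have -> : w * y i = u y i + - g i.
    by rewrite -hg -1?ltnS // /u /w; ring.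
  exact: sqnD_young.
have h2 : (1 + t) ^+ 2 * r2 * nrm2 m y <= sqn w * nrm2 m y.
  by rewrite ler_wpM2r ?nrm2_ge0.
have h3 : (1 + t) * nrm2 m (u y) <= (1 + t) * (r2 * nrm2 m y).
  by rewrite ler_wpM2l ?u_le // addr_ge0 ?ltW.
have h4 : (1 + t) * t * r2 * nrm2 m y <= (1 + t^-1) * nrm2 m g.
  move: (le_trans h2 (le_trans h1 (lerD h3 (lexx _)))).
  by move: (nrm2 m y) (nrm2 m g) => p q; lra.
have t1 : 0 < 1 + t by rewrite addr_gt0.
have h5 : t * ((1 + t) * t * r2 * nrm2 m y) <= t * ((1 + t^-1) * nrm2 m g).
  by rewrite ler_pM2l.
rewrite -(ler_pM2l t1).
have -> : (1 + t) * nrm2 m g = t * ((1 + t^-1) * nrm2 m g).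
  by field; rewrite gt_eqF.
by apply: le_trans h5; rewrite le_eqVlt; apply/orP; left; apply/eqP; ring.
Qed.

Lemma resolvent_uniq y : (forall i, (i <= m)%N -> T y i - z * y i = 0) ->
  forall i, (i <= m)%N -> y i = 0.
Proof.
move=> hy i im; apply/eqP; rewrite -sqn_eq0 eq_le sqn_ge0 andbT.
apply: le_trans (sqn_le_nrm2 _ im) _.
have := resolvent_le (g := fun=> 0) hy.
rewrite /nrm2 [X in _ <= X]big1 => [|j _]; last by rewrite sqn0.
by rewrite pmulr_rle0 // mulr_gt0 ?exprn_gt0.
Qed.

Lemma resolvent_first_le y :
  (forall i, (i <= m)%N -> T y i - z * y i = (i == 0%N)%:R) ->
  t ^+ 2 * r2 * nrm2 m y <= 1.
Proof.
move=> /resolvent_le /le_trans; apply; rewrite /nrm2 big_ord_recl /= sqn1.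
by rewrite big1 ?addr0 // => i _; rewrite sqn0.
Qed.

(** The source sits at index m, so u y = w y at the indices below m; as u is
    tridiagonal, u^m y = w^m y at the index 0.  Compare |w|^m with the norm of
    u^m. *)
Lemma resolvent_last_le y :
  (forall i, (i <= m)%N -> T y i - z * y i = (i == m)%:R) ->
  t ^+ 2 * r2 * ((1 + t) ^+ (2 * m) * sqn (y 0%N)) <= 1.
Proof.
move=> hy; have := resolvent_le hy.
rewrite {2}/nrm2 big_ord_recr /= eqxx sqn1 big1 ?add0r => [|i _]; last first.
  by rewrite ltn_eqF ?ltn_ord // sqn0.
have c0 : 0 <= t ^+ 2 * r2 by rewrite ltW // mulr_gt0 ?exprn_gt0.
apply: le_trans; apply: ler_wpM2l => //.
have u_local (x : nat -> C) (c : C) i : (i < m)%N ->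
    (forall j, (j <= i.+1)%N -> x j = c * y j) -> u x i = c * u y i.
  move=> im h; rewrite /u /jacobi im !h //.
  by case: i h {im} => [|i] h; rewrite ?h ?leqW //; ring.
have pow l : forall i, (i + l <= m)%N -> iter l u y i = w ^+ l * y i.
  elim: l => [|l IH] i il; first by rewrite expr0 mul1r.
  have im : (i < m)%N by lia.
  have hi : T y i = z * y i.
    by apply/eqP; rewrite -subr_eq0 hy ?(ltnW im) // ltn_eqF.
  have uw : u y i = w * y i by rewrite /u hi /w; ring.
  rewrite exprSr -mulrA -uw.
  by rewrite iterS; apply: u_local => // j ji; apply: IH; lia.
have hu l : nrm2 m (iter l u y) <= r2 ^+ l * nrm2 m y.
  elim: l => [|l IH]; first by rewrite expr0 mul1r.
  rewrite iterS exprS -mulrA; apply: le_trans (u_le _) _.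
  by rewrite ler_wpM2l // ltW.
have h1 : sqn w ^+ m * sqn (y 0%N) <= r2 ^+ m * nrm2 m y.
  rewrite -sqnX -sqnM -pow ?add0n //; apply: le_trans (hu m).
  exact: sqn_le_nrm2.
rewrite -(ler_pM2l (exprn_gt0 m r2_gt0)); apply: le_trans h1.
rewrite mulrA ler_wpM2r ?sqn_ge0 // exprM -exprMn mulrC.
by rewrite lerXn2r // ?nnegrE ?sqn_ge0 // mulr_ge0 ?sqr_ge0 ?(ltW r2_gt0).
Qed.

End Bounds.
End JacobiOperator.

(** * Resolvents and the three-term recurrence *)

Section ThreeTerm.
Variable R : rcfType.
Local Notation C := R[i].
Variables (a b kap : nat -> R) (bt L : R).
Hypothesis L0 : 0 < L.
Hypothesis bL : forall i, b i ^+ 2 <= L.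
Hypothesis aL : forall m i, (a i + (i == m)%:R * kap m) ^+ 2 <= L.
Hypothesis bt0 : bt != 0.
Local Notation T m := (jacobi a b m (kap m)).

(** The index is shifted by one: y 0 is the value preceding the first index of
    the truncated operators, and [bt] is the coefficient that couples it. *)
Definition three_term (z : C) (y : nat -> C) : Prop := forall i,
  (if i is i'.+1 then b i' else bt)%:C * y i + (a i)%:C * y i.+1
    + (b i)%:C * y i.+2 = z * y i.+1.

(** The defect at index m of a solution, for the truncation whose last diagonal
    entry is increased by [kap m]. *)
Definition bdry (m : nat) (y : nat -> C) : C :=
  (b m)%:C * y m.+2 - (kap m)%:C * y m.+1.

Definition resolvent_at (m : nat) (z : C) (j : nat) (h : nat -> C) : Prop :=
  forall i, (i <= m)%N -> T m h i - z * h i = (i == j)%:R.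

(** A solution of the recurrence fails to be a null vector of the truncation
    only at the two ends. *)
Lemma jacobi_sol z y m i : three_term z y -> (i <= m)%N ->
  T m (fun i => y i.+1) i - z * y i.+1 =
  - ((i == 0%N)%:R * bt%:C * y 0%N) - (i == m)%:R * bdry m y.
Proof.
move=> hy im; rewrite -hy /jacobi /bdry rmorphD rmorphM rmorph_nat /=.
move: im; rewrite leq_eqVlt => /orP[/eqP ->|im].
  rewrite ltnn eqxx; case: m => [|m] /=; ring.
by rewrite im (ltn_eqF im); case: i im => [|i] im /=; ring.
Qed.

(* Both a_m and a_m + kap m are bounded by sqrt L. *)
Let kapL m : kap m ^+ 2 <= 4 * L.
Proof.
have := aL m m; have := aL m.+1 m; rewrite eqxx (ltn_eqF (ltnSn m)).
rewrite mul0r mul1r addr0; move: (a m) (kap m) => x y h1 h2.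
by have := sqr_ge0 (x + y + x); lra.
Qed.

(** The disc with centre iY through the points +-sqrt(9 L), which bound the
    spectra of all the truncations; [far] is the outside of a slightly larger
    concentric disc. *)
Definition disc2 (Y : R) : R := 9 * L + Y ^+ 2.
Definition far (Y t : R) (z : C) : Prop :=
  (1 + t) ^+ 2 * disc2 Y <= sqn (z - Y *i).

Lemma disc2_gt0 Y : 0 < disc2 Y.
Proof. by rewrite ltr_wpDr ?sqr_ge0 ?mulr_gt0. Qed.

Section Region.
Variables (Y t : R).
Hypothesis t0 : 0 < t.
Let c := t ^+ 2 * disc2 Y.

Lemma res_bound m z h : far Y t z -> resolvent_at m z 0 h ->
  c * nrm2 m h <= 1.
Proof. by move=> fz hh; exact: (resolvent_first_le L0 bL (aL m) t0 fz hh). Qed.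

(** The difference of two first columns solves the system with source
    (z - z1) h1, by the resolvent identity. *)
Lemma res_lipschitz m z z1 h h1 : far Y t z -> far Y t z1 ->
  resolvent_at m z 0 h -> resolvent_at m z1 0 h1 ->
  c ^+ 2 * sqn (h 0%N - h1 0%N) <= sqn (z - z1).
Proof.
move=> fz fz1 hh hh1.
have c0 : 0 <= c by rewrite mulr_ge0 ?sqr_ge0 // ltW ?disc2_gt0.
have hd i : (i <= m)%N -> T m (fun i => 1 * h i + (-1) * h1 i) i
    - z * (1 * h i + (-1) * h1 i) = (z - z1) * h1 i.
  move=> im; rewrite jacobi_comb; have := hh _ im; have := hh1 _ im.
  by move=> /eqP; rewrite subr_eq => /eqP -> /eqP; rewrite subr_eq => /eqP ->; ring.
have := resolvent_le L0 bL (aL m) t0 fz hd.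
have -> : nrm2 m (fun i => (z - z1) * h1 i) = sqn (z - z1) * nrm2 m h1.
  by rewrite /nrm2 mulr_sumr; apply: eq_bigr => i _; rewrite sqnM.
move=> h2; have h3 := res_bound fz1 hh1.
have : c * (sqn (z - z1) * nrm2 m h1) <= sqn (z - z1).
  by rewrite mulrCA -[leRHS]mulr1 ler_wpM2l ?sqn_ge0.
apply: le_trans; rewrite expr2 -mulrA ler_wpM2l //; apply: le_trans h2.
rewrite ler_wpM2l //.
have -> : h 0%N - h1 0%N = 1 * h 0%N + (-1) * h1 0%N by ring.
by have := sqn_le_nrm2 (fun i => 1 * h i + (-1) * h1 i) (leq0n m).
Qed.

Section Pair.
Variables (z : C) (p q : nat -> C).
Hypothesis fz : far Y t z.
Hypothesis hp : three_term z p.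
Hypothesis hq : three_term z q.
Hypothesis w0 : p 1%N * q 0%N - q 1%N * p 0%N != 0.

(** [casoratian m] is, up to a nonzero factor, the determinant of the
    truncated system, and [res0 m] the upper left entry of its resolvent. *)
Definition casoratian m : C := bdry m p * q 0%N - bdry m q * p 0%N.
Definition res0 m : C :=
  (p 1%N * bdry m q - q 1%N * bdry m p) / (bt%:C * casoratian m).

(** If it vanished, the solution q 0 * p - p 0 * q, which is 0 before the first
    index, would be a null vector of the truncation. *)
Lemma casoratian_neq0 m : casoratian m != 0.
Proof.
apply/eqP => X0; case/eqP: w0.
pose V i := q 0%N * p i.+1 + (- p 0%N) * q i.+1.
suff : V 0%N = 0 by rewrite /V => <-; ring.
have uniq := resolvent_uniq L0 bL (aL m) t0 fz.
apply: (uniq V _ 0%N); last exact: leq0n.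
move=> i im.
rewrite /V (jacobi_comb a b m (kap m) (q 0%N) (- p 0%N)
  (fun i => p i.+1) (fun i => q i.+1)).
have := jacobi_sol hp im; have := jacobi_sol hq im.
move=> /eqP; rewrite subr_eq => /eqP -> /eqP; rewrite subr_eq => /eqP ->.
rewrite -[RHS](mulr0 (- (i == m)%:R)) -X0 /casoratian; ring.
Qed.

Lemma res_last m : resolvent_at m z m
  (fun i => (- q 0%N / casoratian m) * p i.+1 + (p 0%N / casoratian m) * q i.+1).
Proof.
move=> i im; have X0 := casoratian_neq0 m.
rewrite (jacobi_comb a b m (kap m) _ _ (fun i => p i.+1) (fun i => q i.+1)).
have := jacobi_sol hp im; have := jacobi_sol hq im.
move=> /eqP; rewrite subr_eq => /eqP -> /eqP; rewrite subr_eq => /eqP ->.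
move: X0; rewrite /casoratian => X0; field; exact: X0.
Qed.

Lemma res_first m : resolvent_at m z 0
  (fun i => (bdry m q / (bt%:C * casoratian m)) * p i.+1
          + (- bdry m p / (bt%:C * casoratian m)) * q i.+1).
Proof.
move=> i im; have X0 := casoratian_neq0 m.
have bt0C : bt%:C != 0 by rewrite fmorph_eq0.
rewrite (jacobi_comb a b m (kap m) _ _ (fun i => p i.+1) (fun i => q i.+1)).
have := jacobi_sol hp im; have := jacobi_sol hq im.
move=> /eqP; rewrite subr_eq => /eqP -> /eqP; rewrite subr_eq => /eqP ->.
by move: X0; rewrite /casoratian => X0; field; rewrite X0; exact: bt0C.
Qed.

Lemma res_first0 m : (bdry m q / (bt%:C * casoratian m)) * p 1
          + (- bdry m p / (bt%:C * casoratian m)) * q 1 = res0 m.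
Proof. by rewrite /res0; ring. Qed.

(** Together with [bdry_q] this exhibits bdry q / bdry p as the Moebius image
    of [res0 m] under a map that does not depend on m. *)
Lemma bdry_p m : (p 1%N + bt%:C * p 0%N * res0 m) * casoratian m =
  bdry m p * (p 1%N * q 0%N - q 1%N * p 0%N).
Proof.
have X0 := casoratian_neq0 m; have bt0C : bt%:C != 0 by rewrite fmorph_eq0.
by rewrite /res0; move: X0; rewrite /casoratian => X0; field; rewrite X0; exact: bt0C.
Qed.

Lemma bdry_q m : (q 1%N + bt%:C * q 0%N * res0 m) * casoratian m =
  bdry m q * (p 1%N * q 0%N - q 1%N * p 0%N).
Proof.
have X0 := casoratian_neq0 m; have bt0C : bt%:C != 0 by rewrite fmorph_eq0.
by rewrite /res0; move: X0; rewrite /casoratian => X0; field; rewrite X0; exact: bt0C.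
Qed.

(** The Wronskian divided by the casoratian is the upper right entry of the
    resolvent. *)
Lemma casoratian_large m : c * ((1 + t) ^+ (2 * m) *
  sqn ((p 1%N * q 0%N - q 1%N * p 0%N) / casoratian m)) <= 1.
Proof.
have := resolvent_last_le L0 bL (aL m) t0 fz (@res_last m).
set x := (X in sqn X); set x' := (X in _ -> _ * (_ * sqn X) <= _).
by have -> // : x' = - x; rewrite ?sqnN // /x /x'; ring.
Qed.

(** On the indices 0, ..., m the first column g of the resolvent of the larger
    truncation solves the smaller system with an additional source xi at the
    index m, so the two upper left entries differ by xi times the upper right
    entry of the smaller resolvent. *)
Lemma res0_cauchy m l : (m < l)%N ->
  c ^+ 2 * ((1 + t) ^+ (2 * m) * sqn (res0 l - res0 m)) <= 10 * L.
Proof.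
move=> ml.
have c0 : 0 <= c by rewrite mulr_ge0 ?sqr_ge0 // ltW ?disc2_gt0.
have [g [hg g0]] : exists g, resolvent_at l z 0 g /\ g 0%N = res0 l.
  by eexists; split; [exact: res_first | exact: res_first0].
have [h [hh h0]] : exists h, resolvent_at m z 0 h /\ h 0%N = res0 m.
  by eexists; split; [exact: res_first | exact: res_first0].
have [e [he e0]] : exists e, resolvent_at m z m e /\
    c * ((1 + t) ^+ (2 * m) * sqn (e 0%N)) <= 1.
  eexists; split; first exact: res_last.
  exact: (resolvent_last_le L0 bL (aL m) t0 fz (@res_last m)).
pose xi := (kap m)%:C * g m - (b m)%:C * g m.+1.
have hgm i : (i <= m)%N -> T m g i - z * g i = (i == 0%N)%:R + (i == m)%:R * xi.
  move=> im; rewrite -(hg i); last by lia.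
  have il : (i < l)%N by lia.
  rewrite /xi /jacobi il (ltn_eqF il) !rmorphD !rmorphM !rmorph_nat /=.
  move: im {il}; rewrite leq_eqVlt => /orP[/eqP ->|im].
    by rewrite ltnn eqxx /=; ring.
  by rewrite im (ltn_eqF im) /=; ring.
have uniq := resolvent_uniq L0 bL (aL m) t0 fz.
have diff : res0 l - res0 m = xi * e 0%N.
  apply/eqP; rewrite -subr_eq0 -g0 -h0; apply/eqP.
  have -> : g 0%N - h 0%N - xi * e 0%N =
    1 * (1 * g 0%N + (-1) * h 0%N) + (- xi) * e 0%N by ring.
  apply: (uniq (fun i => 1 * (1 * g i + (-1) * h i) + (- xi) * e i) _ 0%N).
    2: exact: leq0n.
  move=> i im.
  rewrite (jacobi_comb a b m (kap m) _ _ (fun i => 1 * g i + (-1) * h i) e).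
  rewrite (jacobi_comb a b m (kap m) _ _ g h).
  have := hgm _ im; have := hh _ im; have := he _ im.
  move=> /eqP; rewrite subr_eq => /eqP -> /eqP; rewrite subr_eq => /eqP -> /eqP.
  by rewrite subr_eq => /eqP ->; ring.
have xiL : c * sqn xi <= 10 * L.
  have h1 : sqn xi <= 10 * L * nrm2 l g.
    apply: le_trans (sqnD_le _ _) _; rewrite sqnN !sqnM !sqnR.
    have s1 : kap m ^+ 2 * sqn (g m) <= 4 * L * nrm2 l g.
      by apply: ler_pM; rewrite ?sqr_ge0 ?sqn_ge0 ?kapL ?sqn_le_nrm2 // ltnW.
    have s2 : b m ^+ 2 * sqn (g m.+1) <= L * nrm2 l g.
      by apply: ler_pM; rewrite ?sqr_ge0 ?sqn_ge0 ?sqn_le_nrm2.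
    by lra.
  apply: le_trans (ler_wpM2l c0 h1) _.
  rewrite mulrCA -[leRHS]mulr1 ler_wpM2l ?mulr_ge0 ?(ltW L0) //.
  exact: res_bound fz hg.
have -> : c ^+ 2 * ((1 + t) ^+ (2 * m) * sqn (res0 l - res0 m)) =
  (c * sqn xi) * (c * ((1 + t) ^+ (2 * m) * sqn (e 0%N))).
  by rewrite diff sqnM; ring.
rewrite -[leRHS]mulr1; apply: ler_pM => //; first by rewrite mulr_ge0 ?sqn_ge0.
apply: mulr_ge0 => //; apply: mulr_ge0; last exact: sqn_ge0.
by apply: exprn_ge0; rewrite addr_ge0 ?ltW.
Qed.

End Pair.
End Region.
End ThreeTerm.

(** * Cauchy transforms with polynomial weights *)

Section RationalIntegrals.
Variable R : realType.
Local Notation C := R[i].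
Variable sigma : {finite_measure set (measurableTypeR R) -> \bar R}.

Implicit Types (g h G N : {poly R}) (z : C).
Local Notation D := (`[-1, 1]%classic : set R).

Let mD : measurable (D : set (measurableTypeR R)).
Proof. exact: measurable_itv. Qed.

Definition pos_on N : Prop := forall t, D t -> 0 < N.[t].

Definition ratint G N : R := \int[sigma]_(t in D) (G.[t] / N.[t]).

Lemma rat_continuous G N : pos_on N ->
  {within D, continuous (fun t : R => G.[t] / N.[t])}.
Proof.
move=> N0; apply: continuous_in_subspaceT => t /set_mem Dt.
apply: cvgM; first exact: continuous_horner.
apply: cvgV; first by rewrite gt_eqF // N0.
exact: continuous_horner.
Qed.

Lemma rat_integrable G N : pos_on N ->
  sigma.-integrable D (EFin \o (fun t : R => G.[t] / N.[t])).
Proof.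
move=> N0; have cf := rat_continuous (G:=G) N0.
apply: measurable_bounded_integrable => //.
- by rewrite ltey_eq fin_num_measure.
- exact: (subspace_continuous_measurable_fun mD cf).
have /compact_bounded := continuous_compact cf (segment_compact (a := -1) (b := 1)).
case=> M [Mr hM]; exists M; split=> // x Mx t Dt.
by apply: hM => //; exists t.
Qed.

Lemma ratintD G G' N : pos_on N -> ratint (G + G') N = ratint G N + ratint G' N.
Proof.
move=> N0; rewrite /ratint -RintegralD //; [|exact: rat_integrable..].
by apply: eq_Rintegral => t _; rewrite hornerD mulrDl.
Qed.

Lemma ratintZ (c : R) G N : pos_on N -> ratint (c *: G) N = c * ratint G N.
Proof.
move=> N0; rewrite /ratint -RintegralZl //; last exact: rat_integrable.
by apply: eq_Rintegral => t _; rewrite hornerZ mulrA.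
Qed.

Lemma ratint_ext G N G' N' : (forall t, D t -> G.[t] / N.[t] = G'.[t] / N'.[t]) ->
  ratint G N = ratint G' N'.
Proof. by move=> h; apply: eq_Rintegral => t /set_mem; exact: h. Qed.

Lemma ratint_le G N G' N' : pos_on N -> pos_on N' ->
  (forall t, D t -> G.[t] / N.[t] <= G'.[t] / N'.[t]) -> ratint G N <= ratint G' N'.
Proof. by move=> N0 N0' h; apply: le_Rintegral => //; apply: rat_integrable. Qed.

Lemma ratint_norm_le G N G' N' : pos_on N -> pos_on N' ->
  (forall t, D t -> `|G.[t] / N.[t]| <= G'.[t] / N'.[t]) -> `|ratint G N| <= ratint G' N'.
Proof.
move=> N0 N0' h; rewrite ler_norml; apply/andP; split.
  rewrite -mulN1r -ratintZ //; apply: ratint_le => // t Dt.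
  by have := h _ Dt; rewrite ler_norml hornerZ mulN1r mulNr => /andP[].
by apply: ratint_le => // t Dt; have := h _ Dt; rewrite ler_norml => /andP[].
Qed.

Lemma pos_on1 : pos_on 1.
Proof. by move=> t _; rewrite hornerC. Qed.

Lemma horner_bounded G : exists2 M : R, 0 <= M & forall t, D t -> `|G.[t]| <= M.
Proof.
have /compact_bounded := continuous_compact (rat_continuous (G:=G) pos_on1)
   (segment_compact (a := -1) (b := 1)).
case=> M [Mr hM]; exists (`|M| + 1); first by rewrite addr_ge0.
move=> t Dt; have -> : G.[t] = G.[t] / (1 : {poly R}).[t] by rewrite hornerC divr1.
by apply: hM; [rewrite (le_lt_trans (ler_norm _)) // ltrDl | exists t].
Qed.

(** This polynomial in t is |t - z|^2; it is the common denominator of the real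
    and imaginary parts of 1 / (t - z). *)
Definition den z : {poly R} := ('X - (complex.Re z)%:P) ^+ 2 + (complex.Im z ^+ 2)%:P.

Lemma denE z t : (den z).[t] = sqn (t%:C - z).
Proof.
case: z => x y; rewrite /den sqnE /= !hornerE /=; ring.
Qed.

Definition off z := ~ real_segment (-1) 1 z.

Lemma den_pos z : off z -> pos_on (den z).
Proof.
move=> oz t Dt; rewrite denE sqn_gt0; apply/eqP => h; apply: oz.
by exists t => //; apply/eqP; rewrite -subr_eq0 h.
Qed.

(** int g(t) / (t - z) dsigma(t), split into real integrals of rational
    functions. *)
Definition Itr g z : C :=
  (ratint (g * ('X - (complex.Re z)%:P)) (den z)) +i* (ratint (complex.Im z *: g) (den z)).

Lemma cauchy_transformE z : cauchy_transform sigma z = Itr 1 z.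
Proof.
case: z => x y; rewrite /cauchy_transform /Cintegral /Itr /ratint /=.
congr (_ +i* _); apply: eq_Rintegral => t _.
  by rewrite mul1r denE sqnE /= !hornerE.
by rewrite hornerZ hornerC mulr1 denE sqnE /= sub0r -mulNr opprK.
Qed.

Definition cpoly : {poly R} -> {poly C} := map_poly (real_complex R).

Lemma real_complexM_complex (c a b : R) : c%:C * (a +i* b) = (c * a) +i* (c * b).
Proof. by apply/eqP; rewrite eq_complex /= !mul0r subr0 addr0 !eqxx. Qed.

Lemma ItrD g h z : off z -> Itr (g + h) z = Itr g z + Itr h z.
Proof.
move=> oz; have N0 := den_pos oz.
by rewrite /Itr mulrDl scalerDr !ratintD.
Qed.

Lemma ItrZ c g z : off z -> Itr (c *: g) z = c%:C * Itr g z.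
Proof.
move=> oz; have N0 := den_pos oz; rewrite /Itr real_complexM_complex.
by congr (_ +i* _); rewrite -?scalerAl !ratintZ // mulrCA.
Qed.

Lemma ItrX g z : off z -> Itr ('X * g) z = z * Itr g z + (ratint g 1)%:C.
Proof.
move=> oz; have N0 := den_pos oz.
have -> : ratint g 1 = ratint (den z * g) (den z).
  apply: ratint_ext => t Dt; rewrite hornerM hornerC divr1 [_ * g.[t]]mulrC mulfK //.
  by rewrite gt_eqF // N0.
move: oz N0; case: z => x y oz N0; rewrite /Itr /=.
have cM (a b c d : R) : (a +i* b) * (c +i* d) = (a * c - b * d) +i* (a * d + b * c).
  by [].
have cD (a b c d : R) : (a +i* b) + (c +i* d) = (a + c) +i* (b + d) by [].
rewrite -(complexr0 (ratint _ _)) cM cD addr0 -mulNr -!ratintZ // -!ratintD //.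
congr (_ +i* _); congr (ratint _ _); rewrite /den /= -!mul_polyC ?polyCN ?polyC_exp; ring.
Qed.

(** (g(z) - g(t)) / (t - z) is a polynomial in z and t. *)
Lemma Itr_mul g h : exists pi : {poly R}, forall z, off z ->
  (cpoly g).[z] * Itr h z = Itr (g * h) z + (cpoly pi).[z].
Proof.
elim/poly_ind: g => [|g c [pi IH]].
  exists 0 => z oz; rewrite /cpoly map_poly0 hornerE !mul0r addr0.
  by rewrite -[0 in RHS](scale0r (1 : {poly R})) ItrZ // mul0r.
exists ('X * pi - (ratint (g * h) 1)%:P) => z oz.
rewrite /cpoly rmorphD rmorphM /= map_polyX map_polyC /= hornerMXaddC.
rewrite rmorphB rmorphM /= map_polyX map_polyC /= hornerD hornerN hornerM hornerX hornerC.
have -> : (g * 'X + c%:P) * h = 'X * (g * h) + c *: h.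
  by rewrite -mul_polyC; ring.
rewrite ItrD // ItrX // ItrZ //; have := IH _ oz; rewrite /cpoly => IH'.
have -> : Itr (g * h) z = (map_poly (real_complex R) g).[z] * Itr h z
   - (map_poly (real_complex R) pi).[z] by rewrite IH' addrK.
ring.
Qed.

Lemma Itr_real g : exists2 M : R, 0 <= M & forall x, 1 < x ->
  `|complex.Re (Itr g x%:C)| <= M / (x - 1).
Proof.
have [M M0 hM] := horner_bounded g.
have Ms0 : 0 <= ratint M%:P 1.
  apply: Rintegral_ge0 => t _; by rewrite !hornerC divr1.
exists (ratint M%:P 1) => // x x1.
have x1' : 0 < x - 1 by rewrite subr_gt0.
have oz : off x%:C.
  by move=> [t /=]; rewrite in_itv /= => /andP[_ t1] [tx]; move: x1; rewrite -tx ltNge t1.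
have N0 := den_pos oz.
rewrite /Itr /= [leRHS]mulrC -ratintZ; last exact: pos_on1.
apply: ratint_norm_le => // [|t Dt]; first exact: pos_on1.
rewrite denE sqnE /= hornerZ !hornerC divr1 !hornerE ?subrr oppr0 expr0n /= addr0.
move: (Dt); rewrite /= in_itv /= => /andP[t1 t2].
have tx : t - x < 0 by lra.
have -> : g.[t] * (t - x) / (t - x) ^+ 2 = g.[t] / (t - x).
  by field; rewrite lt_eqF.
have tx' : 0 < - (t - x) by lra.
rewrite normrM mulrC normfV (ltr0_norm tx); apply: ler_pM => //.
- by rewrite invr_ge0 ltW.
- by rewrite lef_pV2 ?posrE //; lra.
exact: hM.
Qed.

(** By |g| <= g^2 + 1, the integral of |g| q is controlled by that of g^2 q.
    This is what makes the remainders bounded when g is an orthogonal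
    polynomial. *)
Lemma Itr_bound q g z (d : R) : (forall t, D t -> 0 <= q.[t]) -> off z -> 0 < d ->
  (forall t, D t -> d ^+ 2 <= sqn (t%:C - z)) ->
  sqn (Itr (g * q) z) <= 2 * ((ratint (g * (g * q)) 1 + ratint q 1) / d) ^+ 2.
Proof.
move=> q0 oz d0 hd; have N0 := den_pos oz.
set B := (_ + _) / d.
have key (G : {poly R}) : (forall t, D t -> G.[t] ^+ 2 <= sqn (t%:C - z)) ->
    `|ratint (g * q * G) (den z)| <= B.
  move=> hG; rewrite /B -ratintD; last exact: pos_on1.
  rewrite [leRHS]mulrC -ratintZ; last exact: pos_on1.
  apply: ratint_norm_le => // [|t Dt]; first exact: pos_on1.
  rewrite denE hornerZ hornerD !hornerM hornerC divr1.
  set s := sqn _; have s0 : 0 < s by have := N0 _ Dt; rewrite denE.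
  have qt := q0 _ Dt.
  have Gs : `|G.[t]| / s <= d^-1.
    rewrite ler_pdivrMr // mulrC ler_pdivlMr //.
    have Gs2 : `|G.[t]| ^+ 2 <= s by rewrite real_normK ?num_real // hG.
    rewrite -(@ler_pXn2r _ 2) ?nnegrE ?mulr_ge0 ?(ltW d0) ?(ltW s0) //.
    by rewrite exprMn expr2 -/s; apply: ler_pM; rewrite ?sqr_ge0 // hd.
  rewrite !normrM normfV (gtr0_norm s0) (ger0_norm qt).
  have -> : `|g.[t]| * q.[t] * `|G.[t]| / s = (`|G.[t]| / s) * (`|g.[t]| * q.[t]).
    by ring.
  apply: ler_pM; rewrite ?mulr_ge0 ?invr_ge0 ?(ltW s0) //.
  rewrite mulrA -[X in _ + X]mul1r -mulrDl ler_wpM2r //.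
  have := sqr_ge0 (`|g.[t]| - 1); have := normr_ge0 g.[t].
  by rewrite -expr2 -[g.[t] ^+ 2]real_normK ?num_real //; nra.
have B0 : 0 <= B by apply: le_trans (key 0 _) => // t Dt; rewrite hornerC expr0n sqn_ge0.
have sq x : `|x| <= B -> x ^+ 2 <= B ^+ 2.
  by move=> xB; rewrite -[x ^+ 2]real_normK ?num_real // ler_pXn2r ?nnegrE.
rewrite sqnE /Itr /= mulr_natl mulr2n; apply: lerD; apply: sq.
  apply: key => t Dt; rewrite !hornerE sqnE /=; case: (z) => x y /=.
  by rewrite lerDl sqr_ge0.
rewrite -mul_polyC mulrC; apply: key => t Dt; rewrite hornerC sqnE /=.
by case: (z) => x y /=; rewrite sub0r sqrrN lerDr sqr_ge0.
Qed.

End RationalIntegrals.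

(** * Polynomials that stay bounded at infinity *)

Section RealAsymptotics.
Variable R : realType.
Implicit Types (p : {poly R}).

Lemma poly_growth p (x : R) : 1 <= x ->
  `|p.[x]| <= (\sum_(i < size p) `|p`_i|) * x ^+ (size p).-1.
Proof.
move=> x1; rewrite horner_coef mulr_suml; apply: le_trans (ler_norm_sum _ _ _) _.
apply: ler_sum => i _; rewrite normrM ler_wpM2l // normrX ger0_norm ?(le_trans _ x1) //.
by apply: ler_weXn2l => //; have := ltn_ord i; lia.
Qed.

(** If X p + c is bounded then p x = O(1/x); by induction p is constant, hence
    zero. *)
Lemma poly_bounded_const p (B X : R) :
  (forall x, X <= x -> `|p.[x]| <= B) -> (size p <= 1)%N.
Proof.
elim/poly_ind: p B X => [|p c IH] B X hp; first by rewrite size_poly0.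
pose X' := Num.max X 1.
have hp' x : X' <= x -> `|p.[x]| * x <= B + `|c|.
  rewrite ge_max => /andP[Xx x1]; have x0 : 0 <= x by apply: le_trans x1.
  have -> : `|p.[x]| * x = `|p.[x] * x| by rewrite normrM (ger0_norm x0).
  apply: le_trans (lerD (hp _ Xx) (lexx `|c|)).
  rewrite hornerMXaddC -[p.[x] * x in leLHS](addrK c).
  by apply: le_trans (ler_normB _ _) _.
have B0 : 0 <= B + `|c|.
  apply: le_trans (hp' X' (lexx _)); rewrite mulr_ge0 //.
  by rewrite le_max ler01 orbT.
have /IH sp : forall x, X' <= x -> `|p.[x]| <= B + `|c|.
  move=> x Xx; apply: le_trans (hp' _ Xx).
  by rewrite ler_peMr //; move: Xx; rewrite ge_max => /andP[].
suff -> : p = 0 by rewrite mul0r add0r size_polyC leq_b1.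
move: hp'; rewrite (size1_polyC sp); set a := p`_0 => hp'.
have [->//|a0] := eqVneq a 0; exfalso.
have na : 0 < `|a| by rewrite normr_gt0.
pose x := X' + (B + `|c| + 1) / `|a|.
have Xx : X' <= x by rewrite lerDl divr_ge0 // (addr_ge0 B0).
have X0 : 0 <= X' by rewrite le_max ler01 orbT.
have := hp' x Xx; rewrite hornerC /x mulrDr mulrC [_ * (_ / _)]mulrC divfK ?gt_eqF //.
have : 0 <= X' * `|a| by rewrite mulr_ge0.
by lra.
Qed.

Lemma poly_decay0 p (B X : R) :
  (forall x, X <= x -> `|x * p.[x]| <= B) -> p = 0.
Proof.
move=> hp; have : (size ('X * p)%R <= 1)%N.
  by apply: (@poly_bounded_const _ B X) => x /hp; rewrite hornerM hornerX.
rewrite mulrC; have [->//|p0] := eqVneq p 0.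
by rewrite size_mulX // ltnS leqn0 size_poly_eq0 (negbTE p0).
Qed.

Lemma const_decay0 (a B X : R) : (forall x, X <= x -> `|a| * x <= B) -> a = 0.
Proof.
move=> ha; apply: polyC_inj; apply: (@poly_decay0 _ B (Num.max X 0)) => x.
by rewrite ge_max => /andP[/ha h x0]; rewrite hornerC normrM mulrC (ger0_norm x0).
Qed.
End RealAsymptotics.

(** * Complex limits *)

Section ComplexTopology.
Variable R : realType.
Local Notation C := R[i].

Lemma norm_sqn (z : C) : `|z| = (Num.sqrt (sqn z))%:C.
Proof. by rewrite normc_def sqnE. Qed.

Lemma norm_lt_sqn (z : C) (e : R) : 0 < e -> (`|z| < e%:C) = (sqn z < e ^+ 2).
Proof.
move=> e0; rewrite norm_sqn ltcR -[e in LHS](gtr0_norm e0) -sqrtr_sqr.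
by rewrite ltr_sqrt // exprn_gt0.
Qed.

Lemma near_sqn (z0 : C) (e : R) : 0 < e -> \forall z \near z0, sqn (z - z0) < e.
Proof.
move=> e0; have s0 : 0 < Num.sqrt e by rewrite sqrtr_gt0.
have s0' : 0 < (Num.sqrt e)%:C :> C by rewrite ltcR.
near=> z; rewrite -[e](sqr_sqrtr (ltW e0)) -norm_lt_sqn // distrC.
Unshelve. end_near. Qed.

Lemma cvg_sqn (T : Type) (F : set_system T) (f : T -> C) (l : C) : Filter F ->
  (forall e : R, 0 < e -> \forall x \near F, sqn (f x - l) < e) ->
  f x @[x --> F] --> l.
Proof.
move=> FF h; apply/cvgrPdist_lt => e e0.
have [er er0 ->] : exists2 r : R, 0 < r & e = r%:C.
  move: e0; case: e => a b; rewrite ltcE /= => /andP[/eqP -> a0].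
  by exists a.
by apply: filterS (h _ (exprn_gt0 2 er0)) => x; rewrite distrC norm_lt_sqn.
Qed.

(** For complex-valued functions this is convergence in the usual sense, as
    [cvg_sqn] and [cvg_tends] show. *)
Definition tends (T : Type) (F : set_system T) (f : T -> C) (l : C) : Prop :=
  forall e : R, 0 < e -> \forall x \near F, sqn (f x - l) < e.

Lemma cvg_tends (T : Type) (F : set_system T) (f : T -> C) (l : C) : Filter F ->
  f x @[x --> F] --> l -> tends F f l.
Proof. by move=> FF h e /(near_sqn l); exact: h. Qed.

Section Tends.
Context {T : Type} {F : set_system T} {FF : Filter F}.
Implicit Types (f g : T -> C) (a b c : C).

Lemma tends_cst c : tends F (fun=> c) c.
Proof. by move=> e e0; near=> x; rewrite subrr sqn0. Unshelve. all: by end_near. Qed.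

Lemma tends_eq f g a : (\forall x \near F, f x = g x) -> tends F f a -> tends F g a.
Proof. by move=> fg fa e e0; near=> x; rewrite -(near fg x) //; near: x; exact: fa.
Unshelve. all: by end_near. Qed.

Lemma tendsD f g a b : tends F f a -> tends F g b ->
  tends F (fun x => f x + g x) (a + b).
Proof.
move=> fa gb e e0; have e4 : 0 < e / 4 by rewrite divr_gt0.
near=> x.
have -> : f x + g x - (a + b) = (f x - a) + (g x - b) by ring.
apply: le_lt_trans (sqnD_le _ _) _.
have : sqn (f x - a) < e / 4 by near: x; exact: fa.
have : sqn (g x - b) < e / 4 by near: x; exact: gb.
by lra.
Unshelve. all: by end_near. Qed.

Lemma tendsM f g a b : tends F f a -> tends F g b ->
  tends F (fun x => f x * g x) (a * b).
Proof.
move=> fa gb e e0; pose D := 1 + sqn a + sqn b.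
have [sa sb] := (sqn_ge0 a, sqn_ge0 b).
have D0 : 0 < D by rewrite /D; lra.
pose d := Num.min 1 (e / (9 * D)).
have d0 : 0 < d by rewrite lt_min ltr01 divr_gt0 // mulr_gt0.
have d1 : d <= 1 by rewrite ge_min lexx.
have dD : d * (9 * D) <= e by rewrite -ler_pdivlMr ?mulr_gt0 // ge_min lexx orbT.
clearbody d; near=> x.
have -> : f x * g x - a * b = (f x - a) * (g x - b) + a * (g x - b) + b * (f x - a).
  by ring.
apply: le_lt_trans (sqnD3_le _ _ _) _; rewrite !sqnM.
have : sqn (f x - a) < d by near: x; exact: fa.
have : sqn (g x - b) < d by near: x; exact: gb.
have := sqn_ge0 (f x - a); have := sqn_ge0 (g x - b).
move: (sqn (f x - a)) (sqn (g x - b)) => p q q0 p0 qd pd.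
have h1 : p * q <= d by rewrite -[d]mulr1; apply: ler_pM => //; lra.
have h2 : sqn a * q <= sqn a * d by rewrite ler_wpM2l // ltW.
have h3 : sqn b * p <= sqn b * d by rewrite ler_wpM2l // ltW.
have : 0 < d * D by rewrite mulr_gt0.
by move: dD; rewrite /D; lra.
Unshelve. all: by end_near. Qed.

Lemma tends_neq0 f a : tends F f a -> a != 0 ->
  \forall x \near F, sqn a / 4 < sqn (f x) /\ f x != 0.
Proof.
move=> fa a0; have sa : 0 < sqn a by rewrite sqn_gt0.
near=> x.
have h : sqn (f x - a) < sqn a / 4 by near: x; apply: fa; rewrite divr_gt0.
have : sqn a / 4 < sqn (f x).
  have := sqnD_le (f x) (- (f x - a)); rewrite sqnN opprB addrC subrK.
  by lra.
move=> h1; split=> //; rewrite -sqn_gt0; apply: lt_trans h1; by rewrite divr_gt0.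
Unshelve. all: by end_near. Qed.

Lemma tendsV f a : tends F f a -> a != 0 -> tends F (fun x => (f x)^-1) a^-1.
Proof.
move=> fa a0 e e0; have sa : 0 < sqn a by rewrite sqn_gt0.
have fn := tends_neq0 fa a0.
pose d := e * (sqn a * (sqn a / 4)).
have d0 : 0 < d by rewrite !mulr_gt0 // invr_gt0.
near=> x.
have [h1 h2] : sqn a / 4 < sqn (f x) /\ f x != 0 by near: x.
have -> : (f x)^-1 - a^-1 = - (f x - a) / (f x * a) by field; rewrite h2 a0.
rewrite sqnM sqnV sqnM sqnN ltr_pdivrMr ?mulr_gt0 ?sqn_gt0 //.
apply: lt_trans (_ : d < _); first by near: x; exact: fa.
by rewrite /d ltr_pM2l // mulrC ltr_pM2r.
Unshelve. all: by end_near. Qed.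

Lemma tends_inv_infty f g a (M : R) : tends F f a -> tends F g 0 -> a != 0 ->
  (\forall x \near F, g x != 0) -> \forall x \near F, M < sqn (f x / g x).
Proof.
move=> fa g0 a0 gn; have sa : 0 < sqn a by rewrite sqn_gt0.
have fn := tends_neq0 fa a0.
pose M' := `|M| + 1; have M0 : 0 < M' by rewrite ltr_wpDl.
near=> x.
have [h1 h2] : sqn a / 4 < sqn (f x) /\ f x != 0 by near: x.
have gx : g x != 0 by near: x.
rewrite sqnM sqnV ltr_pdivlMr ?sqn_gt0 //.
have h3 : sqn (g x - 0) < sqn a / 4 / M'.
  by near: x; apply: g0; rewrite !divr_gt0.
rewrite subr0 ltr_pdivlMr // in h3.
apply: le_lt_trans (lt_trans h3 h1); rewrite mulrC ler_wpM2l ?sqn_ge0 //.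
by rewrite /M'; apply: le_trans (ler_norm _) _; rewrite lerDl.
Unshelve. all: by end_near. Qed.

End Tends.

Lemma tends_id (z : C) : tends (nbhs z) id z.
Proof. by move=> e e0; exact: near_sqn. Qed.

Lemma tends_horner (T : Type) (F : set_system T) {FF : Filter F} (p : {poly C})
  (f : T -> C) a : tends F f a -> tends F (fun x => p.[f x]) p.[a].
Proof.
move=> fa; elim/poly_ind: p => [|p c IH].
  rewrite horner0; apply: tends_eq (tends_cst (0 : C)).
  by near=> x; rewrite horner0.
rewrite hornerMXaddC; apply: tends_eq (tendsD (tendsM IH fa) (tends_cst c)).
by near=> x; rewrite hornerMXaddC.
Unshelve. all: by end_near. Qed.

End ComplexTopology.

(** * Punctured neighbourhoods *)

Section Punctured.
Variable R : realType.
Local Notation C := R[i].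

Lemma mero_val_tends (g : C -> C) (z l : C) :
  tends (dnbhs z) g l -> mero_val g z = l.
Proof.
move=> gl; apply: cvg_lim; first exact: norm_hausdorff.
exact: cvg_sqn.
Qed.

Lemma dnbhs_near (z : C) (Q : C -> Prop) :
  (\forall x \near z, Q x) -> \forall x \near dnbhs z, Q x.
Proof. by apply: filterS. Qed.

Lemma tends_dnbhs (z l : C) (g : C -> C) : tends (nbhs z) g l -> tends (dnbhs z) g l.
Proof. by move=> gl e e0; apply: dnbhs_near; exact: gl. Qed.

Lemma near_dnbhs_root (p : {poly C}) (z : C) : p != 0 ->
  \forall x \near dnbhs z, p.[x] != 0.
Proof.
move=> p0; have [m [q qz pq]] := multiplicity_XsubC p z; rewrite p0 /= in qz.
have h := dnbhs_near (tends_neq0 (tends_horner q (@tends_id R z)) qz).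
near=> x.
have xz : x != z by near: x; exact: nbhs_dnbhs_neq.
have [_ qx] : sqn q.[z] / 4 < sqn q.[x] /\ q.[x] != 0 by near: x; exact: h.
by rewrite pq hornerM mulf_neq0 // horner_exp hornerXsubC expf_neq0 // subr_eq0.
Unshelve. all: by end_near. Qed.

Lemma poly_eventually_neq0 (p : {poly R}) : p != 0 ->
  exists2 X : R, 1 <= X & forall x, X <= x -> p.[x] != 0.
Proof.
wlog lp : p / 0 < lead_coef p => [wl p0|_].
  have [lp|lp|lp] := ltgtP (lead_coef p) 0.
  - have [||X X1 hX] := wl (- p); rewrite ?lead_coefN ?oppr_gt0 ?oppr_eq0 //.
    by exists X => // x /hX; rewrite hornerN oppr_eq0.
  - exact: wl.
  - by move/eqP: lp; rewrite lead_coef_eq0 (negbTE p0).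
have [X hX] := polyrcf.poly_pinfty_gt_lc lp.
exists (Num.max X 1); first by rewrite le_max lexx orbT.
move=> x; rewrite ge_max => /andP[Xx _].
by rewrite gt_eqF // (lt_le_trans lp) // hX.
Qed.
End Punctured.

(** * Continuity of the Cauchy transform *)

Section Transform.
Variable R : realType.
Local Notation C := R[i].
Variable sigma : {finite_measure set (measurableTypeR R) -> \bar R}.
Local Notation D := (`[-1, 1]%classic : set R).

Lemma dist_off (z0 : C) : off z0 -> exists2 d : R, 0 < d &
  \forall z \near z0, forall t, D t -> d ^+ 2 <= sqn (t%:C - z).
Proof.
move=> oz.
have [e e0 he] : exists2 e : R, 0 < e & forall t, D t -> e ^+ 2 <= sqn (t%:C - z0).
  have [y0|y0] := eqVneq (complex.Im z0) 0; last first.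
    exists `|complex.Im z0|; first by rewrite normr_gt0.
    move=> t _; rewrite real_normK ?num_real // sqnE; case: (z0) => x y /=.
    by rewrite sub0r sqrrN lerDr sqr_ge0.
  move: oz y0; case: z0 => x y oz /= y0; rewrite y0 in oz *.
  have [x1|x1] := ltP 1 x.
    exists (x - 1); first by rewrite subr_gt0.
    move=> t /=; rewrite in_itv /= => /andP[t1 t2].
    rewrite sqnE /= subr0 expr0n addr0 -[(t - x) ^+ 2]sqrrN opprB.
    by rewrite ler_pXn2r ?nnegrE //; lra.
  have [x2|x2] := ltP x (-1).
    exists (- 1 - x); first by rewrite subr_gt0.
    move=> t /=; rewrite in_itv /= => /andP[t1 t2].
    rewrite sqnE /= subr0 expr0n addr0.
    by rewrite ler_pXn2r ?nnegrE //; lra.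
  by exfalso; apply: oz; exists x => //=; rewrite in_itv /= x1 x2.
exists (e / 2); first by rewrite divr_gt0.
have e4 : 0 < e ^+ 2 / 4 by rewrite divr_gt0 // exprn_gt0.
near=> z => t Dt.
have h : sqn (z - z0) < e ^+ 2 / 4 by near: z; exact: near_sqn.
have := sqnD_le (t%:C - z) (z - z0); rewrite addrA subrK => h1.
by have := he _ Dt; move: h h1; rewrite expr_div_n; lra.
Unshelve. all: by end_near. Qed.

Lemma off_near (z0 : C) : off z0 -> \forall z \near z0, off z.
Proof.
move=> /dist_off [d d0 h]; near=> z => -[t Dt tz].
have : d ^+ 2 <= sqn (t%:C - z) by move: t Dt {tz}; near: z.
by rewrite tz subrr sqn0 leNgt exprn_gt0.
Unshelve. all: by end_near. Qed.

Lemma ratint_dist (G N G' N' : {poly R}) c : pos_on N -> pos_on N' ->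
  (forall t, D t -> `|G.[t] / N.[t] - G'.[t] / N'.[t]| <= c) ->
  `|ratint sigma G N - ratint sigma G' N'| <= c * ratint sigma 1 1.
Proof.
move=> N0 N0' h.
have NN : pos_on (N * N') by move=> t Dt; rewrite hornerM mulr_gt0 ?N0 ?N0'.
have -> : ratint sigma G N - ratint sigma G' N' = ratint sigma (G * N' + (-1) *: (G' * N)) (N * N').
  rewrite ratintD // ratintZ // mulN1r; congr (_ - _); apply: ratint_ext => t Dt.
    by rewrite !hornerM; field; rewrite !gt_eqF ?N0 ?N0'.
  by rewrite !hornerM; field; rewrite !gt_eqF ?N0 ?N0'.
rewrite -ratintZ; last exact: pos_on1.
apply: ratint_norm_le => // [|t Dt]; first exact: pos_on1.
rewrite hornerZ hornerC divr1 mulr1; apply: le_trans (h _ Dt).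
rewrite le_eqVlt; apply/orP; left; apply/eqP; congr (`|_|).
by rewrite hornerD hornerZ !hornerM; field; rewrite !gt_eqF ?N0 ?N0'.
Qed.

Lemma Itr1_tends (z0 : C) : off z0 -> tends (nbhs z0) (Itr sigma 1) (Itr sigma 1 z0).
Proof.
move=> oz; have [d d0 hd] := dist_off oz.
have hd0 : forall t, D t -> d ^+ 2 <= sqn (t%:C - z0) by exact: nbhs_singleton hd.
have oz' := off_near oz.
set m := ratint sigma 1 1.
move=> e e0.
pose del := e * (d ^+ 2 * d ^+ 2) / (2 * (m ^+ 2 + 1)).
have del0 : 0 < del.
  by rewrite !(divr_gt0, mulr_gt0, exprn_gt0) // ltr_wpDl ?sqr_ge0.
near=> z.
have hz : sqn (z - z0) < del by near: z; exact: near_sqn.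
have dz : forall t, D t -> d ^+ 2 <= sqn (t%:C - z) by near: z.
have ozz : off z by near: z.
pose c := Num.sqrt (sqn (z - z0) / (d ^+ 2 * d ^+ 2)).
have dd : 0 < d ^+ 2 * d ^+ 2 by rewrite mulr_gt0 ?exprn_gt0.
have c2 : c ^+ 2 = sqn (z - z0) / (d ^+ 2 * d ^+ 2).
  by rewrite sqr_sqrtr // divr_ge0 ?sqn_ge0 ?ltW.
have bound t : D t -> sqn ((t%:C - z)^-1 - (t%:C - z0)^-1) <= c ^+ 2.
  move=> Dt; have p1 := dz _ Dt; have p2 := hd0 _ Dt.
  have dp : 0 < d ^+ 2 by rewrite exprn_gt0.
  have q1 : t%:C - z != 0 by rewrite -sqn_gt0 (lt_le_trans dp).
  have q2 : t%:C - z0 != 0 by rewrite -sqn_gt0 (lt_le_trans dp).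
  have -> : (t%:C - z)^-1 - (t%:C - z0)^-1 = (z - z0) / ((t%:C - z) * (t%:C - z0)).
    by field; rewrite q1 q2.
  rewrite sqnM sqnV sqnM c2 ler_wpM2l ?sqn_ge0 // lef_pV2 ?posrE ?mulr_gt0 ?sqn_gt0 //.
  by apply: ler_pM => //; rewrite ltW.
have norm_le (x : R) : x ^+ 2 <= c ^+ 2 -> `|x| <= c.
  by move=> xc; rewrite -(@ler_pXn2r _ 2) ?nnegrE ?sqrtr_ge0 // real_normK ?num_real.
have reE (u v : C) : complex.Re (u - v) = complex.Re u - complex.Re v.
  by case: u => ? ?; case: v.
have imE (u v : C) : complex.Im (u - v) = complex.Im u - complex.Im v.
  by case: u => ? ?; case: v.
have invRe (u : C) t : complex.Re (t%:C - u)^-1 =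
    ((1 : {poly R}) * ('X - (complex.Re u)%:P)).[t] / (den u).[t].
  by rewrite mul1r denE sqnE; case: u => x y /=; rewrite !hornerE.
have invIm (u : C) t : complex.Im (t%:C - u)^-1 =
    (complex.Im u *: (1 : {poly R})).[t] / (den u).[t].
  by rewrite hornerZ hornerC mulr1 denE sqnE; case: u => x y /=; rewrite sub0r -mulNr opprK.
have m0 : 0 <= m by apply: Rintegral_ge0 => t _; rewrite !hornerC divr1.
have c0 : 0 <= c by rewrite sqrtr_ge0.
have Re_le : (complex.Re (Itr sigma 1 z - Itr sigma 1 z0)) ^+ 2 <= (c * m) ^+ 2.
  rewrite -[leLHS]real_normK ?num_real // ler_pXn2r ?nnegrE ?mulr_ge0 // reE.
  apply: ratint_dist; [exact: den_pos | exact: den_pos |] => t Dt.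
  rewrite -!invRe -reE; apply: norm_le; apply: le_trans (bound _ Dt).
  by rewrite sqnE lerDl sqr_ge0.
have Im_le : (complex.Im (Itr sigma 1 z - Itr sigma 1 z0)) ^+ 2 <= (c * m) ^+ 2.
  rewrite -[leLHS]real_normK ?num_real // ler_pXn2r ?nnegrE ?mulr_ge0 // imE.
  apply: ratint_dist; [exact: den_pos | exact: den_pos |] => t Dt.
  rewrite -!invIm -imE; apply: norm_le; apply: le_trans (bound _ Dt).
  by rewrite sqnE lerDr sqr_ge0.
have m1 : 0 < m ^+ 2 + 1 by rewrite ltr_wpDl ?sqr_ge0.
rewrite sqnE; apply: le_lt_trans (lerD Re_le Im_le) _.
rewrite exprMn c2.
have h1 : sqn (z - z0) / (d ^+ 2 * d ^+ 2) * (2 * (m ^+ 2 + 1)) < e.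
  by rewrite mulrAC ltr_pdivrMr // -ltr_pdivlMr ?mulr_gt0.
have : 0 <= sqn (z - z0) / (d ^+ 2 * d ^+ 2) by rewrite divr_ge0 ?sqn_ge0 ?ltW.
move: h1; move: (sqn (z - z0) / (d ^+ 2 * d ^+ 2)) (m ^+ 2) => u v h1 h2.
by lra.
Unshelve. all: by end_near. Qed.

End Transform.

(** * The function F near infinity *)

Section Setting.
Variable R : realType.
Local Notation C := R[i].
Variable sigma : {finite_measure set (measurableTypeR R) -> \bar R}.
Variables (q1 w1 q2 w2 : {poly R}) (s : nat -> R) (rho : R).
Local Notation D := (`[-1, 1]%classic : set R).

Definition mero_sum (z : C) : C :=
  rat_eval q1 w1 z * cauchy_transform sigma z + rat_eval q2 w2 z.
Local Notation phi := mero_sum.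
Local Notation F := (mero_val phi).

Hypothesis w10 : w1 != 0.
Hypothesis w20 : w2 != 0.
Hypothesis qpos : forall x : R, w1.[x] != 0 -> 0 <= q1.[x] / w1.[x].
Hypothesis hser : forall z : C, rho%:C < `|z| ->
  series (fun j => - (s j)%:C / z ^+ j.+1) @ \oo --> F z.

(** Multiplication by [weight_den] clears the denominators and turns the
    measure into [weight_num] dsigma.  The square makes the latter nonnegative. *)
Definition weight_den : {poly R} := (w1 * w2) ^+ 2.
Definition weight_num : {poly R} := q1 * w1 * w2 ^+ 2.
Local Notation W := weight_den.
Local Notation q := weight_num.

Lemma weight_den_neq0 : W != 0.
Proof. by rewrite expf_neq0 // mulf_neq0. Qed.

Lemma weight_num_ge0 t : 0 <= q.[t].
Proof.
rewrite /weight_num expr2 !hornerM -expr2 mulr_ge0 ?sqr_ge0 //.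
have [w0|w0] := eqVneq w1.[t] 0; first by rewrite w0 mulr0.
have -> : q1.[t] * w1.[t] = (q1.[t] / w1.[t]) * w1.[t] ^+ 2 by field.
by rewrite mulr_ge0 ?sqr_ge0 ?qpos.
Qed.

Lemma cpoly_real (p : {poly R}) (x : R) : (cpoly p).[x%:C] = (p.[x])%:C.
Proof. by rewrite /cpoly horner_map. Qed.

Lemma cpolyM (p r : {poly R}) (z : C) : (cpoly (p * r)).[z] = (cpoly p).[z] * (cpoly r).[z].
Proof. by rewrite /cpoly rmorphM hornerM. Qed.

Lemma cpolyD (p r : {poly R}) (z : C) : (cpoly (p + r)).[z] = (cpoly p).[z] + (cpoly r).[z].
Proof. by rewrite /cpoly rmorphD hornerD. Qed.

Lemma weight_phi : exists Pi : {poly R}, forall z, off z -> (cpoly W).[z] != 0 ->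
  (cpoly W).[z] * phi z = Itr sigma q z + (cpoly Pi).[z].
Proof.
have [pi hpi] := Itr_mul sigma q 1.
exists (pi + q2 * w2 * (w1 * w1)) => z oz.
have := hpi z oz; rewrite mulr1 /weight_den /weight_num !expr2 !cpolyM cpolyD !cpolyM.
move=> h; rewrite !mulf_eq0 !negb_or => /andP[/andP[h1 h2] _].
rewrite addrA -h /mero_sum cauchy_transformE /rat_eval -/(cpoly _) -/(cpoly _).
by rewrite -!/(cpoly _); field; rewrite h1 h2.
Qed.

Lemma phi_tends z : off z -> (cpoly W).[z] != 0 -> tends (nbhs z) phi (phi z).
Proof.
move=> oz; rewrite /weight_den expr2 !cpolyM !mulf_eq0 !negb_or.
move=> /andP[/andP[h1 h2] _].
have hr p w : (cpoly w).[z] != 0 -> tends (nbhs z) (rat_eval p w) (rat_eval p w z).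
  move=> hw; apply: tendsM; last apply: tendsV hw.
    exact: (tends_horner (cpoly p) (@tends_id R z)).
  exact: (tends_horner (cpoly w) (@tends_id R z)).
apply: tendsD; last exact: hr.
apply: tendsM; first exact: hr.
rewrite cauchy_transformE; apply: tends_eq (Itr1_tends sigma oz).
by near=> x; rewrite cauchy_transformE.
Unshelve. all: by end_near. Qed.

(** Near infinity there are no removable singularities to fill in. *)
Lemma F_real : exists2 X : R, 1 <= X & forall x, X <= x ->
  [/\ off x%:C, W.[x] != 0 & F x%:C = phi x%:C].
Proof.
have [X X1 hX] := poly_eventually_neq0 weight_den_neq0.
exists (X + 1); first by rewrite ler_wpDr.
move=> x Xx; have Xx' : X <= x by lra.
have oz : off x%:C.
  by move=> [t /=]; rewrite in_itv /= => /andP[_ t1] [tx]; lra.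
split=> //; first exact: hX.
apply: mero_val_tends; apply: tends_dnbhs; apply: phi_tends => //.
by rewrite cpoly_real fmorph_eq0 hX.
Qed.

Lemma tends_series z : rho%:C < `|z| ->
  tends \oo (series (fun j => - (s j)%:C / z ^+ j.+1)) (F z).
Proof. by move=> hz; apply: cvg_tends; exact: hser. Qed.

Let X0 : R := `|rho| + 1.
Let X0_gt0 : 0 < X0. Proof. by rewrite ltr_wpDl. Qed.
Let X0_rho x : X0 <= x -> rho%:C < `|x%:C|.
Proof.
move=> x0; have x1 : 0 < x by apply: lt_le_trans x0.
rewrite ger0_norm ?ler0c ?ltW // ltcR; apply: lt_le_trans x0.
by rewrite (le_lt_trans (ler_norm _)) // ltrDl.
Qed.

(** The terms of the series at one point of convergence are bounded. *)
Lemma geometric_s : geom_bounded s.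
Proof.
have [N _ hN] := tends_series (X0_rho (lexx _)) ltr01.
apply: (@geometric_geq _ N (fun j => 2 * X0 * X0 ^+ j)); last first.
  apply: geometric_scale; exists 1, X0; split=> // [|m]; first by rewrite lerDr.
  by rewrite mul1r ger0_norm // exprn_ge0 // ltW.
move=> j Nj; have h1 := hN _ Nj; have h2 := hN _ (leqW Nj).
set S := series _ in h1 h2.
have hS : S j.+1 - S j = - (s j)%:C / X0%:C ^+ j.+1.
  by rewrite /S /series /= big_nat_recr //= addrAC subrr add0r.
have := sqnD_le (S j.+1 - F X0%:C) (- (S j - F X0%:C)).
have -> : S j.+1 - F X0%:C - (S j - F X0%:C) = - (s j)%:C / X0%:C ^+ j.+1.
  by rewrite -hS; ring.
rewrite sqnM !sqnN sqnV sqnX !sqnR => h3.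
have : s j ^+ 2 / (X0 ^+ 2) ^+ j.+1 <= 4 by move: h1 h2 h3; rewrite /=; lra.
rewrite ler_pdivrMr ?exprn_gt0 // exprAC => h4.
have p0 : 0 <= 2 * X0 * X0 ^+ j by rewrite ltW // !mulr_gt0 ?exprn_gt0.
rewrite (ger0_norm p0) -(@ler_pXn2r _ 2) ?nnegrE // real_normK ?num_real //.
apply: le_trans h4 _; rewrite le_eqVlt; apply/orP; left; apply/eqP.
by rewrite [X0 ^+ j.+1]exprS; move: (X0 ^+ j) X0 => y x; ring.
Qed.

Definition Fr (x : R) : R := complex.Re (F x%:C).

(** The remainders are dominated by tails of one geometric series, so the
    constants do not depend on the order m of the expansion. *)
Lemma Fr_expansion : exists C X : R, [/\ 0 <= C, 1 <= X & forall m x, X <= x ->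
  `|Fr x + \sum_(j < m) s j / x ^+ j.+1| * x ^+ m.+1 <= C * X ^+ m].
Proof.
have [C [r [C1 r1 hs]]] := geometric_s.
have C0 : 0 <= C by apply: le_trans C1.
pose X := 2 * r + X0.
have X1 : 1 <= X by rewrite /X; have := X0_gt0; lra.
exists (2 * C), X; split=> //; first by rewrite mulr_ge0.
move=> m x Xx; have x0 : 0 < x by apply: lt_le_trans Xx; apply: lt_le_trans X1.
have rx : 2 * r <= x by move: Xx; rewrite /X; have := X0_gt0; lra.
have Xx0 : X0 <= x by move: Xx; rewrite /X; lra.
pose u j := s j / x ^+ j.+1; pose T j := C * r ^+ j / x ^+ j.+1.
have r0 : 0 <= r by apply: le_trans r1.
have T0 j : 0 <= T j by rewrite !mulr_ge0 ?exprn_ge0 ?invr_ge0 ?exprn_ge0 // ltW.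
have uT j : `|u j| <= T j.
  rewrite /u /T normrM normfV normrX (gtr0_norm x0) ler_wpM2r ?hs //.
  by rewrite invr_ge0 exprn_ge0 // ltW.
have TS j : T j.+1 * 2 <= T j.
  have -> : T j.+1 * 2 = T j * (2 * r / x).
    by rewrite /T !exprS; field; rewrite (gt_eqF x0) expf_neq0 ?gt_eqF.
  by rewrite ler_piMr // ler_pdivrMr // mul1r.
have tail n : `|\sum_(j < m + n) u j - \sum_(j < m) u j| <= 2 * T m - 2 * T (m + n)%N.
  elim: n => [|n IH]; first by rewrite addn0 !subrr normr0.
  rewrite addnS big_ord_recr /= addrAC; apply: le_trans (ler_normD _ _) _.
  by have := uT (m + n)%N; have := TS (m + n)%N; lra.
have Tm : T m * x ^+ m.+1 <= C * X ^+ m.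
  rewrite /T divfK ?expf_neq0 ?gt_eqF // ler_wpM2l // lerXn2r ?nnegrE //.
    by apply: le_trans X1.
  by rewrite /X; have := X0_gt0; lra.
have : `|Fr x + \sum_(j < m) u j| <= 2 * T m.
  apply/ler_addgt0Pr => e e0.
  have [N _ hN] := tends_series (X0_rho Xx0) (exprn_gt0 2 e0).
  have := hN (m + N)%N (leq_addl _ _); rewrite /series /=.
  have -> : \sum_(0 <= k < m + N) - (s k)%:C / x%:C ^+ k.+1 = (- \sum_(k < m + N) u k)%:C.
    rewrite big_mkord rmorphN rmorph_sum /= -sumrN; apply: eq_bigr => k _.
    by rewrite /u rmorphM fmorphV rmorphXn /= mulNr.
  move=> h; have h1 : (- (\sum_(k < m + N) u k) - Fr x) ^+ 2 < e ^+ 2.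
    apply: le_lt_trans h; rewrite sqnE /Fr; case: (F x%:C) => a b /=.
    by rewrite lerDl sqr_ge0.
  have h2 : `|\sum_(k < m + N) u k + Fr x| < e.
    rewrite -(@ltr_pXn2r _ 2) ?nnegrE ?(ltW e0) // real_normK ?num_real //.
    by rewrite -[ltLHS]sqrrN opprD.
  have -> : Fr x + \sum_(j < m) u j = (\sum_(k < m + N) u k + Fr x)
     - (\sum_(k < m + N) u k - \sum_(j < m) u j) by ring.
  apply: le_trans (ler_normB _ _) _.
  by have := tail N; have := T0 (m + N)%N; lra.
move=> h; apply: le_trans (ler_wpM2r (exprn_ge0 _ (ltW x0)) h) _.
by rewrite -[leLHS]mulrA -[leRHS]mulrA ler_wpM2l.
Qed.

End Setting.

(** * Moments and remainders *)

Section Moments.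
Variable R : realType.
Local Notation C := R[i].
Variable sigma : {finite_measure set (measurableTypeR R) -> \bar R}.
Variables (q1 w1 q2 w2 : {poly R}) (s : nat -> R) (rho : R).
Local Notation phi := (mero_sum sigma q1 w1 q2 w2).
Local Notation F := (mero_val phi).
Hypothesis w10 : w1 != 0.
Hypothesis w20 : w2 != 0.
Hypothesis hser : forall z : C, rho%:C < `|z| ->
  series (fun j => - (s j)%:C / z ^+ j.+1) @ \oo --> F z.
Local Notation W := (weight_den w1 w2).
Local Notation q := (weight_num q1 w1 w2).
Local Notation Fr := (Fr sigma q1 w1 q2 w2).

Lemma ReM_real (c : R) (x : C) : complex.Re (c%:C * x) = c * complex.Re x.
Proof. by case: x => u v /=; rewrite mul0r subr0. Qed.

Lemma ReD (x y : C) : complex.Re (x + y) = complex.Re x + complex.Re y.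
Proof. by case: x => u v; case: y. Qed.

(** The coefficient of 1/x in the expansion of V F at infinity is - mom s V, and
    V' is the polynomial part. *)
Lemma moment_asymp V : exists V' : {poly R}, exists B X : R, 1 <= X /\
  forall x, X <= x -> `|x * (V.[x] * Fr x - V'.[x]) + mom s V| * x <= B.
Proof.
have [C [X [C0 X1 hC]]] := Fr_expansion hser.
suff [V' [B hB]] : exists V' : {poly R}, exists B : R,
   forall x, X <= x -> `|x * (V.[x] * Fr x - V'.[x]) + mom s V| * x <= B.
  by exists V', B, X.
have x_gt0 x : X <= x -> 0 < x by move=> Xx; apply: lt_le_trans Xx; apply: lt_le_trans X1.
rewrite (poly_sumX (leqnn (size V))).
apply: (big_ind (fun V : {poly R} => exists V' : {poly R}, exists B : R,
   forall x, X <= x -> `|x * (V.[x] * Fr x - V'.[x]) + mom s V| * x <= B)).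
- exists 0, 0 => x _; rewrite linear0 horner0 mul0r subrr mulr0 addr0 normr0.
  by rewrite mul0r.
- move=> V1 V2 [V1' [B1 h1]] [V2' [B2 h2]]; exists (V1' + V2'), (B1 + B2) => x Xx.
  apply: le_trans (lerD (h1 _ Xx) (h2 _ Xx)).
  rewrite -mulrDl ler_wpM2r ?(ltW (x_gt0 _ Xx)) //.
  apply: le_trans (ler_normD _ _); rewrite le_eqVlt; apply/orP; left; apply/eqP.
  by rewrite linearD /= !hornerD; congr (`|_|); ring.
move=> i _; move: (nat_of_ord i) (V`_i) => {}i c {V}.
exists (- c *: (\sum_(j < i) s j *: 'X^(i.-1 - j))), (`|c| * (C * X ^+ i.+1)) => x Xx.
have x0 := x_gt0 _ Xx.
have -> : x * ((c *: 'X^i).[x] * Fr x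
      - (- c *: (\sum_(j < i) s j *: 'X^(i.-1 - j))).[x]) + mom s (c *: 'X^i)
   = c * ((Fr x + \sum_(j < i.+1) s j / x ^+ j.+1) * x ^+ i.+1).
  have hsum : \sum_(j < i) s j / x ^+ j.+1 * x ^+ i.+1 =
      x * \sum_(j < i) (s j *: 'X^(i.-1 - j)).[x].
    rewrite mulr_sumr; apply: eq_bigr => j _; rewrite hornerZ hornerXn.
    have -> : x ^+ i.+1 = x ^+ (i.-1 - j) * x * x ^+ j.+1.
      by rewrite -exprSr -exprD; congr (_ ^+ _); have := ltn_ord j; lia.
    by field; rewrite expf_neq0 // gt_eqF.
  rewrite linearZ /= momXn !hornerZ hornerXn horner_sum big_ord_recr /= !mulrDl.
  rewrite divfK ?expf_neq0 ?gt_eqF // mulr_suml hsum exprS; ring.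
rewrite normrM -mulrA ler_wpM2l // normrM -mulrA.
have -> : `|x ^+ i.+1| * x = x ^+ i.+2.
  by rewrite ger0_norm ?exprn_ge0 ?ltW // -exprSr.
exact: hC.
Qed.

Lemma weight_real : exists Pi : {poly R}, 
  (forall z, off z -> (cpoly W).[z] != 0 ->
     (cpoly W).[z] * phi z = Itr sigma q z + (cpoly Pi).[z]) /\
  exists2 X : R, 1 <= X & forall x, X <= x ->
   off x%:C /\ W.[x] * Fr x = complex.Re (Itr sigma q x%:C) + Pi.[x].
Proof.
have [Pi hPi] := weight_phi sigma q1 w1 q2 w2.
have [X X1 hX] := F_real sigma q1 q2 w10 w20.
exists Pi; split=> //; exists X => // x /hX [ox Wx Fx]; split=> //.
rewrite -ReM_real /Fr Fx -cpoly_real hPi ?cpoly_real ?fmorph_eq0 //.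
Qed.

Lemma real_Itr_bound g : exists2 M : R, 0 <= M & forall x, 2 <= x ->
  `|complex.Re (Itr sigma g x%:C)| * x <= M.
Proof.
have [M M0 hM] := Itr_real sigma g; exists (2 * M); first by rewrite mulr_ge0.
move=> x x2; have x1 : 1 < x by lra.
have h := hM _ x1; have x1' : 0 < x - 1 by lra.
rewrite ler_pdivlMr // in h.
by have := normr_ge0 (complex.Re (Itr sigma g x%:C)); nra.
Qed.

(** Both sides are minus the coefficient of 1/x at infinity of g W F, computed
    from the series on the left and from the Cauchy transform of q dsigma on the
    right; a polynomial that decays at infinity is zero. *)
Lemma moment_identity g : mom s (W * g) = ratint sigma (g * q) 1.
Proof.
have [V' [B [X [X1 hV]]]] := moment_asymp (W * g).
have [Pi [_ [Y Y1 hY]]] := weight_real.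
have [pi hpi] := Itr_mul sigma g q.
have [M M0 hM] := real_Itr_bound ('X * (g * q)).
pose T := pi + g * Pi - V'.
pose Z := Num.max (Num.max X Y) 2.
pose A x := x * ((W * g).[x] * Fr x - V'.[x]) + mom s (W * g).
have key x : Z <= x -> [/\ 2 <= x, `|A x| * x <= B,
   `|complex.Re (Itr sigma ('X * (g * q)) x%:C)| * x <= M &
   x * T.[x] = A x - mom s (W * g) - complex.Re (Itr sigma ('X * (g * q)) x%:C)
      + ratint sigma (g * q) 1].
  rewrite !ge_max => /andP[/andP[Xx Yx] x2]; split=> //; first exact: hV.
    exact: hM.
  have [ox hx] := hY _ Yx.
  have -> : complex.Re (Itr sigma ('X * (g * q)) x%:C) =
     x * complex.Re (Itr sigma (g * q) x%:C) + ratint sigma (g * q) 1.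
    by rewrite ItrX // ReD ReM_real.
  have : g.[x] * complex.Re (Itr sigma q x%:C) =
      complex.Re (Itr sigma (g * q) x%:C) + pi.[x].
    by rewrite -ReM_real -cpoly_real hpi // ReD cpoly_real.
  have -> : complex.Re (Itr sigma q x%:C) = W.[x] * Fr x - Pi.[x] by rewrite hx; ring.
  move=> e1; have -> : complex.Re (Itr sigma (g * q) x%:C) =
     g.[x] * (W.[x] * Fr x - Pi.[x]) - pi.[x] by rewrite e1; ring.
  by rewrite /A /T hornerD hornerN hornerD !hornerM; ring.
have T0 : T = 0.
  apply: (@poly_decay0 _ _ (B + M + `|mom s (W * g)| + `|ratint sigma (g * q) 1|) Z).
  move=> x /key [x2 h1 h2 ->].
  apply: le_trans (ler_normD _ _) _; rewrite lerD2r.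
  apply: le_trans (ler_normB _ _) _.
  apply: le_trans (lerD (ler_normB _ _) (lexx _)) _.
  by move: h1 h2; have := normr_ge0 (A x);
     have := normr_ge0 (complex.Re (Itr sigma ('X * (g * q)) x%:C)); nra.
apply/eqP; rewrite -subr_eq0; apply/eqP; apply: (@const_decay0 _ _ (B + M) Z) => x.
move=> /key [x2 h1 h2]; rewrite T0 horner0 mulr0 => h3.
have -> : mom s (W * g) - ratint sigma (g * q) 1 =
   A x - complex.Re (Itr sigma ('X * (g * q)) x%:C) by move: h3; lra.
apply: le_trans (lerD h1 h2); rewrite -mulrDl ler_wpM2r //; first by lra.
exact: ler_normB.
Qed.

Section Remainder.
Variables (k : nat -> nat) (eps b : nat -> R) (p : nat -> {poly R})
  (f : nat -> nat -> R) (sg : R).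
Hypothesis H : fraction_data k eps b p f.
Hypothesis sg0 : 0 < sg.
Hypothesis hf : forall m, f 0%N m.+1 = - s m / sg.
Local Notation P := (P_poly eps b p).
Local Notation Q := (Q_poly eps b p).

Lemma mom_momf g : mom s g = sg * mom (momf f) g.
Proof.
rewrite /mom mulr_sumr; apply: eq_bigr => i _; rewrite /momf hf.
by field; rewrite gt_eqF.
Qed.

(** The formal order of the remainder, from [rev_remainder], is an order of
    decay because the expansion of F converges. *)
Lemma remainder_decay i : exists B X : R, 1 <= X /\ forall x, X <= x ->
  `|(P i).[x] * Fr x + sg * (Q i).[x]| * x ^+ deg k i.+1 <= B.
Proof.
have [C [X [C0 X1 hC]]] := Fr_expansion hser.
pose d := deg k i; pose d' := deg k i.+1; pose M := (d + d').+1.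
have [e he _] := @rev_remainder _ _ _ _ _ _ H i M (ltnSn _).
pose p1 := \sum_(l < size (P i)) `|(P i)`_l|.
pose e1 := \sum_(l < size e) `|e`_l|.
have p10 : 0 <= p1 by apply: sumr_ge0.
have e10 : 0 <= e1 by apply: sumr_ge0.
exists (p1 * (C * X ^+ (d + d')) + sg * e1), X; split=> // x Xx.
have x1 : 1 <= x by apply: le_trans Xx.
have x0 : 0 < x by apply: lt_le_trans x1.
have y0 : x^-1 != 0 by rewrite invr_eq0 gt_eqF.
have xd n : x^-1 ^+ n * x ^+ n = 1 by rewrite -exprMn mulVf ?expr1n ?gt_eqF.
pose a0 : R := (\poly_(l < M) f 0%N l).[x^-1].
have a0E : sg * a0 = - \sum_(j < d + d') s j / x ^+ j.+1.
  rewrite /a0 horner_poly big_ord_recl /= (_ : f 0%N 0%N = 0) ?mul0r ?add0r; last by case: H.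
  rewrite mulr_sumr -sumrN; apply: eq_bigr => j _.
  by rewrite /bump /= add1n hf exprVn; field; rewrite ?expf_neq0 ?gt_eqF.
have main : (P i).[x] * a0 + (Q i).[x] = x^-1 ^+ d' * e.[x^-1].
  move/(congr1 (horner^~ x^-1)): he.
  rewrite hornerD hornerM !horner_rev ?(size_P H) ?(size_Q H) // invrK.
  rewrite hornerM hornerXn exprD -/a0 => h.
  have xn0 : x^-1 ^+ deg k i != 0 by rewrite expf_neq0.
  by apply: (mulfI xn0); rewrite mulrDr mulrA h; ring.
have -> : (P i).[x] * Fr x + sg * (Q i).[x] =
   (P i).[x] * (Fr x + \sum_(j < d + d') s j / x ^+ j.+1) + sg * (x^-1 ^+ d' * e.[x^-1]).
  by rewrite -main -[X in Fr x + X]opprK -a0E; ring.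
rewrite -/d'; have xd'0 : 0 <= x ^+ d' by rewrite exprn_ge0 // ltW.
apply: le_trans (ler_wpM2r xd'0 (ler_normD _ _)) _; rewrite mulrDl; apply: lerD.
  rewrite normrM.
  have hP : `|(P i).[x]| <= p1 * x ^+ d.
    apply: le_trans (poly_growth _ x1) _; rewrite ler_wpM2l //.
    apply: ler_weXn2l => //; rewrite -subn1 leq_subLR add1n; exact: (size_P H i).
  have h0 := hC (d + d')%N x Xx.
  set u := `|Fr x + _| in h0 *; have u0 : 0 <= u by apply: normr_ge0.
  apply: le_trans (_ : p1 * x ^+ d * u * x ^+ d' <= _).
    by rewrite ler_wpM2r // ler_wpM2r.
  have -> : p1 * x ^+ d * u * x ^+ d' = p1 * (u * x ^+ (d + d')) by rewrite exprD; ring.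
  rewrite ler_wpM2l //; apply: le_trans h0; rewrite ler_wpM2l //.
  by apply: ler_weXn2l.
rewrite normrM (gtr0_norm sg0) -mulrA ler_wpM2l ?(ltW sg0) //.
rewrite normrM normrX (ger0_norm (_ : 0 <= x^-1)); last by rewrite invr_ge0 ltW.
rewrite mulrAC xd mul1r horner_coef; apply: le_trans (ler_norm_sum _ _ _) _.
apply: ler_sum => l _; rewrite normrM ler_piMr // normrX.
rewrite exprn_ile1 // ger0_norm ?invr_ge0 ?(ltW x0) //.
by rewrite invf_le1.
Qed.

(** The two sides differ by a polynomial.  The left side decays at infinity
    because the order of the remainder exceeds the degree of W, and so does the
    Cauchy transform. *)
Lemma remainder_transform i : (size W <= deg k i.+1)%N ->
  forall z, off z -> (cpoly W).[z] != 0 ->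
  (cpoly W).[z] * ((cpoly (P i)).[z] * phi z + sg%:C * (cpoly (Q i)).[z]) =
  Itr sigma (P i * q) z.
Proof.
move=> sW.
have [Pi [hPi [Y Y1 hY]]] := weight_real.
have [pi hpi] := Itr_mul sigma (P i) q.
have [M M0 hM] := real_Itr_bound (P i * q).
have [B [X [X1 hB]]] := remainder_decay i.
pose L := pi + P i * Pi + sg *: (W * Q i).
pose w := \sum_(l < size W) `|W`_l|.
have w0 : 0 <= w by apply: sumr_ge0.
have L0 : L = 0.
  apply: (@poly_decay0 _ _ (w * B + M) (Num.max (Num.max X Y) 2)) => x.
  rewrite !ge_max => /andP[/andP[Xx Yx] x2].
  have [ox hx] := hY _ Yx; have x1 : 1 <= x by lra.
  have x0 : 0 < x by lra.
  have : (P i).[x] * complex.Re (Itr sigma q x%:C) =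
      complex.Re (Itr sigma (P i * q) x%:C) + pi.[x].
    by rewrite -ReM_real -cpoly_real hpi // ReD cpoly_real.
  have -> : complex.Re (Itr sigma q x%:C) = W.[x] * Fr x - Pi.[x] by rewrite hx; ring.
  set I := complex.Re _ => e1.
  have -> : x * L.[x] = x * W.[x] * ((P i).[x] * Fr x + sg * (Q i).[x]) - I * x.
    rewrite /L !hornerD hornerZ (hornerM (P i)) (hornerM W).
    have -> : pi.[x] = (P i).[x] * (W.[x] * Fr x - Pi.[x]) - I by rewrite e1; ring.
    ring.
  apply: le_trans (ler_normB _ _) _; apply: lerD; last first.
    by rewrite normrM (gtr0_norm x0); apply: hM.
  have := hB _ Xx; set v := _ + _ => hv.
  rewrite !normrM (gtr0_norm x0).
  have hW : x * `|W.[x]| <= w * x ^+ deg k i.+1.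
    apply: le_trans (ler_wpM2l (ltW x0) (poly_growth _ x1)) _.
    rewrite mulrCA -exprS ler_wpM2l //; apply: ler_weXn2l => //.
    rewrite prednK // lt0n size_poly_eq0; exact: weight_den_neq0.
  apply: le_trans (ler_wpM2r (normr_ge0 _) hW) _.
  by rewrite -mulrA ler_wpM2l // mulrC.
move=> z oz Wz; have := hpi z oz.
have -> : Itr sigma q z = (cpoly W).[z] * phi z - (cpoly Pi).[z].
  by rewrite hPi //; ring.
move=> h; have -> : Itr sigma (P i * q) z =
  (cpoly (P i)).[z] * ((cpoly W).[z] * phi z - (cpoly Pi).[z]) - (cpoly pi).[z].
  by rewrite h; ring.
have : (cpoly L).[z] = 0 by rewrite L0 /cpoly map_poly0 horner0.
rewrite /L !cpolyD cpolyM -mul_polyC !cpolyM.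
have -> : (cpoly sg%:P).[z] = sg%:C by rewrite /cpoly map_polyC hornerC.
move=> h0; apply/eqP; rewrite -subr_eq0 -h0; apply/eqP; ring.
Qed.

End Remainder.
End Moments.

(** * Eventual positivity of the signs *)

Section EventualSign.
Variable R : realType.
Variables (k : nat -> nat) (eps b : nat -> R) (p : nat -> {poly R})
  (f : nat -> nat -> R).
Hypothesis H : fraction_data k eps b p f.
Local Notation P := (P_poly eps b p).
Local Notation S := (mom (momf f)).
Variable (N0 : nat).
Hypothesis k1 : forall j, (N0 <= j)%N -> k j = 1%N.

Lemma mom_PP_eq i j : (N0 <= j)%N -> (i <= j)%N -> S (P j * P i) = (i == j)%:R * eps j.
Proof.
move=> Nj; rewrite leq_eqVlt => /orP[/eqP ->|ij].
  by rewrite eqxx mul1r (mom_PP H) // k1.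
by rewrite (mom_PP_lt H) // ltn_eqF // mul0r.
Qed.

(** Otherwise the form S(g^2) would be negative definite on a space of dimension
    larger than the codimension of the ideal generated by W, hence negative at
    some nonzero multiple of W. *)
Lemma eventually_eps1 (W : {poly R}) : W != 0 ->
  (forall h, 0 <= S ((W * h) * (W * h))) ->
  exists2 N, (N0 <= N)%N & forall j, (N <= j)%N -> eps j = 1.
Proof.
move=> W0 Hpos; apply: contrapT => hN.
have next n : {j | (maxn N0 n <= j)%N /\ eps j = -1}.
  apply: cid; apply: contrapT => hj; apply: hN; exists (maxn N0 n); first exact: leq_maxl.
  move=> j nj; have [//|e] : eps j = 1 \/ eps j = -1 by case: H => _ /(_ j) [].
  by exfalso; apply: hj; exists j.
pose e := fix e i := if i is i'.+1 then sval (next (e i').+1) else sval (next 0%N).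
have eP i : (N0 <= e i)%N /\ eps (e i) = -1.
  by case: i => [|i] /=; case: (next _) => j [/= h1 h2]; split=> //;
    rewrite (leq_trans _ h1) // leq_maxl.
have eS i : (e i < e i.+1)%N.
  by rewrite /=; case: (next _) => j [/= h1 h2]; rewrite (leq_trans _ h1) // leq_maxr.
have e_mono : {homo e : i j / (i < j)%N}.
  move=> i j; elim: j => // j IH; rewrite ltnS leq_eqVlt => /orP[/eqP -> //|/IH h].
  exact: ltn_trans h (eS j).
(* One more polynomial than the remainders modulo W have coefficients. *)
pose d := size W.
pose A : 'M[R]_(d.+1, d) := \matrix_(i, l) (P (e i) %% W)`_l.
have : kermx A != 0.
  rewrite -mxrank_eq0 mxrank_ker subn_eq0 -ltnNge ltnS; exact: rank_leq_col.
case/rowV0Pn => v /sub_kermxP vA v0.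
pose G := \sum_(i < d.+1) v 0 i *: P (e i).
have GW : G %% W = 0.
  apply/polyP => l; rewrite coef0.
  have [ld|dl] := ltnP l d; last first.
    by rewrite nth_default // (leq_trans _ dl) // ltnW // ltn_modp.
  have := congr1 (fun M : 'rV_d => M 0 (Ordinal ld)) vA; rewrite !mxE => h.
  rewrite -[RHS]h.
  rewrite /G (big_morph _ (modpD W) (mod0p W)) coef_sum; apply: eq_bigr => i _.
  by rewrite modpZl coefZ mxE.
have GE : G = W * (G %/ W) by rewrite {1}(divp_eq G W) GW addr0 mulrC.
have := Hpos (G %/ W); rewrite -GE; apply/negP; rewrite -ltNge.
have PP (i l : 'I_d.+1) : S (P (e i) * P (e l)) = - (i == l)%:R.
  have [il|li|il] := ltngtP i l.
  - rewrite mulrC mom_PP_eq ?(eP l).1 ?(ltnW (e_mono _ _ il)) //.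
    by rewrite (ltn_eqF (e_mono _ _ il)) mul0r -val_eqE (ltn_eqF il) oppr0.
  - rewrite mom_PP_eq ?(eP i).1 ?(ltnW (e_mono _ _ li)) //.
    by rewrite (ltn_eqF (e_mono _ _ li)) mul0r -val_eqE (gtn_eqF li) oppr0.
  have -> : i = l by apply: val_inj.
  by rewrite mom_PP_eq ?(eP l).1 // !eqxx mul1r (eP l).2.
have -> : S (G * G) = - \sum_i v 0 i ^+ 2.
  rewrite {1}/G mulr_suml linear_sum /= -sumrN; apply: eq_bigr => i _.
  have -> : v 0 i *: P (e i) * G = v 0 i *: \sum_l v 0 l *: (P (e i) * P (e l)).
    rewrite -scalerAl /G mulr_sumr; congr (_ *: _).
    by apply: eq_bigr => l _; rewrite scalerAr.
  rewrite linearZ /= linear_sum /= (bigD1 i) //= linearZ /= PP eqxx.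
  rewrite big1 => [|l li]; first by rewrite addr0 /=; ring.
  by rewrite linearZ /= PP eq_sym (negbTE li) oppr0 mulr0.
rewrite oppr_lt0 lt_def sumr_ge0 ?andbT => [|i _]; last exact: sqr_ge0.
apply: contra v0; rewrite psumr_eq0 => [|i _]; last exact: sqr_ge0.
move=> /allP hv; apply/eqP/rowP => i; rewrite mxE.
by have := hv i (mem_index_enum _); rewrite /= sqrf_eq0 => /eqP.
Qed.

End EventualSign.

(** * The tail of the P-fraction *)

Section StableTail.
Variable R : realType.
Variables (k : nat -> nat) (eps b : nat -> R) (p : nat -> {poly R})
  (f : nat -> nat -> R).
Hypothesis H : fraction_data k eps b p f.
Local Notation P := (P_poly eps b p).
Local Notation S := (mom (momf f)).
Variable (N : nat).
Hypothesis k1 : forall j, (N <= j)%N -> k j = 1%N.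
Hypothesis eps1 : forall j, (N <= j)%N -> eps j = 1.

Lemma tail_bounded : geom_bounded (f 0%N) -> exists2 K : R, 1 <= K &
  forall j, (N <= j)%N -> `|(p j)`_0| <= K /\ b j <= K.
Proof.
move=> gf; have gN := geometric_f N H gf.
rewrite -[N]addn0 in gN.
have [||K K1 hK] := jacobi_bounded (fraction_data_shift N H) _ _ gN.
- by move=> j; rewrite k1 // leq_addr.
- by move=> j; rewrite eps1 // leq_addr.
exists K => // j Nj; have := hK (j - N)%N; by rewrite subnKC.
Qed.

Lemma btilde_tail j : (N <= j)%N -> btilde_pred eps b j.+1 = b j.
Proof. by move=> Nj; rewrite /= !eps1 ?leqW // !mul1r. Qed.

Lemma p_tail j : (N <= j)%N -> p j = 'X + ((p j)`_0)%:P.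
Proof.
move=> Nj; have [hm hs] : p j \is monic /\ size (p j) = 2%N.
  by case: H => _ _ /(_ j); rewrite k1.
apply/polyP => -[|[|i]]; rewrite coefD coefX coefC /= ?add0r ?addr0 //.
- by move/monicP: hm; rewrite lead_coefE hs.
- by rewrite nth_default ?hs.
Qed.

Lemma P_tail_rec j : (N <= j)%N ->
  'X * P j.+1 = b j *: P j + (- (p j.+1)`_0) *: P j.+1 + b j.+1 *: P j.+2.
Proof.
move=> Nj; rewrite (P_recS H) btilde_tail // {2}p_tail ?leqW //.
by rewrite -!mul_polyC polyCN; ring.
Qed.

Lemma Q_tail_rec j : (N <= j)%N ->
  'X * Q_poly eps b p j.+1 = b j *: Q_poly eps b p j
    + (- (p j.+1)`_0) *: Q_poly eps b p j.+1 + b j.+1 *: Q_poly eps b p j.+2.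
Proof.
move=> Nj; rewrite (Q_recS H) btilde_tail // {2}p_tail ?leqW //.
by rewrite -!mul_polyC polyCN; ring.
Qed.

(** Multiplication by X in the basis (P_j) is a sum of three terms with
    coefficients bounded by K. *)
Lemma moment_tail_bounded (K : R) m j l : 1 <= K ->
  (forall j, (N <= j)%N -> `|(p j)`_0| <= K /\ b j <= K) ->
  (N + m <= j)%N -> (N <= l)%N -> `|S ('X^m * P j * P l)| <= (3 * K) ^+ m.
Proof.
move=> K1 hK; have K0 : 0 <= K by apply: le_trans K1.
elim: m j => [|m IH] j Nj Nl.
  rewrite addn0 in Nj; rewrite !expr0 mul1r.
  have one (i i' : nat) : `|(i == i')%:R * (1 : R)| <= 1.
    by rewrite mulr1; case: (i == i'); rewrite ?normr1 ?normr0.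
  case: (leqP j l) => jl.
    by rewrite mulrC (mom_PP_eq H k1) // eps1.
  by rewrite (mom_PP_eq H k1) // ?eps1 // ltnW.
case: j Nj => [|j] Nj; first by lia.
have Nj' : (N <= j)%N by lia.
have -> : 'X^(m.+1) * P j.+1 * P l = 'X^m * ('X * P j.+1) * P l by rewrite exprSr; ring.
set Bd := (X in _ <= X); rewrite P_tail_rec // !mulrDr !mulrDl !linearD /= -!scalerAr -!scalerAl !linearZ /=.
have [a1 b1] := hK _ (leqW Nj'); have [_ b0] := hK _ Nj'.
have bp i : 0 < b i by case: H => _ /(_ i) [].
have bnd (c x B : R) : `|c| <= K -> `|x| <= B -> `|c * x| <= K * B.
  by move=> cK xB; rewrite normrM ler_pM.
apply: le_trans (ler_normD _ _) _.
have h3 : `|b j.+1 * S ('X^m * P j.+2 * P l)| <= K * (3 * K) ^+ m.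
  by apply: bnd; [rewrite ger0_norm // ltW | apply: IH; lia].
apply: le_trans (lerD (ler_normD _ _) h3) _.
have h1 : `|b j * S ('X^m * P j * P l)| <= K * (3 * K) ^+ m.
  by apply: bnd; [rewrite ger0_norm // ltW | apply: IH; lia].
have h2 : `|- (p j.+1)`_0 * S ('X^m * P j.+1 * P l)| <= K * (3 * K) ^+ m.
  by apply: bnd; [rewrite normrN | apply: IH; lia].
apply: le_trans (lerD (lerD h1 h2) (lexx _)) _; rewrite /Bd exprS.
by move: ((3 * K) ^+ m) => y; lra.
Qed.

Lemma weighted_moment_bounded (K : R) (W : {poly R}) j : 1 <= K ->
  (forall j, (N <= j)%N -> `|(p j)`_0| <= K /\ b j <= K) ->
  (N + size W <= j)%N ->
  S (W * (P j * P j)) <= \sum_(i < size W) `|W`_i| * (3 * K) ^+ i.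
Proof.
move=> K1 hK Nj; apply: le_trans (ler_norm _) _.
rewrite {1}(poly_sumX (leqnn (size W))) mulr_suml linear_sum /=.
apply: le_trans (ler_norm_sum _ _ _) _; apply: ler_sum => i _.
rewrite -scalerAl linearZ /= normrM ler_wpM2l // mulrA.
apply: moment_tail_bounded => //; apply: leq_trans Nj; last exact: leq_addr.
by rewrite leq_add2l ltnW.
Qed.

End StableTail.

(** * Identification of the approximants *)

Section PadeIdentification.
Variable R : realType.
Local Notation C := R[i].

Lemma near_sqn_ex (z0 : C) (Q : C -> Prop) : (\forall z \near z0, Q z) ->
  exists2 d : R, 0 < d & forall z, sqn (z - z0) < d -> Q z.
Proof.
move=> /nbhs_normP [e /= e0 he].
have [r r0 er] : exists2 r : R, 0 < r & e = r%:C.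
  move: e0; case: e {he} => a b; rewrite ltcE /= => /andP[/eqP -> a0].
  by exists a.
exists (r ^+ 2); first by rewrite exprn_gt0.
by move=> z hz; apply: he; rewrite /= distrC er norm_lt_sqn.
Qed.

Lemma poly_quotient_bounded (g h : {poly C}) : h.[0] != 0 ->
  exists d B : R, [/\ 0 < d, 0 <= B & forall y, sqn y < d ->
    h.[y] != 0 /\ sqn (g.[y] / h.[y]) <= B].
Proof.
move=> h0; pose F0 := nbhs (0 : C).
have FF0 : Filter F0 by exact: nbhs_filter.
have th : tends F0 (horner h) h.[0] by exact: tends_horner (@tends_id R 0).
have tg : tends F0 (horner g) g.[0] by exact: tends_horner (@tends_id R 0).
have tq := tendsM (FF := FF0) tg (tendsV (FF := FF0) th h0).
have n1 := tends_neq0 (FF := FF0) th h0.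
have n2 := tq _ ltr01.
have [d d0 hd] := near_sqn_ex (filterI n1 n2).
exists d, (2 + 2 * sqn (g.[0] / h.[0])); split=> //.
  by have := sqn_ge0 (g.[0] / h.[0]); lra.
move=> y yd; have [|[_ hy] hq] := hd y; first by rewrite subr0.
split=> //; have := sqnD_le (g.[y] / h.[y] - g.[0] / h.[0]) (g.[0] / h.[0]).
by rewrite subrK; move: hq => /=; lra.
Qed.

Lemma sqn_norm_le (z : C) (B : R) : 0 <= B -> (`|z| <= B%:C) = (sqn z <= B ^+ 2).
Proof.
move=> B0; rewrite norm_sqn lecR -[B in LHS](ger0_norm B0) -sqrtr_sqr.
by rewrite ler_sqrt // sqr_ge0.
Qed.

Lemma sqn_norm_gt (z : C) (B : R) : 0 <= B -> (B%:C < `|z|) = (B ^+ 2 < sqn z).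
Proof.
by move=> B0; rewrite norm_sqn ltcR ltNge -lecR -norm_sqn sqn_norm_le // -ltNge.
Qed.

(** Near 0 a nonzero polynomial is at least a constant times |y|^l, where l is
    its order of vanishing, which is less than its size. *)
Lemma poly_small_eq0 (T : {poly C}) (m : nat) (d K : R) : 0 < d ->
  (size T <= m)%N -> (forall y, y != 0 -> sqn y < d -> sqn T.[y] <= K * sqn y ^+ m) -> T = 0.
Proof.
move=> d0 sT hT; have [//|T0] := eqVneq T 0; exfalso.
have [l [g]] := multiplicity_XsubC T 0; rewrite T0 /= subr0 => g0 Tg.
have gn0 : g != 0 by apply: contraNneq T0 => g00; rewrite Tg g00 mul0r.
have lm : (l < m)%N.
  apply: leq_trans sT; rewrite Tg size_mul ?expf_neq0 ?polyX_eq0 // size_polyXn addnS /=.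
  by rewrite -add1n leq_add2r lt0n size_poly_eq0.
have gt0 : 0 < sqn g.[0] by rewrite sqn_gt0.
have K0 : 0 <= K.
  rewrite leNgt; apply/negP => Kn.
  pose y : C := (Num.sqrt (d / 2))%:C.
  have d2 : 0 < d / 2 by rewrite divr_gt0.
  have sy : sqn y = d / 2 by rewrite sqnR sqr_sqrtr // ltW.
  have y0 : y != 0 by rewrite -sqn_gt0 sy.
  have := hT y y0; rewrite sy => /(_ _) h.
  have : 0 <= K * (d / 2) ^+ m.
    by apply: le_trans (sqn_ge0 T.[y]) _; apply: h; lra.
  by rewrite pmulr_lge0 ?exprn_gt0 // leNgt Kn.
have tg : tends (nbhs (0 : C)) (horner g) g.[0].
  by exact: tends_horner (@tends_id R 0).
have [d1 d10 hd1] := near_sqn_ex (tends_neq0 (FF := nbhs_filter _) tg g0).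
pose e := Num.min (Num.min d d1) (Num.min 1 (sqn g.[0] / 4 / (K + 1))) / 2.
have K1 : 0 < K + 1 by rewrite ltr_wpDl.
have e0 : 0 < e by rewrite divr_gt0 // !lt_min d0 d10 ltr01 !divr_gt0.
pose y : C := (Num.sqrt e)%:C.
have sy : sqn y = e by rewrite sqnR sqr_sqrtr // ltW.
have y0 : y != 0 by rewrite -sqn_gt0 sy.
have mine : Num.min (Num.min d d1) (Num.min 1 (sqn g.[0] / 4 / (K + 1))) = 2 * e.
  by rewrite /e; field.
have ed : e < d by have := lexx (2 * e); rewrite -{2}mine !le_min => /andP[/andP[]]; lra.
have ed1 : e < d1 by have := lexx (2 * e); rewrite -{2}mine !le_min => /andP[/andP[]]; lra.
have e1 : e < 1 by have := lexx (2 * e); rewrite -{2}mine !le_min => /andP[_ /andP[]]; lra.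
have eg : e < sqn g.[0] / 4 / (K + 1).
  by have := lexx (2 * e); rewrite -{2}mine !le_min => /andP[_ /andP[]]; lra.
have [|h1 _] := hd1 y; first by rewrite subr0 sy.
have := hT y y0; rewrite sy => /(_ ed).
rewrite Tg hornerM hornerXn sqnM sqnX sy /= -(subnK (ltnW lm)) exprD mulrA.
rewrite ler_pM2r ?exprn_gt0 // => h2.
have h3 : K * e ^+ (m - l) <= K * e.
  apply: ler_wpM2l => //; rewrite -[leRHS]expr1; apply: ler_wiXn2l.
  - exact: ltW.
  - exact: ltW.
  by rewrite subn_gt0.
rewrite ltr_pdivlMr // in eg.
by have := h1; rewrite /=; nra.
Qed.

Section Pair.
Variables (k : nat -> nat) (eps b : nat -> R) (p : nat -> {poly R})
  (f : nat -> nat -> R) (sg : R) (s : nat -> R).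
Hypothesis H : fraction_data k eps b p f.
Hypothesis sg0 : 0 < sg.
Hypothesis hf : forall m, f 0%N m.+1 = - s m / sg.
Local Notation P := (P_poly eps b p).
Local Notation Q := (Q_poly eps b p).

(** This is the number for which b_j P_(j+1) - kappa_j P_j vanishes at 0. *)
Definition kappa j : R := b j * ((P j.+1).[0] / (P j).[0]).
Definition Dpoly j : {poly R} := b j *: P j.+1 - kappa j *: P j.
Definition Epoly j : {poly R} := b j *: Q j.+1 - kappa j *: Q j.

Variable j : nat.
Hypothesis kj : k j = 1%N.
Hypothesis P0 : (P j).[0] != 0.
Let d := deg k j.
Let dS : deg k j.+1 = d.+1. Proof. by rewrite degS kj addn1. Qed.
Let bj0 : b j != 0. Proof. by rewrite gt_eqF //; case: H => _ /(_ j) []. Qed.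

Lemma size_Dpoly : (size (Dpoly j) <= d.+2)%N.
Proof.
apply: leq_trans (size_polyD _ _) _; rewrite geq_max size_polyN.
rewrite (leq_trans (size_scale_leq _ _)) -?dS ?(size_P H) //=.
by rewrite (leq_trans (size_scale_leq _ _)) // (leq_trans (size_P H _)) // dS.
Qed.

Lemma size_Epoly : (size (Epoly j) <= d.+2)%N.
Proof.
apply: leq_trans (size_polyD _ _) _; rewrite geq_max size_polyN.
rewrite (leq_trans (size_scale_leq _ _)) -?dS ?(size_Q H) //=.
by rewrite (leq_trans (size_scale_leq _ _)) // (leq_trans (size_Q H _)) // dS.
Qed.

Lemma Dpoly0 : (Dpoly j).[0] = 0.
Proof. by rewrite /Dpoly /kappa hornerD hornerN !hornerZ; field. Qed.

Lemma DE_wronskian : exists2 c : R, c != 0 & Dpoly j * Q j - Epoly j * P j = c%:P.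
Proof.
have [c c0 hc] := wronskian H j; exists (b j * c); first by rewrite mulf_neq0.
by rewrite polyCM -hc /Dpoly /Epoly -!mul_polyC; ring.
Qed.

Lemma Epoly0 : (Epoly j).[0] != 0.
Proof.
have [c c0 hc] := DE_wronskian.
have := congr1 (horner^~ 0) hc; rewrite hornerD hornerN !hornerM Dpoly0 hornerC mul0r sub0r.
by move=> h; apply: contraNneq c0 => E0; rewrite -h E0 mul0r oppr0.
Qed.

(* The polynomials in 1/lambda.  Since [Dpoly] vanishes at 0, its reversal has
   one degree less. *)
Let Db := rev_poly d.+1 (Dpoly j).
Let Eb := rev_poly d.+1 (Epoly j).

Lemma Db_size : (size Db <= d.+1)%N.
Proof.
apply/leq_sizeP => i di; rewrite coef_rev; case: leqP => // id.
have -> : i = d.+1 by lia.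
by rewrite subnn -horner_coef0 Dpoly0.
Qed.

Lemma Db0 : Db.[0] != 0.
Proof.
rewrite horner_coef0 coef_rev /= subn0 /Dpoly coefB !coefZ -dS (P_lead H).
rewrite [(P j)`_ _]nth_default ?mulr0 ?subr0 ?mulf_neq0 ?invr_eq0 //.
  by apply/prodf_neq0 => i _; rewrite gt_eqF //; case: H => _ /(_ i) [].
by rewrite dS; exact: size_P H j.
Qed.

Lemma Eb_size : size Eb = d.+2.
Proof.
apply/eqP; rewrite eqn_leq size_rev_poly /= ltnNge; apply/negP => h.
have := Epoly0; rewrite horner_coef0.
have -> : (Epoly j)`_0 = Eb`_d.+1 by rewrite coef_rev leqnn subnn.
by rewrite nth_default ?eqxx.
Qed.

(** A common factor divides the reversed Wronskian, a multiple of a power of X,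
    but the constant term of Db is nonzero. *)
Lemma Db_Eb_coprime : coprimep Eb Db.
Proof.
have [c c0 hc] := DE_wronskian.
have hrev : Db * rev_poly d (Q j) - Eb * rev_poly d (P j) = c *: 'X^(d.+1 + d).
  rewrite /Db /Eb -!revM ?size_Dpoly ?size_Epoly ?(size_Q H) ?(size_P H) //.
  by rewrite -linearB hc -[c%:P]mulr1 mul_polyC linearZ /= rev1.
rewrite coprimep_sym.
have h1 : coprimep Db ('X^(d.+1 + d)).
  have X0 : 'X = 'X - 0%:P :> {poly R} by rewrite polyC0 subr0.
  rewrite coprimep_expr // X0 coprimep_XsubC.
  exact: Db0.
have : coprimep Db (Eb * rev_poly d (P j)).
  have -> : Eb * rev_poly d (P j) = rev_poly d (Q j) * Db + - c *: 'X^(d.+1 + d).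
    by rewrite scaleNr -hrev; ring.
  by rewrite coprimep_addl_mul coprimepZr // oppr_eq0.
by rewrite coprimepMr => /andP[].
Qed.

(** The remainder of P_(j+1) is small by [rev_remainder]; that of P_j has just
    the order that is needed, thanks to the additional factor 1/lambda in the
    reversal of P_j to degree n_j + 1. *)
Lemma DE_contact : exists g : {poly R},
  Db * (\sum_(i < (d.+1 + d)%N) s i *: 'X^(i.+1)) - sg *: Eb = 'X^(d.+1 + d.+1) * g.
Proof.
pose M := (deg k j.+1 + deg k j.+2 + d + d).+2.
have [|e1 he1 _] := @rev_remainder _ _ _ _ _ _ H j.+1 M; first by rewrite /M; lia.
have [|e2 he2 _] := @rev_remainder _ _ _ _ _ _ H j M.
  by rewrite /M -/d; lia.
set a0 := \poly_(i < M) f 0%N i in he1 he2.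
have revS (T : {poly R}) : (size T <= d.+1)%N -> rev_poly d.+1 T = 'X * rev_poly d T.
  by move=> sT; rewrite -add1n -[T in LHS]mul1r revM ?size_poly1 // rev1.
have d2 : (d.+1 + d.+1 <= deg k j.+1 + deg k j.+2)%N by rewrite (degS k j.+1) dS; lia.
have DbE : Db = b j *: rev_poly d.+1 (P j.+1) - kappa j *: ('X * rev_poly d (P j)).
  by rewrite /Db /Dpoly linearB !linearZ /= (revS _ (size_P H j)).
have EbE : Eb = b j *: rev_poly d.+1 (Q j.+1) - kappa j *: ('X * rev_poly d (Q j)).
  by rewrite /Eb /Epoly linearB !linearZ /= (revS _ (size_Q H j)).
set d3 := (deg k j.+1 + deg k j.+2 - (d.+1 + d.+1))%N.
have h1 : Db * a0 + Eb = 'X^(d.+1 + d.+1) * (b j *: ('X^d3 * e1) - kappa j *: e2).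
  have he1' : rev_poly d.+1 (P j.+1) * a0 + rev_poly d.+1 (Q j.+1) =
      'X^(d.+1 + d.+1) * ('X^d3 * e1).
    by rewrite mulrA -exprD subnKC // -he1 dS.
  have he2' : 'X * (rev_poly d (P j) * a0 + rev_poly d (Q j)) = 'X^(d.+1 + d.+1) * e2.
    by rewrite he2 dS mulrA -exprS.
  transitivity ((b j)%:P * (rev_poly d.+1 (P j.+1) * a0 + rev_poly d.+1 (Q j.+1))
    - (kappa j)%:P * ('X * (rev_poly d (P j) * a0 + rev_poly d (Q j)))).
    by rewrite DbE EbE -!mul_polyC; ring.
  by rewrite he1' he2' -!mul_polyC; ring.
have h2 : sg *: a0 = - (\sum_(i < (d.+1 + d)%N) s i *: 'X^(i.+1))
   + 'X^(d.+1 + d.+1) * (sg *: drop_poly (d.+1 + d.+1) a0).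
  rewrite -[a0 in LHS](poly_take_drop (d.+1 + d.+1)) scalerDr.
  congr (_ + _); last by rewrite -scalerAr mulrC.
  apply/polyP => i; rewrite coefZ coef_take_poly coefN coef_sum.
  under eq_bigr do rewrite coefZ coefXn.
  case: i => [|i].
    rewrite coef_poly big1 => [|i _]; last by rewrite mulr0.
    by rewrite (_ : f 0%N 0%N = 0) ?if_same ?mulr0 ?oppr0 //; case: H.
  rewrite addnS ltnS; case: ltnP => hi.
    rewrite coef_poly ifT; last by rewrite /M dS; lia.
    rewrite hf (bigD1 (Ordinal hi)) //= eqxx mulr1 big1 => [|l /negbTE li].
      by rewrite addr0; field; rewrite gt_eqF.
    by rewrite eqSS eq_sym; rewrite -val_eqE /= in li; rewrite li mulr0.
  rewrite mulr0 big1 ?oppr0 // => l _.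
  by rewrite eqSS gtn_eqF ?mulr0 //; exact: leq_trans (ltn_ord l) hi.
exists (Db * (sg *: drop_poly (d.+1 + d.+1) a0) - sg *:
   (b j *: ('X^d3 * e1) - kappa j *: e2)).
have -> : \sum_(i < (d.+1 + d)%N) s i *: 'X^(i.+1) =
   'X^(d.+1 + d.+1) * (sg *: drop_poly (d.+1 + d.+1) a0) - sg *: a0.
  by rewrite h2; ring.
transitivity ('X^(d.+1 + d.+1) * (Db * (sg *: drop_poly (d.+1 + d.+1) a0))
    - sg%:P * (Db * a0 + Eb)); first by rewrite -!mul_polyC; ring.
by rewrite h1 -!mul_polyC; ring.
Qed.

Let A0 : {poly C} := cpoly (- sg *: Eb).
Let B0 : {poly C} := cpoly Db.

Lemma B00 : B0.[0] != 0.
Proof. by rewrite /B0 -[0]/((0 : R)%:C) cpoly_real fmorph_eq0 Db0. Qed.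

Lemma pade_exists : is_pade s d.+1 d (A0, B0).
Proof.
split=> /=.
- by rewrite /A0 /cpoly size_map_poly (leq_trans (size_scale_leq _ _)) // size_rev_poly.
- by rewrite /B0 /cpoly size_map_poly Db_size.
- exact: B00.
have [g hg] := DE_contact.
have [e [B [e0 Bge hB]]] := poly_quotient_bounded (cpoly g) B00.
have se : 0 < (Num.sqrt e)^-1 by rewrite invr_gt0 sqrtr_gt0.
exists (Num.sqrt B), (Num.sqrt e)^-1 => z hz.
have sz : e^-1 < sqn z.
  by move: hz; rewrite sqn_norm_gt ?(ltW se) // exprVn sqr_sqrtr // ltW.
have z0 : z != 0 by rewrite -sqn_gt0; apply: lt_trans sz; rewrite invr_gt0.
have [|By hBy] := hB z^-1.
  by rewrite sqnV -[e]invrK ltf_pV2 ?posrE ?invr_gt0 ?sqn_gt0.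
have yz : z^-1 ^+ (d.+1 + d.+1) = (z ^+ (d.+1 + d.+1))^-1 by rewrite exprVn.
have hsum : \sum_(i < d.+1 + d) (s i)%:C / z ^+ i.+1 =
    (cpoly (\sum_(i < (d.+1 + d)%N) s i *: 'X^(i.+1))).[z^-1].
  rewrite /cpoly rmorph_sum horner_sum; apply: eq_bigr => i _.
  by rewrite /= map_polyZ map_polyXn hornerZ hornerXn exprVn.
have -> : \sum_(i < d.+1 + d) (s i)%:C / z ^+ i.+1 + A0.[z^-1] / B0.[z^-1] =
   (cpoly g).[z^-1] / B0.[z^-1] / z ^+ (d.+1 + d.+1).
  rewrite hsum; set S := (cpoly (\sum_(_ < _) _)).[_].
  have hg' : B0.[z^-1] * S + A0.[z^-1] = z^-1 ^+ (d.+1 + d.+1) * (cpoly g).[z^-1].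
    have := congr1 (fun T : {poly R} => (cpoly T).[z^-1]) hg.
    by rewrite cpolyM cpolyD cpolyM -scaleNr /cpoly map_polyXn hornerXn.
  have zn : z ^+ (d.+1 + d.+1) != 0 by rewrite expf_neq0.
  have -> : (cpoly g).[z^-1] = z ^+ (d.+1 + d.+1) * (B0.[z^-1] * S + A0.[z^-1]).
    by rewrite hg' yz mulrA divff // mul1r.
  by field; rewrite By zn.
rewrite addn1 -addnS normrM normfV normrX ler_pM2r ?invr_gt0 ?exprn_gt0 ?normr_gt0 //.
by rewrite sqn_norm_le ?sqrtr_ge0 // sqr_sqrtr.
Qed.

(** Two approximants A/B and A0/B0 agree to an order exceeding the degree of
    A B0 - A0 B, which therefore vanishes; as A0/B0 is in lowest terms and A0
    has the largest degree possible, A/B is a constant multiple of it. *)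
Lemma pade_unique AB : is_pade s d.+1 d AB ->
  exists2 c : C, c != 0 & AB = (c *: A0, c *: B0).
Proof.
case: AB => A B [/= sA sB B1 [K [r hr]]].
have [_ _ _ [K0 [r0 hr0]]] := pade_exists; rewrite /= in hr0.
pose m := (d.+1 + d.+1)%N.
have mE : (d.+1 + d + 1 = m)%N by rewrite /m addn1 addnS.
have T0 : A * B0 - A0 * B = 0.
  have [e1 [C1 [e10 C10 h1]]] := poly_quotient_bounded 1 B1.
  have [e2 [C2 [e20 C20 h2]]] := poly_quotient_bounded 1 B00.
  (* The denominator 1 turns the bound on quotients into one on B * B0. *)
  have one0 : (1 : {poly C}).[0] != 0 by rewrite hornerC oner_neq0.
  have [e3 [C3 [e30 C30 h3]]] := poly_quotient_bounded (B * B0) one0.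
  pose M := Num.max 1 (Num.max r r0).
  have M0 : 0 < M by rewrite lt_max ltr01.
  pose K' := (`|K| + `|K0|) ^+ 2.
  apply: (@poly_small_eq0 _ m (Num.min (Num.min e1 e2) (Num.min e3 (M ^+ 2)^-1)) (K' * C3)).
  - by rewrite !lt_min e10 e20 e30 invr_gt0 exprn_gt0.
  - have [sA0 sB0 _ _] := pade_exists; rewrite /= in sA0 sB0.
    have mul_size (X Y : {poly C}) : (size X <= d.+2)%N -> (size Y <= d.+1)%N ->
        (size (X * Y)%R <= m)%N.
      move=> sX sY; apply: leq_trans (size_polyMleq _ _) _.
      rewrite -subn1 leq_subLR /m; apply: leq_trans (leq_add sX sY) _.
      by rewrite add1n !addSn !addnS.
    apply: leq_trans (size_polyD _ _) _; rewrite geq_max size_polyN.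
    by rewrite !mul_size.
  move=> y y0; rewrite !lt_min => /andP[/andP[/h1 [Bn _] /h2 [B0n _]] /andP[/h3 [_ h3'] yM]].
  have zM : M%:C < `|y^-1|.
    rewrite sqn_norm_gt ?(ltW M0) // sqnV -[M ^+ 2]invrK ltf_pV2 ?posrE ?sqn_gt0 //.
    by rewrite invr_gt0 exprn_gt0.
  have zr : r%:C < `|y^-1| by apply: le_lt_trans zM; rewrite lecR /M !le_max lexx !orbT.
  have zr0 : r0%:C < `|y^-1| by apply: le_lt_trans zM; rewrite lecR /M !le_max lexx !orbT.
  have := hr _ zr; have := hr0 _ zr0; rewrite !invrK mE.
  set S := \sum_(i < _) _ => b0 b1.
  have ny : 0 < `|y^-1| ^+ m by rewrite exprn_gt0 // normr_gt0 invr_eq0.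
  rewrite ler_pdivlMr // in b0; rewrite ler_pdivlMr // in b1.
  have tri : `|(A.[y] / B.[y] - A0.[y] / B0.[y]) * y^-1 ^+ m| <= (`|K| + `|K0|)%:C.
    have -> : A.[y] / B.[y] - A0.[y] / B0.[y] =
      (S + A.[y] / B.[y]) - (S + A0.[y] / B0.[y]) by ring.
    rewrite normrM normrX; apply: le_trans (ler_wpM2r (ltW ny) (ler_normB _ _)) _.
    rewrite mulrDl rmorphD; apply: lerD; [apply: le_trans b1 _ | apply: le_trans b0 _];
      by rewrite lecR ler_norm.
  rewrite sqn_norm_le ?addr_ge0 // sqnM sqnX sqnV in tri.
  have ym : 0 < sqn y ^+ m by rewrite exprn_gt0 // sqn_gt0.
  have tri' : sqn (A.[y] / B.[y] - A0.[y] / B0.[y]) <= K' * sqn y ^+ m.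
    by rewrite exprVn ler_pdivrMr in tri.
  have -> : (A * B0 - A0 * B).[y] =
     (A.[y] / B.[y] - A0.[y] / B0.[y]) * ((B * B0).[y] / (1 : {poly C}).[y]).
    by rewrite hornerD hornerN !hornerM hornerC divr1; field; rewrite Bn B0n.
  rewrite sqnM mulrAC; apply: ler_pM; rewrite ?sqn_ge0 //.
have cop : coprimep A0 B0.
  by rewrite /A0 /B0 /cpoly coprimep_map coprimepZl ?oppr_eq0 ?gt_eqF // Db_Eb_coprime.
have sA0 : size A0 = d.+2.
  by rewrite /A0 /cpoly size_map_poly size_scale ?Eb_size // oppr_eq0 gt_eqF.
have dvd : A0 %| A.
  rewrite -(Gauss_dvdpl _ cop); apply/dvdpP; exists B.
  by apply/eqP; rewrite -subr_eq0 [B * A0]mulrC T0.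
have A0n : A0 != 0 by rewrite -size_poly_eq0 sA0.
have B0n : B0 != 0 by apply: contraNneq B00 => ->; rewrite horner0.
have [c hc] : exists c, A = c *: A0.
  case/dvdpP: dvd => g gE; have [g0|g0] := eqVneq g 0.
    by exists 0; rewrite gE g0 mul0r scale0r.
  have : (size g <= 1)%N.
    by move: sA; rewrite gE size_mul // sA0 addnS /= -[d.+2]add1n leq_add2r.
  by move=> /size1_polyC gc; exists g`_0; rewrite gE {1}gc mul_polyC.
have BE : B = c *: B0.
  apply: (mulfI A0n); apply/eqP; rewrite -subr_eq0 -oppr_eq0 opprB.
  by rewrite -[X in _ == X]T0 hc -scalerAr scalerAl.
exists c; last by rewrite hc BE.
apply: contraNneq B1 => c0; by rewrite BE c0 scale0r horner0.
Qed.

Lemma pade_formula : exists2 c : C, c != 0 &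
  forall z, z != 0 ->
  pade_den s d.+1 d z = c * (cpoly (Dpoly j)).[z] / z ^+ d.+1 /\
  pade s d.+1 d z = - (sg%:C * (cpoly (Epoly j)).[z]) / (cpoly (Dpoly j)).[z].
Proof.
have hx : is_pade s d.+1 d (pade_pair s d.+1 d).
  by apply: (xgetPex (0, 0)); exists (A0, B0); exact: pade_exists.
have [c c0 hc] := pade_unique hx.
have revE (T : {poly R}) (z : C) : (size T <= d.+2)%N -> z != 0 ->
    (cpoly (rev_poly d.+1 T)).[z^-1] = (cpoly T).[z] / z ^+ d.+1.
  move=> sT z0; rewrite /cpoly (rev_sum sT) {2}(poly_sumX sT) !rmorph_sum !horner_sum mulr_suml.
  apply: eq_bigr => i _; rewrite /= !map_polyZ !map_polyXn !hornerZ !hornerXn.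
  have -> : z ^+ d.+1 = z ^+ (d.+1 - i) * z ^+ i.
    by rewrite -exprD subnK // -ltnS.
  by rewrite exprVn; field; rewrite !expf_neq0.
exists c => // z z0.
have denE : pade_den s d.+1 d z = c * (cpoly (Dpoly j)).[z] / z ^+ d.+1.
  by rewrite /pade_den hc /= hornerZ revE ?size_Dpoly // mulrA.
split=> //; rewrite /pade denE hc /= hornerZ /A0 /cpoly map_polyZ hornerZ.
rewrite -/(cpoly _) revE ?size_Epoly // rmorphN /=.
have zd : z ^+ d.+1 != 0 by rewrite expf_neq0.
have [D0|D0] := eqVneq (cpoly (Dpoly j)).[z] 0.
  by rewrite D0 mulr0 mul0r invr0 !mulr0.
by field; rewrite c0 D0 zd.
Qed.
End Pair.
End PadeIdentification.

(** * Limits of resolvent entries *)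

Section Resolvents.
Variable R : realType.
Local Notation C := R[i].

(** Completeness of the real numbers, applied to real and imaginary parts. *)
Lemma complex_complete (u : nat -> C) :
  (forall e : R, 0 < e -> exists x : C, \forall n \near \oo, sqn (u n - x) < e) ->
  exists l, tends \oo u l.
Proof.
move=> hu.
have part (pr : C -> R) : (forall x y, pr (x - y) = pr x - pr y) ->
    (forall x, pr x ^+ 2 <= sqn x) ->
    exists l : R, pr (u n) @[n --> \oo] --> l.
  move=> prB prS; apply/cvg_ex; apply: R_complete; apply: cauchy_exP => e e0.
  have [x hx] := hu _ (exprn_gt0 2 e0); exists (pr x).
  have : \forall n \near \oo, `|pr x - pr (u n)| < e.
    apply: filterS hx => n hn; rewrite distrC -prB.
    rewrite -(@ltr_pXn2r _ 2) ?nnegrE ?(ltW e0) // real_normK ?num_real //.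
    exact: le_lt_trans (prS _) hn.
  by [].
have [|x|a ha] := part (@complex.Re R); first by case=> ? ? [].
  by rewrite sqnE lerDl sqr_ge0.
have [|x|b hb] := part (@complex.Im R); first by case=> ? ? [].
  by rewrite sqnE lerDr sqr_ge0.
exists (a +i* b) => e e0.
have s0 : 0 < Num.sqrt (e / 2) by rewrite sqrtr_gt0 divr_gt0.
move/cvgrPdist_lt: ha => /(_ _ s0) ha; move/cvgrPdist_lt: hb => /(_ _ s0) hb.
near=> n.
have sq (x : R) : `|x| < Num.sqrt (e / 2) -> x ^+ 2 < e / 2.
  move=> hx; rewrite -[ltRHS]sqr_sqrtr ?divr_ge0 ?(ltW e0) //.
  by rewrite -[ltLHS]real_normK ?num_real // ltr_pXn2r ?nnegrE ?sqrtr_ge0.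
have h1 : `|a - complex.Re (u n)| < Num.sqrt (e / 2) by near: n.
have h2 : `|b - complex.Im (u n)| < Num.sqrt (e / 2) by near: n.
rewrite -sqnN opprB sqnE; move: (sq _ h1) (sq _ h2); case: (u n) => x y /=.
by lra.
Unshelve. all: by end_near. Qed.

Section Limit.
Variables (a b kap : nat -> R) (bt L : R).
Hypothesis L0 : 0 < L.
Hypothesis bL : forall i, b i ^+ 2 <= L.
Hypothesis aL : forall m i, (a i + (i == m)%:R * kap m) ^+ 2 <= L.
Hypothesis bt0 : bt != 0.
Variables (p q : C -> nat -> C).
Hypothesis hp : forall z, three_term a b bt z (p z).
Hypothesis hq : forall z, three_term a b bt z (q z).
Hypothesis w0 : forall z, p z 1%N * q z 0%N - q z 1%N * p z 0%N != 0.

Definition res z m : C := res0 b kap bt (p z) (q z) m.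

(** The disc |z - iY|^2 <= 9 L + Y^2 does not contain a given nonreal point once
    Y is large, with the sign opposite to its imaginary part; for a real point
    outside the segment, Y = 0 serves. *)
Lemma far_exists (z0 : C) :
  ~ real_segment (- Num.sqrt (9 * L)) (Num.sqrt (9 * L)) z0 ->
  exists Y t : R, 0 < t /\ \forall z \near z0, far L Y t z.
Proof.
move=> oz; have L9 : 0 < 9 * L by rewrite mulr_gt0.
have [Y hY] : exists Y, disc2 L Y < sqn (z0 - Y *i).
  have [y0|y0] := eqVneq (complex.Im z0) 0; last first.
    exists (- (9 * L + 1) / (2 * complex.Im z0)).
    rewrite sqnE /disc2; case: (z0) y0 => x y /= y0; rewrite subr0.
    have -> : x ^+ 2 + (y - - (9 * L + 1) / (2 * y)) ^+ 2 =
      x ^+ 2 + y ^+ 2 + (9 * L + 1) + (- (9 * L + 1) / (2 * y)) ^+ 2 by field.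
    by have := sqr_ge0 x; have := sqr_ge0 y; lra.
  exists 0; rewrite /disc2 expr0n addr0 sqnE /=.
  move: oz y0; case: (z0) => x y /= oz y0; rewrite y0 in oz *.
  rewrite !subr0 expr0n addr0.
  rewrite ltNge; apply/negP => hx; apply: oz; exists x; last by [].
  rewrite /= in_itv /= -ler_norml -(@ler_pXn2r _ 2) ?nnegrE ?sqrtr_ge0 //.
  by rewrite real_normK ?num_real // sqr_sqrtr // ltW.
set g := sqn _ in hY; set D := disc2 L Y in hY.
have D0 : 0 < D by exact: disc2_gt0.
(* One of the three factors 1 + t is lost to the perturbation of z0; for
   t <= 1, (1 + t)^3 <= 1 + 7 t, and 14 leaves a strict inequality. *)
pose t := Num.min 1 ((g - D) / (14 * D)).
have t0 : 0 < t by rewrite lt_min ltr01 divr_gt0 ?subr_gt0 // mulr_gt0.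
have t1 : t <= 1 by rewrite ge_min lexx.
have tD : t * (14 * D) <= g - D.
  by rewrite -ler_pdivlMr ?mulr_gt0 // ge_min lexx orbT.
have cube : (1 + t) ^+ 3 * D < g.
  have h1 : (1 + t) ^+ 3 <= 1 + 7 * t.
    have : t ^+ 2 <= t by rewrite -[leRHS]expr1; apply: ler_wiXn2l => //; exact: ltW.
    have : t ^+ 3 <= t by rewrite -[leRHS]expr1; apply: ler_wiXn2l => //; exact: ltW.
    have -> : (1 + t) ^+ 3 = 1 + 3 * t + 3 * t ^+ 2 + t ^+ 3.
      by move: (t) => x; ring.
    by lra.
  have := ler_wpM2r (ltW D0) h1; have : 0 < t * D by rewrite mulr_gt0.
  by lra.
exists Y, t; split=> //.
pose del := (g - (1 + t) ^+ 3 * D) / (1 + t^-1).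
have ti : 0 < 1 + t^-1 by rewrite addr_gt0 // invr_gt0.
have del0 : 0 < del by rewrite divr_gt0 // subr_gt0.
near=> z; rewrite /far -/D.
have hz : sqn (z - z0) < del by near: z; exact: near_sqn.
have := sqnD_young (z - Y *i) (- (z - z0)) t0.
have -> : z - Y *i - (z - z0) = z0 - Y *i by ring.
rewrite sqnN -/g => hg.
have h2 : (1 + t^-1) * sqn (z - z0) <= g - (1 + t) ^+ 3 * D.
  by rewrite mulrC -ler_pdivlMr // ltW.
have t2 : 0 < 1 + t by rewrite addr_gt0.
rewrite -(ler_pM2l t2) mulrA -exprS.
by lra.
Unshelve. all: by end_near. Qed.

(** The estimate depends on z only through the disc that it avoids. *)
Lemma res_step_small Y t (e : R) : 0 < t -> 0 < e -> exists M, forall z m l,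
  far L Y t z -> (M <= m)%N -> (m < l)%N -> sqn (res z l - res z m) < e.
Proof.
move=> t0 e0; pose c := t ^+ 2 * disc2 L Y.
have c0 : 0 < c by rewrite mulr_gt0 ?exprn_gt0 ?disc2_gt0.
have q1 : 1 < (1 + t) ^+ 2 by rewrite exprn_egt1 // ltrDl.
have [M hM] := expr_unbounded (10 * L / (c ^+ 2 * e)) q1.
exists M => z m l fz Mm ml.
have := res0_cauchy L0 bL aL bt0 t0 fz (hp z) (hq z) (w0 z) ml.
rewrite -/c exprM -/(res z l) -/(res z m) => h.
have ce : 0 < c ^+ 2 * e by rewrite mulr_gt0 // exprn_gt0.
rewrite (ltr_pdivrMr _ _ ce) in hM.
have qm : ((1 + t) ^+ 2) ^+ M <= ((1 + t) ^+ 2) ^+ m.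
  by apply: ler_weXn2l => //; exact: ltW.
have cc : 0 < c ^+ 2 by rewrite exprn_gt0.
have qp : 0 < ((1 + t) ^+ 2) ^+ m by rewrite exprn_gt0 // (lt_trans ltr01).
have : c ^+ 2 * (((1 + t) ^+ 2) ^+ m * sqn (res z l - res z m)) <
    c ^+ 2 * (((1 + t) ^+ 2) ^+ m * e).
  apply: le_lt_trans h _; apply: lt_le_trans hM _.
  by rewrite mulrCA; apply: ler_wpM2l; [exact: ltW | apply: ler_wpM2r => //; exact: ltW].
by rewrite (ltr_pM2l cc) (ltr_pM2l qp).
Qed.

Definition reslim z : C := xget 0 [set g | tends \oo (res z) g].

Lemma reslim_tends Y t z : 0 < t -> far L Y t z -> tends \oo (res z) (reslim z).
Proof.
move=> t0 fz; apply: (xgetPex 0); apply: complex_complete => e e0.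
have [M hM] := @res_step_small Y t e t0 e0.
exists (res z M); exists M.+1 => // m /= Mm; exact: hM.
Qed.

Lemma res_lip Y t z z1 m : 0 < t -> far L Y t z -> far L Y t z1 ->
  (t ^+ 2 * disc2 L Y) ^+ 2 * sqn (res z m - res z1 m) <= sqn (z - z1).
Proof.
move=> t0 fz fz1.
have h1 := res_first L0 bL aL bt0 t0 fz (hp z) (hq z) (w0 z) (m := m).
have h2 := res_first L0 bL aL bt0 t0 fz1 (hp z1) (hq z1) (w0 z1) (m := m).
have := res_lipschitz L0 bL aL t0 fz fz1 h1 h2.
by rewrite /= !res_first0.
Qed.

(** The entries are equi-Lipschitz, so convergence at z0 gives convergence
    jointly in z and m. *)
Lemma res_joint Y t z0 : 0 < t -> (\forall z \near z0, far L Y t z) ->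
  tends (filter_prod (nbhs z0) \oo) (fun x => res x.1 x.2) (reslim z0).
Proof.
move=> t0 fz e e0; have fz0 := nbhs_singleton fz.
pose c := t ^+ 2 * disc2 L Y.
have c0 : 0 < c ^+ 2 by rewrite exprn_gt0 // mulr_gt0 ?exprn_gt0 ?disc2_gt0.
have e4 : 0 < e / 4 by rewrite divr_gt0.
have h1 := reslim_tends t0 fz0 e4.
have h2 := @near_sqn _ z0 (c ^+ 2 * (e / 4)) (mulr_gt0 c0 e4).
exists ([set z | far L Y t z /\ sqn (z - z0) < c ^+ 2 * (e / 4)],
  [set m | sqn (res z0 m - reslim z0) < e / 4]) => /=.
  by split; [exact: filterI | exact: h1].
move=> [z m] /= [[fz' hz] hm].
have hl : sqn (res z m - res z0 m) < e / 4.
  by rewrite -(ltr_pM2l c0); apply: le_lt_trans hz; exact: res_lip.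
have := sqnD_le (res z m - res z0 m) (res z0 m - reslim z0).
by rewrite addrA subrK; lra.
Qed.

Lemma reslim_continuous Y t z0 : 0 < t -> (\forall z \near z0, far L Y t z) ->
  tends (nbhs z0) reslim (reslim z0).
Proof.
move=> t0 fz e e0; have fz0 := nbhs_singleton fz.
have e4 : 0 < e / 4 by rewrite divr_gt0.
have [[A B] /= [hA [M _ hM]] hAB] := res_joint t0 fz e4.
near=> z.
have Az : A z by near: z.
have fz' : far L Y t z by near: z.
have [M' _ hM'] := reslim_tends t0 fz' e4.
pose m := maxn M M'.
have h1 := hAB (z, m) (conj Az (hM m (leq_maxl _ _))).
have h2 := hM' m (leq_maxr _ _).
have := sqnD_le (- (res z m - reslim z)) (res z m - reslim z0).
rewrite sqnN opprB addrA subrK; move: h1 h2 => /=; lra.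
Unshelve. all: by end_near. Qed.

End Limit.
End Resolvents.

(** * Local convergence *)

Section Convergence.
Variable R : realType.
Local Notation C := R[i].
Variable sigma : {finite_measure set (measurableTypeR R) -> \bar R}.
Variables (q1 w1 q2 w2 : {poly R}) (s : nat -> R) (rho : R).
Local Notation phi := (mero_sum sigma q1 w1 q2 w2).
Local Notation F := (mero_val phi).
Hypothesis w10 : w1 != 0.
Hypothesis w20 : w2 != 0.
Hypothesis qpos : forall x : R, w1.[x] != 0 -> 0 <= q1.[x] / w1.[x].
Hypothesis hser : forall z : C, rho%:C < `|z| ->
  series (fun j => - (s j)%:C / z ^+ j.+1) @ \oo --> F z.
Local Notation W := (weight_den w1 w2).
Local Notation q := (weight_num q1 w1 w2).
Variables (k : nat -> nat) (eps b : nat -> R) (p : nat -> {poly R})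
  (f : nat -> nat -> R) (sg : R).
Hypothesis H : fraction_data k eps b p f.
Hypothesis sg0 : 0 < sg.
Hypothesis hf : forall m, f 0%N m.+1 = - s m / sg.
Variables (N : nat) (K B : R).
Hypothesis k1 : forall j, (N <= j)%N -> k j = 1%N.
Hypothesis eps1 : forall j, (N <= j)%N -> eps j = 1.
Hypothesis K1 : 1 <= K.
Hypothesis hK : forall j, (N <= j)%N -> `|(p j)`_0| <= K /\ b j <= K.
Hypothesis B0 : 0 <= B.
Hypothesis hB : forall j, `|kappa eps b p j| <= B.
Local Notation P := (P_poly eps b p).
Local Notation Q := (Q_poly eps b p).

(* The Jacobi matrix of the tail has indices N + 1, N + 2, ...; the values of
   the solutions at N play the role of the boundary value y 0. *)
Let a' i := - (p (N.+1 + i)%N)`_0.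
Let b' i := b (N.+1 + i)%N.
Let kap m := kappa eps b p (N.+1 + m)%N.
Let L := (K + B + 1) ^+ 2.
Let Y (z : C) i := (cpoly (P (N + i)%N)).[z].
Let Z (z : C) i := (cpoly (Q (N + i)%N)).[z].
Let G := reslim b' kap (b N) Y Z.
Let h := res b' kap (b N) Y Z.

Let b_gt0 j : 0 < b j. Proof. by case: H => _ /(_ j) []. Qed.
Let KB0 : 0 < K + B + 1.
Proof. by rewrite ltr_wpDl // addr_ge0 // (le_trans ler01). Qed.
Let L0 : 0 < L. Proof. by rewrite exprn_gt0. Qed.
Let bL i : b' i ^+ 2 <= L.
Proof.
have Ni : (N <= N.+1 + i)%N by lia.
have [_ bK] := hK Ni.
rewrite /L /b' ler_pXn2r ?nnegrE ?(ltW KB0) ?(ltW (b_gt0 _)) //.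
by have := B0; lra.
Qed.
Let aL m i : (a' i + (i == m)%:R * kap m) ^+ 2 <= L.
Proof.
have Ni : (N <= N.+1 + i)%N by lia.
have [aK _] := hK Ni.
rewrite -[leLHS]real_normK ?num_real // /L ler_pXn2r ?nnegrE ?(ltW KB0) //.
apply: le_trans (ler_normD _ _) _; rewrite /a' normrN normrM.
have kB := hB (N.+1 + m)%N; have : `|(i == m)%:R : R| <= 1.
  by case: (i == m); rewrite ?normr1 ?normr0.
have := normr_ge0 (kap m); rewrite -/(kap m) in kB.
by have := normr_ge0 ((i == m)%:R : R); move=> x0 y0 x1; nra.
Qed.
Let bt0 : b N != 0. Proof. by rewrite gt_eqF. Qed.

Let three z (T : nat -> {poly R}) :
  (forall j, (N <= j)%N -> 'X * T j.+1 =
     b j *: T j + (- (p j.+1)`_0) *: T j.+1 + b j.+1 *: T j.+2) ->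
  three_term a' b' (b N) z (fun i => (cpoly (T (N + i)%N)).[z]).
Proof.
move=> hT i; have := congr1 (fun g => (cpoly g).[z]) (hT (N + i)%N (leq_addr _ _)).
rewrite !cpolyD cpolyM /cpoly !map_polyZ !hornerZ map_polyX hornerX /=.
rewrite !addnS => ->; congr (_ * _ + _ * _ + _ * _).
by case: i => [|i]; rewrite ?addn0 // /b' addnS addSn.
Qed.
Let hY z : three_term a' b' (b N) z (Y z).
Proof. by apply: three => j Nj; exact: (P_tail_rec H k1 eps1). Qed.
Let hZ z : three_term a' b' (b N) z (Z z).
Proof. by apply: three => j Nj; exact: (Q_tail_rec H k1 eps1). Qed.

Let wr z : Y z 1%N * Z z 0%N - Z z 1%N * Y z 0%N != 0.
Proof.
have [c c0 hc] := wronskian H N.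
have := congr1 (fun g => (cpoly g).[z]) hc.
rewrite /cpoly rmorphB !rmorphM /= hornerD hornerN !hornerM map_polyC hornerC /=.
rewrite /Y /Z addn0 addn1 -/(cpoly _) => e.
by rewrite [X in _ - X]mulrC e fmorph_eq0.
Qed.

Let bdryY z m : bdry b' kap m (Y z) = (cpoly (Dpoly eps b p (N.+1 + m)%N)).[z].
Proof.
rewrite /bdry /Y /Dpoly /cpoly rmorphB /= !map_polyZ hornerD hornerN !hornerZ.
by rewrite !addnS !addSn.
Qed.
Let bdryZ z m : bdry b' kap m (Z z) = (cpoly (Epoly eps b p (N.+1 + m)%N)).[z].
Proof.
rewrite /bdry /Z /Epoly /cpoly rmorphB /= !map_polyZ hornerD hornerN !hornerZ.
by rewrite !addnS !addSn.
Qed.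

Let Rd := Num.sqrt (9 * L).
Let Rd1 : 1 <= Rd.
Proof.
have L9 : 0 <= 9 * L by rewrite mulr_ge0 // ltW.
have h1 : 1 ^+ 2 <= Rd ^+ 2.
  by rewrite /Rd sqr_sqrtr // expr1n /L; have := K1; have := B0; nra.
by move: h1; rewrite ler_pXn2r ?nnegrE ?sqrtr_ge0.
Qed.
Let outside z := ~ real_segment (- Rd) Rd z.
Let out_off z : outside z -> off z.
Proof.
move=> oz [t /=]; rewrite in_itv /= => /andP[t1 t2] tz; apply: oz; exists t => //=.
by rewrite in_itv /=; have := Rd1; lra.
Qed.

Let far_near z0 : outside z0 -> exists Y t : R, 0 < t /\ \forall z \near z0, far L Y t z.
Proof. exact: far_exists. Qed.

(* Numerator and denominator of the Moebius map that takes the upper left entry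
   of the resolvent of the tail to the approximant, or to F. *)
Let den1 (z g : C) : C := Y z 1%N + (b N)%:C * Y z 0%N * g.
Let num1 (z g : C) : C := - (sg%:C * (Z z 1%N + (b N)%:C * Z z 0%N * g)).

(* By [wr] the Moebius map is nondegenerate. *)
Let den_num z g : den1 z g = 0 -> num1 z g != 0.
Proof.
move=> d0; apply: contraNneq (wr z) => n0.
have sgC : sg%:C != 0 by rewrite fmorph_eq0 gt_eqF.
have n0' : Z z 1%N + (b N)%:C * Z z 0%N * g = 0.
  by apply/eqP; move/eqP: n0; rewrite oppr_eq0 mulf_eq0 (negbTE sgC).
have -> : Y z 1%N * Z z 0%N - Z z 1%N * Y z 0%N =
  den1 z g * Z z 0%N - (Z z 1%N + (b N)%:C * Z z 0%N * g) * Y z 0%N by rewrite /den1; ring.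
by rewrite d0 n0' !mul0r subrr.
Qed.

Lemma tends_unique0 (T : Type) (FF : set_system T) {PF : ProperFilter FF}
  (g : T -> C) (l : C) : tends FF g l -> tends FF g 0 -> l = 0.
Proof.
move=> gl g0; apply/eqP; rewrite -sqn_eq0; apply/negPn/negP => l0.
have l1 : 0 < sqn l / 4 by rewrite divr_gt0 // lt_def l0 sqn_ge0.
have [x [h1 h2]] := filter_ex (filterI (gl _ l1) (g0 _ l1)).
rewrite subr0 in h2.
have := sqnD_le (- (g x - l)) (g x); rewrite sqnN opprB subrK.
by lra.
Qed.

Let den_weight := \sum_(i < size W) `|W`_i| * (3 * K) ^+ i.

Let Itr_P_bound z (d : R) i : (N + size W <= i)%N -> off z -> 0 < d ->
  (forall t, (`[-1, 1]%classic : set R) t -> d ^+ 2 <= sqn (t%:C - z)) ->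
  sqn (Itr sigma (P i * q) z) <= 2 * ((sg * den_weight + ratint sigma q 1) / d) ^+ 2.
Proof.
move=> Ni oz d0 hd.
have q0 t : 0 <= q.[t] by exact: weight_num_ge0.
apply: le_trans (Itr_bound sigma (P i) (fun t _ => q0 t) oz d0 hd) _.
have r0 g : (forall t, 0 <= g.[t]) -> 0 <= ratint sigma g 1.
  by move=> g0; apply: Rintegral_ge0 => t _; rewrite hornerC divr1.
have PP0 : 0 <= ratint sigma (P i * (P i * q)) 1.
  apply: r0 => t; rewrite hornerM (hornerM (P i) q) mulrA -expr2; apply: mulr_ge0; [exact: sqr_ge0 | exact: q0].
have h1 : ratint sigma (P i * (P i * q)) 1 <= sg * den_weight.
  rewrite mulrA -(moment_identity w10 w20 hser) (mom_momf sg0 hf) ler_pM2l //.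
  exact: (weighted_moment_bounded H k1 eps1 K1 hK Ni).
have rq : 0 <= ratint sigma q 1 by apply: r0; exact: q0.
have sw : 0 <= sg * den_weight by exact: le_trans PP0 h1.
apply: ler_wpM2l => //.
have mono : (ratint sigma (P i * (P i * q)) 1 + ratint sigma q 1) / d <=
   (sg * den_weight + ratint sigma q 1) / d.
  by rewrite ler_pM2r ?invr_gt0 // lerD2r.
by rewrite ler_pXn2r // nnegrE divr_ge0 ?(ltW d0) // addr_ge0.
Qed.

(** E m below is W (D_j F + sg E_j) times the Wronskian over the casoratian; the
    first factor stays bounded and the last one decays exponentially.  Its limit
    is W times the difference of the two sides. *)
Lemma phi_den_num z : outside z -> (cpoly W).[z] != 0 ->
  phi z * den1 z (G z) = num1 z (G z).
Proof.
move=> oz Wz; have oz' := out_off oz.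
have [Yc [t [t0 hfar]]] := far_near oz; have fz := nbhs_singleton hfar.
have [d d0 hd] := dist_off oz'; have hd0 := nbhs_singleton hd.
pose c := t ^+ 2 * disc2 L Yc.
have c0 : 0 < c by rewrite mulr_gt0 ?exprn_gt0 ?disc2_gt0.
pose V i := Y z i * phi z + sg%:C * Z z i.
pose E m := (cpoly W).[z] * (V 1%N + (b N)%:C * V 0%N * h z m).
have tG := reslim_tends L0 bL aL bt0 hY hZ wr t0 fz.
have tE : tends \oo E ((cpoly W).[z] * (V 1%N + (b N)%:C * V 0%N * G z)).
  apply: tendsM; first exact: tends_cst.
  apply: tendsD; first exact: tends_cst.
  by apply: tendsM; [exact: tends_cst | exact: tG].
pose Ct := 2 * ((sg * den_weight + ratint sigma q 1) / d) ^+ 2.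
have Ct0 : 0 <= Ct by rewrite mulr_ge0 ?sqr_ge0.
have ideg i : (i <= deg k i.+1)%N.
  elim: i => [//|i IH]; rewrite degS.
  have ki : (0 < k i.+1)%N by case: H.
  by apply: leq_trans (leq_add IH ki); rewrite addn1.
have Esmall m : (N + size W + size W <= m)%N ->
    c * ((1 + t) ^+ (2 * m) * sqn (E m)) <= 4 * L * Ct + 4 * L * Ct.
  move=> Nm.
  have X0 := casoratian_neq0 L0 bL aL t0 fz (hY z) (hZ z) (wr z) m.
  set X := casoratian _ _ _ _ _ in X0.
  set w := Y z 1%N * Z z 0%N - Z z 1%N * Y z 0%N.
  have e1 := bdry_p L0 bL aL bt0 t0 fz (hY z) (hZ z) (wr z) m.
  have e2 := bdry_q L0 bL aL bt0 t0 fz (hY z) (hZ z) (wr z) m.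
  rewrite -/X -/(h z m) -/w bdryY in e1; rewrite -/X -/(h z m) -/w bdryZ in e2.
  have rem i : (size W <= i)%N -> (cpoly W).[z] * ((cpoly (P i)).[z] * phi z +
      sg%:C * (cpoly (Q i)).[z]) = Itr sigma (P i * q) z.
    move=> Wi; apply: (remainder_transform w10 w20 hser H sg0 hf) => //.
    exact: leq_trans Wi (ideg i).
  have Wm : (size W <= N.+1 + m)%N.
    by apply: leq_trans (leq_addl _ m); apply: leq_trans (leq_addl _ _) Nm.
  have NWm : (N + size W <= N.+1 + m)%N.
    by apply: leq_trans (leq_addl _ m); apply: leq_trans (leq_addr _ _) Nm.
  have EE : E m = ((b' m)%:C * Itr sigma (P (N.+1 + m).+1 * q) z
      - (kap m)%:C * Itr sigma (P (N.+1 + m)%N * q) z) * (w / X).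
    rewrite -!rem //; last exact: leqW.
    apply: (mulIf X0); rewrite -[in RHS]mulrA divfK //.
    have -> : E m * X = (cpoly W).[z] * (((Y z 1%N + (b N)%:C * Y z 0%N * h z m) * X) * phi z
       + sg%:C * ((Z z 1%N + (b N)%:C * Z z 0%N * h z m) * X)).
      by rewrite /E /V; ring.
    rewrite e1 e2 /Dpoly /Epoly /cpoly !rmorphB /= !map_polyZ !hornerD !hornerN !hornerZ /=.
    rewrite /b' /kap; ring.
  have small := casoratian_large L0 bL aL t0 fz (hY z) (hZ z) (wr z) m.
  rewrite -/X -/w -/c in small.
  have kL : kap m ^+ 2 <= L.
    rewrite -[leLHS]real_normK ?num_real // ler_pXn2r ?nnegrE ?(ltW KB0) //.
    by apply: le_trans (hB _) _; have := K1; lra.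
  set I1 := Itr _ _ _ in EE; set I2 := Itr _ (P (N.+1 + m)%N * q) _ in EE.
  have i1 : sqn I1 <= Ct by apply: Itr_P_bound => //; exact: leqW.
  have i2 : sqn I2 <= Ct by exact: Itr_P_bound.
  have num_le : sqn ((b' m)%:C * I1 - (kap m)%:C * I2) <= 4 * L * Ct + 4 * L * Ct.
    apply: le_trans (sqnD_le _ _) _; rewrite sqnN !sqnM !sqnR.
    have s1 : b' m ^+ 2 * sqn I1 <= L * Ct by apply: ler_pM; rewrite ?sqr_ge0 ?sqn_ge0.
    have s2 : kap m ^+ 2 * sqn I2 <= L * Ct by apply: ler_pM; rewrite ?sqr_ge0 ?sqn_ge0.
    have : 0 <= L * Ct by rewrite mulr_ge0 ?(ltW L0).
    by lra.
  rewrite EE sqnM; set u := sqn (_ - _) in num_le *.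
  have -> : c * ((1 + t) ^+ (2 * m) * (u * sqn (w / X))) =
     u * (c * ((1 + t) ^+ (2 * m) * sqn (w / X))) by ring.
  rewrite -[leRHS]mulr1; apply: ler_pM => //; first exact: sqn_ge0.
  apply: mulr_ge0; first exact: ltW.
  by apply: mulr_ge0; [apply: exprn_ge0; rewrite addr_ge0 // ltW | exact: sqn_ge0].
have E0 : tends \oo E 0.
  move=> e e0; have q_gt1 : 1 < (1 + t) ^+ 2 by rewrite exprn_egt1 // ltrDl.
  have [M hM] := expr_unbounded ((4 * L * Ct + 4 * L * Ct) / (c * e)) q_gt1.
  exists (maxn (N + size W + size W) M) => // m /=; rewrite geq_max => /andP[Nm Mm].
  have := Esmall _ Nm; rewrite subr0 exprM => h1.
  have ce : 0 < c * e by rewrite mulr_gt0.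
  rewrite (ltr_pdivrMr _ _ ce) in hM.
  have qm : ((1 + t) ^+ 2) ^+ M <= ((1 + t) ^+ 2) ^+ m.
    by apply: ler_weXn2l => //; exact: ltW.
  have qp : 0 < ((1 + t) ^+ 2) ^+ m by rewrite exprn_gt0 // (lt_trans ltr01).
  rewrite -(ltr_pM2l qp) -(ltr_pM2l c0); apply: le_lt_trans h1 _.
  apply: lt_le_trans hM _; rewrite mulrCA; apply: ler_wpM2l; first exact: ltW.
  by apply: ler_wpM2r => //; exact: ltW.
have V00 : (cpoly W).[z] * (V 1%N + (b N)%:C * V 0%N * G z) = 0.
  exact: tends_unique0 tE E0.
move/eqP: V00; rewrite mulf_eq0 (negbTE Wz) /= => /eqP V0.
by apply/eqP; rewrite -subr_eq0 -V0 /den1 /num1 /V; apply/eqP; ring.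
Qed.

Let joint z0 : outside z0 ->
  tends (filter_prod (nbhs z0) \oo) (fun x => h x.1 x.2) (G z0) /\
  tends (nbhs z0) G (G z0).
Proof.
move=> /far_near [Yc [t [t0 hfar]]]; split.
  exact: (res_joint L0 bL aL bt0 hY hZ wr t0 hfar).
exact: (reslim_continuous L0 bL aL bt0 hY hZ wr t0 hfar).
Qed.

Let outside_near z0 : outside z0 -> \forall z \near z0, outside z.
Proof.
move=> /far_near [Yc [t [t0 hfar]]]; near=> z => -[x /=].
rewrite in_itv /= => hx zx.
have fz : far L Yc t z by near: z.
have x2 : x ^+ 2 <= 9 * L.
  have L9 : 0 <= 9 * L by rewrite mulr_ge0 // ltW.
  rewrite -[9 * L](sqr_sqrtr L9) -[leLHS]real_normK ?num_real //.
  by rewrite ler_pXn2r ?nnegrE ?sqrtr_ge0 // ler_norml.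
move: fz; rewrite /far -zx sqnE /= subr0 sub0r sqrrN => fz.
have D0 := disc2_gt0 L0 Yc.
have : disc2 L Yc < (1 + t) ^+ 2 * disc2 L Yc.
  by rewrite ltr_pMl // exprn_egt1 // ltrDl.
by move: fz; rewrite /disc2; lra.
Unshelve. all: by end_near. Qed.

Section TendsDenNum.
Context {T : Type} {FF : set_system T} {PF : Filter FF}.
Variables (zz gg : T -> C) (z0 g0 : C).
Hypothesis hz : tends FF zz z0.
Hypothesis hg : tends FF gg g0.

Lemma tends_den : tends FF (fun x => den1 (zz x) (gg x)) (den1 z0 g0).
Proof.
apply: tendsD; first exact: tends_horner.
by apply: tendsM => //; apply: tendsM; [exact: tends_cst | exact: tends_horner].
Qed.

Lemma tends_num : tends FF (fun x => num1 (zz x) (gg x)) (num1 z0 g0).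
Proof.
have neg (u : T -> C) l : tends FF u l -> tends FF (fun x => - u x) (- l).
  move=> ul; rewrite -mulN1r; apply: tends_eq (tendsM (tends_cst (-1)) ul).
  by apply: filterE => x; rewrite mulN1r.
apply: neg; apply: tendsM; first exact: tends_cst.
apply: tendsD; first exact: tends_horner.
by apply: tendsM => //; apply: tendsM; [exact: tends_cst | exact: tends_horner].
Qed.
End TendsDenNum.

Let Wn0 : cpoly W != 0.
Proof. by rewrite /cpoly map_poly_eq0 weight_den_neq0. Qed.

(** The right side is continuous, and [phi_den_num] identifies it with phi on a
    punctured neighbourhood, also around the zeros of W. *)
Lemma F_den_num z : outside z -> den1 z (G z) != 0 -> F z = num1 z (G z) / den1 z (G z).
Proof.
move=> oz dz; apply: mero_val_tends.
have [_ tG] := joint oz.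
have td := tends_den (PF := nbhs_filter z) (@tends_id R z) tG.
have tn := tends_num (PF := nbhs_filter z) (@tends_id R z) tG.
have tq := tends_dnbhs (tendsM (FF := nbhs_filter z) tn (tendsV (FF := nbhs_filter z) td dz)).
apply: tends_eq tq.
have n1 := near_dnbhs_root z Wn0.
have n2 := dnbhs_near (tends_neq0 (FF := nbhs_filter z) td dz).
have n3 := dnbhs_near (outside_near oz).
near=> x.
have [_ dx] : sqn (den1 z (G z)) / 4 < sqn (den1 (id x) (G x)) /\ den1 (id x) (G x) != 0.
  by near: x; exact: n2.
have Wx : (cpoly W).[x] != 0 by near: x; exact: n1.
have ox : outside x by near: x; exact: n3.
by rewrite -(phi_den_num ox Wx) mulfK.
Unshelve. all: by end_near. Qed.

(** At a zero of the denominator the numerator is nonzero, so that phi tends to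
    infinity there. *)
Lemma den_neq0 z : outside z -> ~ poles phi z -> den1 z (G z) != 0.
Proof.
move=> oz np; apply/eqP => d0; apply: np; split; first exact: out_off.
move=> M; have [_ tG] := joint oz.
have td := tends_dnbhs (tends_den (PF := nbhs_filter z) (@tends_id R z) tG).
have tn := tends_dnbhs (tends_num (PF := nbhs_filter z) (@tends_id R z) tG).
rewrite /= d0 in td.
have n1 := near_dnbhs_root z Wn0.
have n3 := dnbhs_near (outside_near oz).
have dn : \forall x \near z^', den1 (id x) (G x) != 0.
  near=> x; apply/negP => /eqP dx.
  have Wx : (cpoly W).[x] != 0 by near: x; exact: n1.
  have ox : outside x by near: x; exact: n3.
  have := phi_den_num ox Wx; have := den_num dx; rewrite /= in dx; rewrite dx mulr0.
  by move=> /eqP nx e; apply: nx.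
have nM := tends_inv_infty (`|M| ^+ 2) tn td (den_num d0) dn.
near=> x.
have ox : outside x by near: x; exact: n3.
have Wx : (cpoly W).[x] != 0 by near: x; exact: n1.
have dx : den1 (id x) (G x) != 0 by near: x; exact: dn.
have hM : `|M| ^+ 2 < sqn (num1 (id x) (G x) / den1 (id x) (G x)) by near: x; exact: nM.
apply: le_lt_trans (_ : `|M|%:C < _); first by rewrite lecR ler_norm.
rewrite sqn_norm_gt //; move: hM; rewrite /= -(phi_den_num ox Wx) mulfK //.
Unshelve. all: by end_near. Qed.

(** The approximants are images of h z m under the Moebius map of which F is the
    image of G z, and h z m tends to G z0 jointly in z and m. *)
Lemma pade_local z0 (e : R) : outside z0 -> ~ poles phi z0 -> 0 < e ->
  \forall z \near z0 & j \near \oo, (0 < j)%N -> (P j.-1).[0] != 0 ->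
    pade_den s (deg k j) (deg k j).-1 z != 0 /\
    sqn (pade s (deg k j) (deg k j).-1 z - F z) < e.
Proof.
move=> oz np e0; have dz := den_neq0 oz np.
have [tj tG] := joint oz.
have e4 : 0 < e / 4 by rewrite divr_gt0.
have tid : tends (filter_prod (nbhs z0) \oo) (fun x : C * nat => x.1) z0.
  move=> d d0; exists ([set z | sqn (z - z0) < d], setT) => /=.
    by split; [exact: near_sqn | exact: filterT].
  by move=> x [].
have PFp : Filter (filter_prod (nbhs z0) \oo) by exact: filter_prod_filter.
have td := tends_den (PF := PFp) tid tj; have tn := tends_num (PF := PFp) tid tj.
have tq := tendsM (FF := PFp) tn (tendsV (FF := PFp) td dz).
have td1 := tends_den (PF := nbhs_filter z0) (@tends_id R z0) tG; have tn1 := tends_num (PF := nbhs_filter z0) (@tends_id R z0) tG.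
have tq1 := tendsM (FF := nbhs_filter z0) tn1 (tendsV (FF := nbhs_filter z0) td1 dz).
have [[A J] /= [hA [M _ hM]] hAJ] := filterI (tends_neq0 (FF := PFp) td dz) (tq _ e4).
have n1 := tends_neq0 (FF := nbhs_filter z0) td1 dz.
have n2 := tq1 _ e4.
have [Yc [t [t0 hfar]]] := far_near oz.
exists ([set z | [/\ A z, sqn (num1 z (G z) / den1 z (G z) - num1 z0 (G z0) / den1 z0 (G z0)) < e / 4,
   den1 z (G z) != 0, outside z & far L Yc t z]], [set j | (N.+2 + M <= j)%N]) => /=.
  split; last by exists (N.+2 + M)%N.
  near=> z; split.
  - by near: z.
  - by near: z; exact: n2.
  - by have [] : sqn (den1 z0 (G z0)) / 4 < sqn (den1 (id z) (G z)) /\ den1 (id z) (G z) != 0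
      by near: z; exact: n1.
  - by near: z; exact: outside_near.
  - by near: z.
move=> [z j] /= [[Az hz dGz oz' fz] Mj] j0 Pj.
have zn0 : z != 0.
  apply/eqP => z0E; apply: oz'; exists 0; last by rewrite z0E.
  by rewrite /= in_itv /= oppr_le0 sqrtr_ge0.
have [m jE Mm] : exists2 m, j = (N.+1 + m).+1 & (M <= m)%N.
  have Nj : (N.+2 <= j)%N := leq_trans (leq_addr M _) Mj.
  by exists (j - N.+2)%N; [rewrite -addSn subnKC | rewrite leq_subRL].
have [[_ dm] hm] := hAJ (z, m) (conj Az (hM _ Mm)); rewrite /= in dm hm.
rewrite jE /= in Pj *.
have km : k (N.+1 + m)%N = 1%N by rewrite k1 // (leq_trans (leqnSn N)) // leq_addr.
have [c c0 hc] := pade_formula H sg0 hf km Pj.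
have dS : deg k (N.+1 + m).+1 = (deg k (N.+1 + m)%N).+1 by rewrite degS km addn1.
rewrite dS /=; have [-> ->] := hc z zn0.
have X0 := casoratian_neq0 L0 bL aL t0 fz (hY z) (hZ z) (wr z) m.
have e1 := bdry_p L0 bL aL bt0 t0 fz (hY z) (hZ z) (wr z) m.
have e2 := bdry_q L0 bL aL bt0 t0 fz (hY z) (hZ z) (wr z) m.
rewrite -/(h z m) bdryY in e1; rewrite -/(h z m) bdryZ in e2.
set X := casoratian _ _ _ _ _ in X0 e1 e2; set w := _ - _ in e1 e2.
set Dz := (cpoly _).[z] in e1 *; set Ez := (cpoly (Epoly _ _ _ _)).[z] in e2 *.
have D0 : Dz != 0.
  apply/eqP => D0; move/eqP: e1; rewrite D0 mul0r mulf_eq0 (negbTE X0) orbF.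
  by rewrite (negbTE dm).
split; first by rewrite !mulf_neq0 // invr_eq0 expf_neq0.
have -> : - (sg%:C * Ez) / Dz = num1 z (h z m) / den1 z (h z m).
  have w0 : w != 0 by exact: wr.
  have wX : w / X != 0 by rewrite mulf_neq0 // invr_eq0.
  have dE : den1 z (h z m) = Dz * (w / X) by rewrite mulrA -e1 mulfK.
  have nE : num1 z (h z m) = - (sg%:C * Ez) * (w / X).
    by rewrite mulNr -mulrA [Ez * _]mulrA -e2 mulfK.
  by rewrite dE nE -mulf_div divff // mulr1.
rewrite (F_den_num oz' dGz).
have := sqnD_le (num1 z (h z m) / den1 z (h z m) - num1 z0 (G z0) / den1 z0 (G z0))
  (- (num1 z (G z) / den1 z (G z) - num1 z0 (G z0) / den1 z0 (G z0))).
rewrite sqnN opprB addrA subrK; move: hm hz => /=; lra.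
Unshelve. all: by end_near. Qed.

End Convergence.

(** * Indices and scaling of a P-fraction *)

Section FractionData.
Variable R : realType.
Variables (s : nat -> R) (n : nat -> nat) (eps b : nat -> R) (p : nat -> {poly R})
  (f : nat -> nat -> R).
Hypothesis Hn : normal_indices s n.
Hypothesis HP : P_fraction s n eps b p f.

Lemma fraction_data_gap : fraction_data (gap n) eps b p f.
Proof.
case: Hn => _ n_mono _; case: HP => -[f00 _] hb hp hf0 hf.
split=> //; first by case=> [|j] //; case: (hf0 j).
by move=> j; rewrite subn_gt0 n_mono.
Qed.

Lemma deg_gap j : deg (gap n) j = n j.
Proof.
case: Hn => n0 n_mono _; rewrite /deg; elim: j => [|j IH]; first by rewrite big_ord0.
by rewrite big_ord_recr /= IH /gap subnKC // ltnW // n_mono.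
Qed.

Lemma index_ge j : (j <= n j)%N.
Proof.
case: Hn => n0 n_mono _; elim: j => // j IH.
exact: leq_ltn_trans IH (n_mono _ _ (ltnSn j)).
Qed.

(** Eventually n_j + 1 is again a normal index. *)
Lemma eventually_gap1 : (exists N, forall m, (N <= m)%N -> \det (hankel s m) != 0) ->
  exists N, forall j, (N <= j)%N -> gap n j = 1%N.
Proof.
move=> [N hN]; exists N => j Nj; case: (Hn) => n0 n_mono hn.
have Nn : (N <= (n j).+1)%N by rewrite leqW // (leq_trans Nj) // index_ge.
have [i i0 iE] := (hn (n j).+1 isT).1 (hN _ Nn).
have ij : (j < i)%N.
  have [ij|//|ij] := ltngtP i j.
    by have := n_mono _ _ ij; rewrite iE ltnNge leqnSn.
  by move: iE; rewrite ij => /eqP; rewrite ltn_eqF.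
have ji : (i <= j.+1)%N.
  rewrite leqNgt; apply/negP => /n_mono; rewrite iE ltnS.
  by rewrite leqNgt n_mono.
have -> : gap n j = (n i - n j)%N.
  by rewrite /gap; congr (n _ - _)%N; apply/eqP; rewrite eqn_leq ij ji.
by rewrite iE subSnn.
Qed.

(** Otherwise, division by 0 being 0, all coefficients of f_0 would vanish, and
    F_0 would have no reciprocal. *)
Lemma scale_gt0 : 0 < `|s (n 1%N).-1|.
Proof.
rewrite lt_def normr_ge0 andbT; apply/eqP => sg0.
have [_ _ _ _ /(_ 0%N (gap n 0))] := fraction_data_gap.
rewrite /series_mul eqxx big1 => [/eqP|i _]; first by rewrite eq_sym oppr_eq0 oner_eq0.
case: HP => -[f00 f0S] _ _ _ _.
by case: (nat_of_ord i) => [|m]; rewrite ?f00 ?f0S ?sg0 ?invr0 ?mulr0 mul0r.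
Qed.

Lemma fraction_geometric : geom_bounded s -> geom_bounded (f 0%N).
Proof.
move=> [C [r [C1 r1 hs]]]; case: HP => -[f00 f0S] _ _ _ _.
have sg0 := scale_gt0; move: (`|s (n 1%N).-1|) sg0 f0S => sg sg0 f0S.
have r0 : 0 <= r by apply: le_trans r1.
have C0 : 0 <= C by apply: le_trans C1.
exists (C / sg + 1), r; split=> //; first by rewrite lerDr divr_ge0 // ltW.
case=> [|m].
  by rewrite f00 normr0 mulr_ge0 ?exprn_ge0 // addr_ge0 // divr_ge0 // ltW.
rewrite f0S normrM normrN normfV (gtr0_norm sg0).
apply: le_trans (ler_wpM2r _ (hs m)) _; first by rewrite invr_ge0 ltW.
rewrite mulrAC; apply: ler_pM; rewrite ?exprn_ge0 ?divr_ge0 ?(ltW sg0) //.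
  by rewrite lerDl.
exact: ler_weXn2l.
Qed.

(** At an index outside N_F the quotient is 0 by the convention on division, so
    the bound holds at all indices. *)
Lemma kappa_bounded :
  (ereal_sup [set (`|b j.-1 * ((P_poly eps b p j).[0] / (P_poly eps b p j.-1).[0])|)%:E
     | j in NF_index eps b p] < +oo)%E ->
  exists2 B : R, 0 <= B & forall j, `|kappa eps b p j| <= B.
Proof.
set A := (X in ereal_sup X) => hA.
exists (Num.max 0 (fine (ereal_sup A))); first by rewrite le_max lexx.
move=> j; rewrite le_max; have [P0|P0] := eqVneq (P_poly eps b p j).[0] 0.
  by rewrite /kappa P0 invr0 !mulr0 normr0 lexx.
have /ereal_sup_ubound : A (`|kappa eps b p j|)%:E by exists j.+1.
by move: hA; case: (ereal_sup A) => [r _|//|//]; rewrite lee_fin => ->; rewrite orbT.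
Qed.

End FractionData.

(** * Uniform convergence on compact sets *)

Section Uniform.
Variable R : realType.
Local Notation C := R[i].

Lemma compact_uniform (K : set C) (NF : set nat) (Q : C -> nat -> Prop) :
  compact K -> (forall z, K z -> \forall z' \near z & j \near \oo, NF j -> Q z' j) ->
  \forall j \near within NF \oo, forall z, K z -> Q z j.
Proof.
move=> /compact_near_coveringP cK hQ.
have := cK nat (within NF \oo) (fun j z => Q z j) _.
apply => z Kz; have [[A J] /= [hA hJ] hAJ] := hQ _ Kz.
exists (A, [set j | J j /\ NF j]) => /=.
  by split=> //; apply: filterS hJ => j Jj NFj.
by move=> [z' j] /= [Az' [Jj NFj]]; apply: (hAJ (z', j)).
Qed.

Lemma family_uniform (Om : set C) (h : nat -> C -> C) (F : C -> C) (NF : set nat) :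
  (forall K e, compactly_in Om K -> 0 < e ->
    \forall j \near within NF \oo, forall z, K z -> sqn (h j z - F z) < e) ->
  {family compactly_in Om, h @ within NF \oo --> F}.
Proof.
move=> hc; apply/fam_cvgP => K cK U /uniform_nbhs [E [/=]].
rewrite -entourage_from_ballE => -[e /= e0 eE] hU.
have [r er] : exists r, e = r%:C.
  by exists (complex.Re e); move: e0; case: e {eE} => x y; rewrite ltcE /= => /andP[/eqP -> _].
rewrite er ltcR in e0.
apply: filterS (hc K (r ^+ 2) cK (exprn_gt0 2 e0)) => j hj.
apply: hU => z Kz; apply: eE => /=.
by rewrite er -ball_normE /= norm_lt_sqn // -sqnN opprB hj.
Qed.

End Uniform.

Theorem theorem3p5 (R : realType)
    (sigma : {finite_measure set (measurableTypeR R) -> \bar R})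
    (q1 w1 q2 w2 : {poly R}) (s : nat -> R) (rho : R)
    (n : nat -> nat) (eps b : nat -> R) (p : nat -> {poly R})
    (f : nat -> nat -> R)
    (phi := fun z : R[i] =>
       rat_eval q1 w1 z * cauchy_transform sigma z + rat_eval q2 w2 z)
    (F := mero_val phi)
    (P := P_poly eps b p)
    (NF := NF_index eps b p) :
  w1 != 0 -> (size q1 <= size w1)%N ->
  (forall x : R, w1.[x] != 0 -> 0 <= q1.[x] / w1.[x]) ->
  w2 != 0 -> (size q2 < size w2)%N ->
  (forall z : R[i], rho%:C < `|z| ->
     series (fun j => - (s j)%:C / z ^+ j.+1) @ \oo --> F z) ->
  (exists N, forall m, (N <= m)%N -> \det (hankel s m) != 0) ->
  normal_indices s n ->
  P_fraction s n eps b p f ->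
  (ereal_sup [set (`|b j.-1 * ((P j).[0] / (P j.-1).[0])|)%:E | j in NF]
     < +oo)%E ->
  exists2 e : R, 0 < e &
    let Omega := ~` (real_segment (-1 - e) (1 + e) `|` poles phi) in
    (forall K, compactly_in Omega K ->
       \forall j \near within NF \oo,
         forall z, K z -> pade_den s (n j) (n j).-1 z != 0) /\
    {family compactly_in Omega,
       (fun j => pade s (n j) (n j).-1) @ within NF \oo --> F}.
Proof.
move=> w10 _ qpos w20 _ hser hdet Hn HP hsup.
have H := fraction_data_gap Hn HP.
have sg0 := scale_gt0 Hn HP.
have hf : forall m, f 0%N m.+1 = - s m / `|s (n 1%N).-1| by case: HP => -[].
have [N0 k1] := eventually_gap1 Hn hdet.
have Wn0 := weight_den_neq0 w10 w20.
have hpos h : 0 <= mom (momf f) (weight_den w1 w2 * h * (weight_den w1 w2 * h)).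
  rewrite -(pmulr_rge0 _ sg0) -(mom_momf sg0 hf) -mulrA.
  rewrite (moment_identity w10 w20 hser) /ratint; apply: Rintegral_ge0 => t _.
  rewrite hornerC divr1 (hornerM _ (weight_num q1 w1 w2)) mulr_ge0 ?weight_num_ge0 //.
  rewrite mulrCA -expr2 /weight_den (hornerM (_ ^+ 2)) !horner_exp.
  by rewrite mulr_ge0 ?sqr_ge0.
have [N N0N eps1] := eventually_eps1 H k1 Wn0 hpos.
have {}k1 j : (N <= j)%N -> gap n j = 1%N by move=> Nj; rewrite k1 // (leq_trans N0N).
have [K K1 hK] := tail_bounded H k1 eps1 (fraction_geometric Hn HP (geometric_s hser)).
have [B B0 hB] := kappa_bounded hsup.
set Rd := Num.sqrt (9 * (K + B + 1) ^+ 2).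
have Rd1 : 1 < Rd.
  rewrite -[ltLHS]sqrtr1 ltr_sqrt; first by nra.
  by rewrite mulr_gt0 // exprn_gt0 // ltr_wpDl // addr_ge0 // (le_trans ler01).
(* For this e the segment [-1 - e, 1 + e] is [-Rd, Rd], which contains the
   spectra of the truncations. *)
exists (Rd - 1); first by rewrite subr_gt0.
move=> Omega.
have unif A e : compactly_in Omega A -> 0 < e -> \forall j \near within NF \oo,
    forall z, A z -> pade_den s (n j) (n j).-1 z != 0 /\
                     sqn (pade s (n j) (n j).-1 z - F z) < e.
  move=> [AO cA] e0; apply: compact_uniform cA _ => z /AO zO.
  have oz : ~ real_segment (- Rd) Rd z.
    move=> zs; apply: zO; left; move: zs; congr (real_segment _ _ z); ring.
  have pz : ~ poles phi z by move=> zp; apply: zO; right.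
  have := pade_local w10 w20 qpos hser H sg0 hf k1 eps1 K1 hK B0 hB oz pz e0.
  by apply: filterS => -[z' j] /= hz [j0 Pj]; rewrite -(deg_gap Hn); apply: hz.
split=> [A cA|].
  by apply: filterS (unif A 1 cA ltr01) => j hj z /hj [].
by apply: family_uniform => A e cA e0; apply: filterS (unif A e cA e0) => j hj z /hj [].
Qed.
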